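(* Let $W\subset\mathbb{R}^d$ be a compact convex set with $\mathrm{Vol}_d(W)>0$, let $\Lambda$ be a non-atomic locally finite measure on the space $\mathcal{H}$ of affine hyperplanes of $\mathbb{R}^d$, let $t>0$, and let $Y(t,W)$ be the random tessellation of $W$ obtained from the MNW-construction driven by $\Lambda$ up to time $t$. Let $\zeta$ be a bounded measurable even function on the unit sphere, put $\phi(f):=\mathrm{Vol}_{d-1}(f)\,\zeta(\vec{\mathbf n}(f))$ for $(d-1)$-dimensional facets $f$ with unit normal $\vec{\mathbf n}(f)$, and let $\Sigma_\phi(Y(t,W)):=\sum_f\phi(f)$, the sum being over all I-facets $f$ of $Y(t,W)$. Then $$\mathrm{Var}\big(\Sigma_\phi(Y(t,W))\big)=\int_{[W]}\zeta^2(\vec{\mathbf n}(H))\int_{W\cap H}\int_{W\cap H}\frac{1-\exp(-t\Lambda([xy]))}{\Lambda([xy])}\,dx\,dy\,\Lambda(dH).$$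
   Context: For $B\subset\mathbb{R}^d$, $[B]:=\{H\in\mathcal{H}:H\cap B\ne\emptyset\}$; $[xy]$ denotes the set of hyperplanes hitting the segment joining $x$ and $y$; $\vec{\mathbf n}(H)$ is a unit normal of $H$; $dx,dy$ denote $(d-1)$-dimensional Lebesgue measure on $H$. The integrand $\frac{1-e^{-ta}}{a}$ is read as $\int_0^te^{-sa}ds$, i.e. as $t$ when $a=0$. Locally finite means $\Lambda([B])<\infty$ for bounded $B$. MNW-construction of $Y(t,W)$: at time $0$ there is a single cell $W$. Every cell $c$ present is given, independently, an exponentially distributed lifetime with parameter $\Lambda([c])$. When the lifetime of $c$ expires, $c$ is split into two sub-cells by a random hyperplane $H\in[c]$ with law $\Lambda(\cdot\cap[c])/\Lambda([c])$; the new cells $c^\pm$ receive independent exponential lifetimes with parameters $\Lambda([c^\pm])$, and so on, until the deterministic time $t$. The cell-separating pieces $c\cap H$ arising in the splits are the I-facets of $Y(t,W)$. *)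

(* Defs.v *)
From HB Require Import structures.
From mathcomp Require Import all_boot all_order all_algebra.
From mathcomp Require Import all_classical all_reals all_analysis.
From mathcomp Require Import measurable_realfun ring.

Set Implicit Arguments.
Unset Strict Implicit.
Unset Printing Implicit Defensive.

Import Order.TTheory GRing.Theory Num.Theory.
Import numFieldNormedType.Exports.

Local Open Scope classical_set_scope.
Local Open Scope ring_scope.

(* The space R^n is 'rV[R]_n. Its sigma-algebra is the one generated by the   *)
(* coordinates, i.e. the n-fold product of the Borel sigma-algebra of R,      *)
(* which is the Borel sigma-algebra of R^n.                                   *)
Section borel_rV.
Variables (R : realType) (n : nat).

Definition rV_cylinders : set (set 'rV[R]_n) :=
  [set A | exists (i : 'I_n) (B : set R),
     measurable B /\ A = (fun x : 'rV[R]_n => x 0 i) @^-1` B].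

HB.instance Definition _ := @isMeasurable.Build (sigma_display rV_cylinders)
  'rV[R]_n <<s rV_cylinders >> (@sigma_algebra0 _ setT rV_cylinders)
  (@sigma_algebraC _ rV_cylinders) (@sigma_algebra_bigcup _ setT rV_cylinders).

Lemma measurable_coord (i : 'I_n) :
  measurable_fun [set: 'rV[R]_n] (fun x : 'rV[R]_n => x 0 i).
Proof.
move=> _ B mB; rewrite setTI; apply: sub_sigma_algebra.
by exists i, B.
Qed.

Lemma measurable_fun_coordP d (T : measurableType d) (f : T -> 'rV[R]_n) :
  measurable_fun [set: T] f <->
  forall i, measurable_fun [set: T] (fun t => f t 0 i).
Proof.
split=> [mf i|mf].
  exact: (measurableT_comp (measurable_coord i) mf).
apply: (measurability rV_cylinders) => //.
move=> _ [_ [i [B [mB ->]]] <-].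
by have := mf i measurableT B mB.
Qed.

End borel_rV.

(* n-dimensional Lebesgue measure on R^n, by R^(n+1) = R x R^n; on the        *)
(* one-point space R^0 it is the unit mass (counting measure).                *)
Section lebesgue_rV.
Variable R : realType.

Definition cons_rV n (p : R * 'rV[R]_n) : 'rV[R]_n.+1 :=
  row_mx (const_mx p.1 : 'rV[R]_1) p.2.

Lemma cons_rV0 n (p : R * 'rV[R]_n) : cons_rV p 0 0 = p.1.
Proof.
transitivity (cons_rV p 0 (lshift n (0 : 'I_1))).
  by congr (cons_rV p 0 _); exact/val_inj.
by rewrite [LHS](row_mxEl (const_mx p.1 : 'rV[R]_1)) mxE.
Qed.

Lemma cons_rVS n (p : R * 'rV[R]_n) (i : 'I_n) :
  cons_rV p 0 (lift ord0 i) = p.2 0 i.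
Proof.
transitivity (cons_rV p 0 (rshift 1 i)).
  by congr (cons_rV p 0 _); exact/val_inj.
exact: (row_mxEr (const_mx p.1 : 'rV[R]_1)).
Qed.

Lemma measurable_cons_rV n : measurable_fun setT (@cons_rV n).
Proof.
apply/measurable_fun_coordP => i; case: (unliftP ord0 i) => [j|] ->.
  under eq_fun do rewrite cons_rVS.
  exact: (measurableT_comp (measurable_coord j) measurable_snd).
under eq_fun do rewrite cons_rV0.
exact: measurable_fst.
Qed.

HB.instance Definition _ n := isMeasurableFun.Build _ _ _ _ (@cons_rV n)
  (@measurable_cons_rV n).

Section step.
Variables (n : nat) (m : {sigma_finite_measure set 'rV[R]_n -> \bar R}).

Definition lebesgue_cons : set 'rV[R]_n.+1 -> \bar R :=
  pushforward (@lebesgue_measure R \x m)%E (@cons_rV n).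

Let lebesgue_cons0 : lebesgue_cons set0 = 0%E.
Proof. by rewrite /lebesgue_cons /pushforward preimage_set0 measure0. Qed.

Let lebesgue_cons_ge0 A : (0 <= lebesgue_cons A)%E.
Proof. exact: (measure_ge0 (@lebesgue_measure R \x m)%E). Qed.

Let lebesgue_cons_sigma_additive : semi_sigma_additive lebesgue_cons.
Proof.
rewrite /lebesgue_cons.
apply: (@measure_semi_sigma_additive _ _ _ (pushforward _ _)).
exact: measurable_cons_rV.
Qed.

HB.instance Definition _ := isMeasure.Build _ _ _ lebesgue_cons
  lebesgue_cons0 lebesgue_cons_ge0 lebesgue_cons_sigma_additive.

Lemma lebesgue_cons_sigma_finite : sigma_finite setT lebesgue_cons.
Proof.
have /sigma_finiteP[F [TF ndF Foo]] := sigma_finiteT (@lebesgue_measure R).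
have /sigma_finiteP[G [TG ndG Goo]] := sigma_finiteT m.
pose split (x : 'rV[R]_n.+1) : R * 'rV[R]_n := (x 0 0, \row_i x 0 (lift ord0 i)).
have consK : cancel (@cons_rV n) split.
  move=> [a x]; rewrite /split cons_rV0; congr pair; apply/rowP => i.
  by rewrite mxE cons_rVS.
have msplit : measurable_fun setT split.
  apply: measurable_fun_pair; first exact: measurable_coord.
  apply/measurable_fun_coordP => i.
  under eq_fun do rewrite mxE.
  exact: measurable_coord.
exists (fun k => split @^-1` (F k `*` G k)).
  rewrite -preimage_bigcup; apply/seteqP; split=> // x _ /=.
  have [i _ Fi] : (\bigcup_i F i) (split x).1 by rewrite -TF.
  have [j _ Gj] : (\bigcup_j G j) (split x).2 by rewrite -TG.
  exists (maxn i j) => //; split.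
    exact: (subsetPset _ _ (ndF _ _ (leq_maxl i j))).
  exact: (subsetPset _ _ (ndG _ _ (leq_maxr i j))).
move=> k; have [mFk Fkoo] := Foo k; have [mGk Gkoo] := Goo k; split.
  by rewrite -[X in measurable X]setTI; apply: msplit => //; exact: measurableX.
rewrite /lebesgue_cons /pushforward -comp_preimage.
rewrite (_ : split \o _ = id); last by apply/funext => p /=; rewrite consK.
by rewrite preimage_id product_measure1E// lte_mul_pinfty// ge0_fin_numE.
Qed.

HB.instance Definition _ := Measure_isSigmaFinite.Build _ _ _ lebesgue_cons
  lebesgue_cons_sigma_finite.

End step.

Fixpoint lebesgue_rV n : {sigma_finite_measure set 'rV[R]_n -> \bar R} :=
  if n is n'.+1 then lebesgue_cons (lebesgue_rV n') else \d_(0 : 'rV[R]_0).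

End lebesgue_rV.

Section hyperplanes.
Variables (R : realType) (n : nat).
Local Notation E := 'rV[R]_n.+1.
Implicit Types (u v x y : E).

Definition dotr u v : R := \sum_i u 0 i * v 0 i.

Definition unit_sphere : set E := [set u | dotr u u = 1].

(* The unit normal of a hyperplane is made unique by requiring its first      *)
(* nonzero coordinate to be positive.                                         *)
Definition oriented_unit u : bool :=
  (dotr u u == 1) &&
  [exists i, (0 < u 0 i) && [forall j : 'I_n.+1, (j < i)%N ==> (u 0 j == 0)]].

(* Affine hyperplanes of R^(n+1), as pairs of their oriented unit normal u    *)
(* and the r with H = {x | <u, x> = r}; see hyperplane_existsuniq below.      *)
Record hyperplane := Hyperplane {
  hyperplane_coord : E * R;
  _ : oriented_unit hyperplane_coord.1 }.

HB.instance Definition _ := [isSub for hyperplane_coord].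
HB.instance Definition _ := [Choice of hyperplane by <:].

Implicit Types H : hyperplane.

Definition normal H : E := (hyperplane_coord H).1.
Definition offset H : R := (hyperplane_coord H).2.
Definition points H : set E := [set x | dotr (normal H) x = offset H].

Lemma dotrC u v : dotr u v = dotr v u.
Proof. by apply: eq_bigr => i _; rewrite mulrC. Qed.

Lemma dotrDl u v x : dotr (u + v) x = dotr u x + dotr v x.
Proof. by rewrite -big_split /=; apply: eq_bigr => i _; rewrite mxE mulrDl. Qed.

Lemma dotrZl a u x : dotr (a *: u) x = a * dotr u x.
Proof. by rewrite mulr_sumr; apply: eq_bigr => i _; rewrite mxE mulrA. Qed.

Lemma dotrNl u x : dotr (- u) x = - dotr u x.
Proof. by rewrite -scaleN1r dotrZl mulN1r. Qed.

Lemma dotrDr u v x : dotr x (u + v) = dotr x u + dotr x v.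
Proof. by rewrite dotrC dotrDl !(dotrC x). Qed.

Lemma dotrZr a u x : dotr x (a *: u) = a * dotr x u.
Proof. by rewrite dotrC dotrZl dotrC. Qed.

Lemma dotrNr u x : dotr x (- u) = - dotr x u.
Proof. by rewrite dotrC dotrNl dotrC. Qed.

Definition dotrE := (dotrDl, dotrDr, dotrZl, dotrZr, dotrNl, dotrNr).

Lemma dotr_ge0 u : 0 <= dotr u u.
Proof. by apply: sumr_ge0 => i _; rewrite -expr2 sqr_ge0. Qed.

Lemma dotr_eq0 u : (dotr u u == 0) = (u == 0).
Proof.
apply/idP/eqP => [|->]; last first.
  by rewrite /dotr big1 // => i _; rewrite mxE mul0r.
rewrite psumr_eq0 => [/allP u0|i _]; last by rewrite -expr2 sqr_ge0.
apply/rowP => i; rewrite mxE; apply/eqP.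
by have := u0 i (mem_index_enum i); rewrite -expr2 sqrf_eq0.
Qed.

Lemma dotr_normal H : dotr (normal H) (normal H) = 1.
Proof. by case/andP: (valP H) => /eqP. Qed.

Lemma oriented_unit_ge0 u : oriented_unit u -> 0 <= u 0 0.
Proof.
move=> /andP[_ /existsP[i /andP[ui /forallP u0]]].
have [i0|i0] := posnP i; first by rewrite (_ : 0 = i) ?ltW //; exact/val_inj.
by have := u0 0; rewrite i0 => /eqP ->.
Qed.

Lemma oriented_unitN u : oriented_unit u -> ~~ oriented_unit (- u).
Proof.
move=> /andP[_ /existsP[i /andP[ui /forallP ui0]]].
apply/negP => /andP[_ /existsP[j /andP[uj /forallP uj0]]].
rewrite mxE oppr_gt0 in uj.
have [ij|ji|ij] := ltngtP i j.
- by have := uj0 i; rewrite ij mxE oppr_eq0 gt_eqF.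
- by have := ui0 j; rewrite ji lt_eqF.
- by move: uj; rewrite -(val_inj ij) => /(lt_trans ui); rewrite ltxx.
Qed.

Lemma oriented_unit_or u : dotr u u = 1 -> oriented_unit u || oriented_unit (- u).
Proof.
move=> u1; have [i ui] : exists i, u 0 i != 0.
  apply/existsP; apply: contra_eqT u1; rewrite negb_exists => /forallP u0.
  rewrite /dotr big1 1?eq_sym ?oner_eq0 // => i _.
  by have := u0 i; rewrite negbK => /eqP ->; rewrite mul0r.
have [k uk kmin] := @arg_minnP _ i (fun i => u 0 i != 0) val ui.
have below (j : 'I_n.+1) : (j < k)%N -> u 0 j == 0.
  by apply: contraTT => uj; rewrite -leqNgt; exact: kmin.
rewrite /oriented_unit !dotrE opprK u1 eqxx /=; apply/orP.
have [k0|k0|k0] := ltgtP (u 0 k) 0; last by rewrite k0 eqxx in uk.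
- right; apply/existsP; exists k; rewrite mxE oppr_gt0 k0.
  by apply/forallP => j; apply/implyP => /below; rewrite mxE oppr_eq0.
- left; apply/existsP; exists k; rewrite k0.
  by apply/forallP => j; apply/implyP => /below.
Qed.

Lemma points_inj : injective points.
Proof.
move=> H K HK; have u1 := dotr_normal H; have v1 := dotr_normal K.
set u := normal H in u1; set v := normal K in v1.
have onH x : dotr u x = offset H -> dotr v x = offset K.
  by move=> Hx; have : points K x by rewrite -HK.
pose w := v - dotr u v *: u.
have uw : dotr u w = 0 by rewrite !dotrE u1 mulr1 subrr.
have vw : dotr v w = 0.
  have r0 : dotr v (offset H *: u) = offset K.
    by apply: onH; rewrite dotrE u1 mulr1.
  have := onH (offset H *: u + w).
  rewrite !(dotrDr (offset H *: u)) r0 dotrZr u1 mulr1 uw addr0 => /(_ erefl).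
  by move/eqP; rewrite -subr_eq0 addrAC subrr add0r => /eqP.
have vE : v = dotr u v *: u.
  apply/eqP; rewrite -subr_eq0 -dotr_eq0 -/w {1}/w dotrDl dotrNl dotrZl.
  by rewrite uw vw mulr0 subr0.
have uv : v = u.
  have : dotr u v ^+ 2 == 1.
    by rewrite expr2 -[X in _ == X]v1 {3}vE dotrZl.
  rewrite sqrf_eq1 => /orP[] /eqP c; move: vE; rewrite c ?scale1r// scaleN1r => vN.
  have := valP K; rewrite -[(val K).1]/v vN => ou.
  by have := oriented_unitN (valP H); rewrite ou.
have rs : offset K = offset H.
  by rewrite -(onH (offset H *: u)) ?uv dotrZr u1 mulr1.
apply: val_inj; rewrite /= [LHS]surjective_pairing [RHS]surjective_pairing.
by congr pair.
Qed.

Lemma hyperplane_existsuniq u r : u != 0 ->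
  exists! H, points H = [set x | dotr u x = r].
Proof.
move=> u0; have uu : 0 < dotr u u by rewrite lt_neqAle eq_sym dotr_eq0 u0 dotr_ge0.
pose c := Num.sqrt (dotr u u).
have c0 : c != 0 by rewrite sqrtr_eq0 -ltNge.
have [H HE] : exists H, points H = [set x | dotr u x = r].
  have : dotr (c^-1 *: u) (c^-1 *: u) = 1.
    rewrite dotrZl dotrZr -[X in _ * (_ * X)](sqr_sqrtr (ltW uu)) -/c expr2.
    by rewrite mulKf // mulVf.
  move=> /oriented_unit_or /orP[] ou.
    exists (@Hyperplane (c^-1 *: u, c^-1 * r) ou).
    apply/seteqP; split=> x; rewrite /points /normal /offset /= dotrZl.
      by move/(mulfI (invr_neq0 c0)).
    by move=> ->.
  exists (@Hyperplane (- (c^-1 *: u), - (c^-1 * r)) ou).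
  apply/seteqP; split=> x; rewrite /points /normal /offset /= dotrNl dotrZl.
    by move=> /oppr_inj /(mulfI (invr_neq0 c0)).
  by move=> ->.
by exists H; split => // K KE; apply: points_inj; rewrite HE.
Qed.

Lemma oriented_unit_e0 : oriented_unit (delta_mx 0 0).
Proof.
apply/andP; split.
  rewrite /dotr big_ord_recl big1 => [|i _]; rewrite !mxE ?mul0r //=.
  by rewrite mulr1 addr0.
by apply/existsP; exists ord0; rewrite mxE ltr01 /=; apply/forallP.
Qed.

HB.instance Definition _ := isPointed.Build hyperplane
  (@Hyperplane (delta_mx 0 0, 0) oriented_unit_e0).

Definition hits (B : set E) : set hyperplane :=
  [set H | points H `&` B !=set0].

(* The Borel sigma-algebra of the usual (Fell) topology on hyperplanes.       *)
Definition hit_sets : set (set hyperplane) := [set hits K | K in compact].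

HB.instance Definition _ := @isMeasurable.Build (sigma_display hit_sets)
  hyperplane <<s hit_sets >> (@sigma_algebra0 _ setT hit_sets)
  (@sigma_algebraC _ hit_sets) (@sigma_algebra_bigcup _ setT hit_sets).

(* The isometry from R^n onto H: x is sent to r u + (0, x) Q with Q the       *)
(* reflection exchanging e_0 and - u, i.e. the one in the hyperplane          *)
(* orthogonal to u + e_0.                                                     *)
Definition chart H (x : 'rV[R]_n) : E :=
  let u := normal H in
  let x' := cons_rV (0, x) in
  offset H *: u + (x' - (dotr x' u / (1 + u 0 0)) *: (u + delta_mx 0 0)).

Lemma dotr_e0 x : dotr x (delta_mx 0 0) = x 0 0.
Proof.
rewrite /dotr (bigD1 0) //= big1 ?addr0 ?mxE ?eqxx ?mulr1 // => i i0.
by rewrite mxE /= (negbTE i0) mulr0.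
Qed.

Lemma normal00 H : 1 + normal H 0 0 != 0.
Proof.
by rewrite gt_eqF // ltr_wpDr // oriented_unit_ge0 //; case: H.
Qed.

Lemma cons_rVB (x y : 'rV[R]_n) :
  cons_rV (0, x) - cons_rV (0, y) = cons_rV (0, x - y) :> E.
Proof.
apply/rowP => i; rewrite [LHS]mxE [X in _ + X]mxE.
by case: (unliftP ord0 i) => [j|] ->; rewrite ?cons_rV0 ?subrr // !cons_rVS !mxE.
Qed.

Lemma chart_isometry H (x y : 'rV[R]_n) :
  dotr (chart H x - chart H y) (chart H x - chart H y) =
  \sum_i (x 0 i - y 0 i) ^+ 2.
Proof.
have c0 := normal00 H; set u := normal H in c0 *.
pose z := cons_rV (0, x - y) : E.
have zz : dotr z z = \sum_i (x 0 i - y 0 i) ^+ 2.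
  rewrite /dotr big_ord_recl cons_rV0 mul0r add0r; apply: eq_bigr => i _.
  by rewrite cons_rVS !mxE expr2.
have -> : chart H x - chart H y =
    z - (dotr z u / (1 + u 0 0)) *: (u + delta_mx 0 0).
  rewrite /z -cons_rVB /chart -/u dotrDl dotrNl mulrBl scalerBl.
  rewrite opprD addrACA subrr add0r opprD addrACA; congr (_ + _).
  by rewrite opprB opprK addrC.
set a := dotr z u.
have z0 : dotr z (delta_mx 0 0) = 0 by rewrite dotr_e0 cons_rV0.
have e0 : dotr (delta_mx 0 0) (delta_mx 0 0) = 1 by rewrite dotr_e0 mxE.
rewrite -zz !dotrE (dotrC u z) (dotrC _ z) z0 -/a e0 dotr_normal.
rewrite (dotrC _ u) dotr_e0 addr0.
move: a (dotr z z) (u 0 0) c0 => a b c c0.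
by field.
Qed.

Lemma range_chart H : range (chart H) = points H.
Proof.
have c0 := normal00 H; have u1 := dotr_normal H.
apply/seteqP; split=> [_ [x _ <-]|y Hy].
  rewrite /points /= /chart; set u := normal H in c0 u1 *.
  rewrite !dotrE u1 (dotrC u) dotr_e0.
  by field.
set u := normal H in c0 u1.
pose z := y - offset H *: u.
have uz : dotr z u = 0.
  by rewrite !dotrE u1 mulr1 (dotrC y) Hy subrr.
pose x' := z - (z 0 0 / (1 + u 0 0)) *: (u + delta_mx 0 0).
have x'0 : x' 0 0 = 0.
  by rewrite !mxE /=; field.
exists (\row_i x' 0 (lift ord0 i)) => //.
have x'E : cons_rV (0, \row_i x' 0 (lift ord0 i)) = x'.
  apply/rowP => i; case: (unliftP ord0 i) => [j|] ->.
    by rewrite cons_rVS mxE.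
  by rewrite cons_rV0; exact/esym.
rewrite /chart x'E -/u.
have -> : dotr x' u = - z 0 0.
  by rewrite /x' (dotrDl z) uz dotrNl dotrZl dotrDl u1 (dotrC _ u) dotr_e0; field.
rewrite mulNr scaleNr opprK /x' subrK /z addrC subrK //.
Qed.

Lemma measurable_chart H : measurable_fun setT (chart H).
Proof.
have mx' i : measurable_fun setT (fun x : 'rV[R]_n => cons_rV (0, x) 0 i).
  case: (unliftP ord0 i) => [j|] ->.
    under eq_fun do rewrite cons_rVS /=.
    exact: measurable_coord.
  under eq_fun do rewrite cons_rV0 /=.
  exact: measurable_cst.
apply/measurable_fun_coordP => i.
rewrite (_ : (fun t => chart H t 0 i) = fun x : 'rV[R]_n =>
    offset H * normal H 0 i + (cons_rV (0, x) 0 i -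
    (dotr (cons_rV (0, x)) (normal H) / (1 + normal H 0 0)) *
    (normal H 0 i + (delta_mx 0 0 : E) 0 i))); last first.
  by apply/funext => x; rewrite /chart; move: (cons_rV _) => x'; rewrite !mxE.
apply: measurable_funD => //; apply: measurable_funB => //.
apply: measurable_funM => //; apply: measurable_funM => //.
by apply: measurable_sum => j; apply: measurable_funM.
Qed.

(* Lebesgue measure of dimension n on H, as a measure on R^(n+1).             *)
Definition hyperplane_lebesgue H : set E -> \bar R :=
  pushforward (lebesgue_rV R n) (chart H).

Section hyperplane_lebesgue_measure.
Variable H : hyperplane.

Let hyperplane_lebesgue0 : hyperplane_lebesgue H set0 = 0%E.
Proof.
by rewrite /hyperplane_lebesgue /pushforward preimage_set0 measure0.
Qed.

Let hyperplane_lebesgue_ge0 A : (0 <= hyperplane_lebesgue H A)%E.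
Proof. exact: (measure_ge0 (lebesgue_rV R n)). Qed.

Let hyperplane_lebesgue_sigma_additive :
  semi_sigma_additive (hyperplane_lebesgue H).
Proof.
rewrite /hyperplane_lebesgue.
apply: (@measure_semi_sigma_additive _ _ _ (pushforward _ _)).
exact: measurable_chart.
Qed.

HB.instance Definition _ := isMeasure.Build _ _ _ (hyperplane_lebesgue H)
  hyperplane_lebesgue0 hyperplane_lebesgue_ge0
  hyperplane_lebesgue_sigma_additive.

End hyperplane_lebesgue_measure.

End hyperplanes.

Section facet_functional.
Variables (R : realType) (n : nat).
Local Notation E := 'rV[R]_n.+1.

(* For an n-dimensional facet f this hyperplane is unique; for f of smaller   *)
(* dimension any choice gives f volume 0.                                     *)
Definition facet_hyperplane (f : set E) : hyperplane R n :=
  xget point [set H | f `<=` points H].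

Definition facet_normal (f : set E) : E := normal (facet_hyperplane f).

Definition facet_volume (f : set E) : R :=
  fine (hyperplane_lebesgue (facet_hyperplane f) f).

Definition facet_phi (zeta : E -> R) (f : set E) : R :=
  facet_volume f * zeta (facet_normal f).

End facet_functional.

Section mnw_construction.
Variables (R : realType) (n : nat).
Local Notation E := 'rV[R]_n.+1.

Definition segment (x y : E) : set E :=
  [set x + s *: (y - x) | s in `[0, 1]%classic].

Definition halfspace (b : bool) (H : hyperplane R n) : set E :=
  if b then [set x | offset H <= dotr (normal H) x]
  else [set x | dotr (normal H) x <= offset H].

(* The cells that may ever appear are indexed by bit sequences: [::] is W and *)
(* the two sub-cells of v are b :: v, so that the ancestors of v are its      *)
(* suffixes. L v is the lifetime of the cell v, h v the hyperplane splitting  *)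
(* it.                                                                        *)
Fixpoint cell (W : set E) (h : seq bool -> hyperplane R n) (v : seq bool) :
    set E :=
  if v is b :: v' then cell W h v' `&` halfspace b (h v') else W.

Fixpoint birth (L : seq bool -> \bar R) (v : seq bool) : \bar R :=
  if v is _ :: v' then (birth L v' + L v')%E else 0%E.

Definition split_before (L : seq bool -> \bar R) (t : R) : set (seq bool) :=
  [set v | (birth L v + L v <= t%:E)%E].

Definition Ifacet (W : set E) (h : seq bool -> hyperplane R n) (v : seq bool) :
    set E :=
  cell W h v `&` points (h v).

Definition Sigma_phi (zeta : E -> R) (W : set E)
    (L : seq bool -> \bar R) (h : seq bool -> hyperplane R n) (t : R) : R :=
  \sum_(v \in split_before L t) facet_phi zeta (Ifacet W h v).

Variable Lambda : {measure set (hyperplane R n) -> \bar R}.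

Definition locally_finite : Prop :=
  forall B : set E, bounded_set B -> measurable (hits B) ->
    (Lambda (hits B) < +oo)%E.

Definition non_atomic : Prop :=
  forall A, measurable A -> (0 < Lambda A)%E ->
    exists B, [/\ measurable B, B `<=` A & (0 < Lambda B < Lambda A)%E].

(* The exponential law of parameter a >= 0; for a = 0 the lifetime is +oo.    *)
Definition lifetime_law (a : R) (S : set (\bar R)) : \bar R :=
  if a == 0 then \d_(+oo%E : \bar R) S
  else exponential_prob a (EFin @^-1` S).

(* A cell c with Lambda [c] = 0 is never split, so the value of its splitting *)
(* hyperplane is irrelevant and set to a default.                             *)
Definition split_law (c : set E) (B : set (hyperplane R n)) : \bar R :=
  if Lambda (hits c) == 0%E then \d_(point : hyperplane R n) B
  else (Lambda (B `&` hits c) * ((fine (Lambda (hits c)))^-1)%:E)%E.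

Variables (d : measure_display) (Omega : measurableType d).
Variables (L : seq bool -> Omega -> \bar R).
Variables (h : seq bool -> Omega -> hyperplane R n).

(* Events determined by the lifetimes and splitting hyperplanes of the cells  *)
(* of the first k generations.                                                *)
Definition history (k : nat) : set (set Omega) :=
  <<s [set X | exists v : seq bool, (size v < k)%N /\
        ((exists2 S, measurable S & X = L v @^-1` S) \/
         (exists2 B, measurable B & X = h v @^-1` B))] >>.

(* Given the first k generations, the lifetimes and splitting hyperplanes of  *)
(* all cells of generation k are independent with the prescribed laws.        *)
Definition mnw_process (P : probability Omega R) (W : set E) : Prop :=
  [/\ forall v, measurable_fun [set: Omega] (L v),
      forall v, measurable_fun [set: Omega] (h v) &
      forall (k : nat) (A : set Omega)
             (S : k.-tuple bool -> set (\bar R))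
             (B : k.-tuple bool -> set (hyperplane R n)),
        history k A ->
        (forall v, measurable (S v)) -> (forall v, measurable (B v)) ->
        P (A `&` [set w | forall v : k.-tuple bool,
                            S v (L v w) /\ B v (h v w)]) =
        (\int[P]_(w in A) \prod_(v : k.-tuple bool)
          (let c := cell W (h ^~ w) v in
           lifetime_law (fine (Lambda (hits c))) (S v) * split_law c (B v)))%E ].

End mnw_construction.

(* int_0^t exp(- s a) ds                                                      *)
Definition exp_kernel (R : realType) (t a : R) : R :=
  if a == 0 then t else (1 - expR (- (t * a))) / a.

(* Main.v *)
(* Write a = Lambda[c], K(r,a) = int_0^r exp(-sa) ds and
   m(c) = int phi(c /\ H) Lambda(dH). For a cell c born with time r left, with
   lifetime L and splitting hyperplane H, the exponential clock enters only through
     E[g(L,H); L <= r] = E int_0^r exp(-al) int_[c] g(l,H) Lambda(dH) dl,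
   in which the rate has cancelled against the normalization of the splitting law.

   Taking g = phi(c /\ H) + (r - l) m(c), where m(c) is the sum of m over the two
   sub-cells, shows that the facets created in the first k generations plus
   sum r m(c) over generation k form a martingale, and that the contributions of
   distinct cells are orthogonal with variance E[phi(c /\ H)^2; L <= r], which is
   E[K(r,a) int phi(c /\ H)^2 Lambda(dH)]. Hence the variance of the total is the
   sum of these over all cells.

   For the other side, fix x, y and b = Lambda[xy]. The same formula with
   g = 1{x, y in one sub-cell} K(r - l, b) shows that K(r,b), followed along the
   cell containing both x and y, loses in mean 1{x,y in c} K(r,a) per split. So
   K(t,b) telescopes to the sum over all cells of E[1{x,y in c} K(r,a)]; integrating
   over x, y in H and over H gives the same series.

   With g = exp(beta (r - l)) and beta large, the expected number of cells of
   generation k that are born before t is O(4^-k). This excludes explosion and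
   bounds the tails of both series. *)

Require Import Defs.
From HB Require Import structures.
From mathcomp Require Import all_boot all_order all_algebra.
From mathcomp Require Import all_classical all_reals all_analysis.
From mathcomp Require Import measurable_realfun.
From mathcomp Require Import ring lra.

Set Implicit Arguments.
Unset Strict Implicit.
Unset Printing Implicit Defensive.

Import Order.TTheory GRing.Theory Num.Theory.
Import numFieldNormedType.Exports.

Local Open Scope classical_set_scope.
Local Open Scope ring_scope.

(** * Measurability on the space of hyperplanes *)

(** The process is known only through a product formula for whole generations, stated on rectangles.
    Monotone class arguments turn it into the law of one cell given [past v], which contains the
    earlier generations and also every other cell of the generation of [v]. With this choice the
    increments inside one generation are orthogonal and can be added one cell at a time. Conditional
    expectations appear only as identities tested against bounded functions measurable for that
    past.

    Two functions in the theorem are not shown to be measurable: the facet sum as a function of the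
    outcome, and the double integral as a function of H. Both are compared with measurable
    functions, if necessary off a null set, by properties of the integral that ask for no
    measurability.

    The decay 4^-k is the square of 2^-k. Young inequalities with parameter 2^-k therefore turn
    quadratic errors 4^-k into errors of order 2^-k for means and variances. In the end both sides
    of the formula lie within O(2^-k) of the same partial sums, so no limit has to be exchanged with
    an integral. *)

Section measurable_comparison.
Context d (T : measurableType d) (R : realType).
Implicit Types f g : T -> R.

Lemma measurable_set_le f g : measurable_fun setT f -> measurable_fun setT g ->
  measurable [set x | f x <= g x].
Proof.
move=> mf mg; have := measurable_fun_ler mf mg measurableT (Y := [set true]).
by rewrite setTI; apply.
Qed.

Lemma measurable_set_lt f g : measurable_fun setT f -> measurable_fun setT g ->
  measurable [set x | f x < g x].
Proof.
move=> mf mg; have := measurable_fun_ltr mf mg measurableT (Y := [set true]).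
by rewrite setTI; apply.
Qed.

Lemma measurable_set_eq f g : measurable_fun setT f -> measurable_fun setT g ->
  measurable [set x | f x = g x].
Proof.
move=> mf mg; have := measurable_fun_eqr mf mg measurableT (Y := [set true]).
rewrite setTI (_ : _ @^-1` _ = [set x | f x = g x]); first by apply.
by apply/seteqP; split=> x /eqP.
Qed.

Lemma measurable_fun_le_sets f :
  (forall r, measurable [set x | f x <= r]) -> measurable_fun setT f.
Proof.
move=> mf; apply: (measurability (@RGenOInfty.G R)).
  exact: RGenOInfty.measurableE.
move=> _ [_ [r ->] <-]; rewrite setTI.
rewrite (_ : _ @^-1` _ = ~` [set x | f x <= r]); first exact: measurableC.
apply/seteqP; split=> x /=; rewrite in_itv /= andbT ltNge; first by move/negP.
by move=> /negP.
Qed.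

End measurable_comparison.

Lemma rV_norm_leP (R : realType) m (x : 'rV[R]_m) (r : R) : 0 <= r ->
  reflect (forall i, `|x 0 i| <= r) (`|x| <= r).
Proof.
move=> r0; rewrite [`|x|]/Num.norm /= mx_normrE.
have bP := @bigmax_leP _ R ('I_1 * 'I_m)%type 0 r predT (fun ij => `|x ij.1 ij.2|).
apply: (iffP bP).
  by move=> [_ h] i; exact: (h (0, i)).
by move=> h; split=> // -[i j] _ /=; rewrite ord1.
Qed.

Section hyperplane_measurability.
Variables (R : realType) (n : nat).
Local Notation E := 'rV[R]_n.+1.
Local Notation Hy := (hyperplane R n).
Implicit Types (H : Hy) (x y : E).

(** Signed Euclidean distance from x to H, since [normal H] is a unit vector. *)
Definition sdist H x : R := dotr (normal H) x - offset H.

Lemma points_sdist H x : points H x <-> sdist H x = 0.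
Proof.
rewrite /points /sdist /=; split=> [->|/eqP]; first exact: subrr.
by rewrite subr_eq0 => /eqP.
Qed.

Lemma sdist_line H x y (s : R) :
  sdist H (x + s *: (y - x)) = (1 - s) * sdist H x + s * sdist H y.
Proof. by rewrite /sdist !dotrE; ring. Qed.

(** Cauchy-Schwarz against a unit vector: the difference of the two sides is the squared length of
    the part of [x] orthogonal to the normal. *)
Lemma dotr_sqr_le H x : dotr (normal H) x ^+ 2 <= dotr x x.
Proof.
have := dotr_ge0 (x - dotr (normal H) x *: normal H).
rewrite !dotrE dotr_normal (dotrC x) => h.
rewrite -subr_ge0; apply: le_trans h _.
by rewrite le_eqVlt; apply/orP; left; apply/eqP; ring.
Qed.

(** Euclidean balls, as opposed to those of the sup norm of row vectors, are hit exactly when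
    [sdist] is small, whatever the direction of the hyperplane. *)
Definition eball x (r : R) : set E := [set y | dotr (y - x) (y - x) <= r ^+ 2].

(** The point of H nearest to [x] is the orthogonal projection [x - sdist H x *: normal H]. These
    hitting sets are generators of the sigma-algebra, and through them [sdist] becomes measurable up
    to sign. *)
Lemma hits_eball x r : 0 <= r -> hits (eball x r) = [set H | `|sdist H x| <= r].
Proof.
move=> r0; apply/seteqP; split=> H /=.
  move=> [y [/points_sdist Hy yB]].
  rewrite -(ler_pXn2r (_ : 0 < 2)%N) // ?nnegrE // real_normK ?num_real //.
  apply: le_trans yB.
  suff -> : sdist H x = - dotr (normal H) (y - x).
    by rewrite sqrrN; exact: dotr_sqr_le.
  by rewrite dotrDr dotrNr opprB; move: Hy; rewrite /sdist; lra.
move=> Hr; exists (x - sdist H x *: normal H); split.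
  by apply/points_sdist; rewrite {1}/sdist !dotrE dotr_normal /sdist; ring.
rewrite /eball /= addrAC subrr add0r !dotrE dotr_normal.
rewrite (_ : - (_ * _) = sdist H x ^+ 2); last by ring.
by rewrite -real_normK ?num_real // ler_pXn2r // nnegrE.
Qed.


Lemma continuous_sum (T : topologicalType) (I : Type) (r : seq I)
    (f : I -> T -> R) : (forall i, continuous (f i)) ->
  continuous (fun z => \sum_(i <- r) f i z).
Proof.
move=> cf; elim: r => [|i r IH].
  by under eq_fun do rewrite big_nil; move=> z; exact: cvg_cst.
under eq_fun do rewrite big_cons.
by move=> z; apply: cvgD; [exact: cf|exact: IH].
Qed.

Lemma continuous_dotr2 (T : topologicalType) (f g : T -> E) :
  continuous f -> continuous g -> continuous (fun z => dotr (f z) (g z)).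
Proof.
move=> cf cg; apply: continuous_sum => i z.
apply: cvgM.
  exact: (continuous_comp (cf z) (@coord_continuous _ _ _ _ _ _)).
exact: (continuous_comp (cg z) (@coord_continuous _ _ _ _ _ _)).
Qed.

Lemma continuous_sdist H : continuous (sdist H).
Proof.
have -> : sdist H = dotr (normal H) \- cst (offset H) by [].
move=> x; apply: (@continuousB _ R^o); last exact: cst_continuous.
move: x; apply: continuous_sum => i x.
apply: (@continuousM R E (cst (normal H 0 i)) (fun y : E => y 0 i)).
  exact: cst_continuous.
exact: coord_continuous.
Qed.

Lemma eball_compact x r : 0 <= r -> compact (eball x r).
Proof.
move=> r0; apply: bounded_closed_compact.
  exists (`|x| + r); split; first by rewrite num_real.
  move=> M rM y yB; apply: le_trans (ltW rM).
  rewrite -[y](subrK x) addrC; apply: le_trans (ler_normD _ _) _.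
  rewrite lerD2l; apply/rV_norm_leP => // j.
  rewrite -(ler_pXn2r (_ : 0 < 2)%N) // ?nnegrE //.
  rewrite real_normK ?num_real //; apply: le_trans yB.
  rewrite /dotr (bigD1 j) //= -expr2 lerDl.
  by apply: sumr_ge0 => k _; rewrite -expr2 sqr_ge0.
apply: (@preimage_closed _ _ (fun y => dotr (y - x) (y - x)) [set z | z <= r ^+ 2]);
  last exact: closed_le.
have cB : continuous (fun y => y - x) by move=> y; apply: (@continuousB _ E) => //; exact: cst_continuous.
by move=> y _; exact: (continuous_dotr2 cB cB).
Qed.

Lemma measurable_hits (K : set E) : compact K -> measurable (hits K).
Proof. by move=> cK; apply: sub_sigma_algebra; exists K. Qed.

Lemma measurable_abs_sdist x : measurable_fun setT (fun H => `|sdist H x|).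
Proof.
apply: measurable_fun_le_sets => r; case: (leP 0 r) => r0.
  by rewrite -hits_eball //; apply: measurable_hits; exact: eball_compact.
rewrite (_ : [set _ | _] = set0) //; apply/seteqP; split=> // H /=.
by move=> /(le_trans (normr_ge0 _)); rewrite leNgt r0.
Qed.

Lemma measurable_sqr_sdist x : measurable_fun setT (fun H => sdist H x ^+ 2).
Proof.
under eq_fun do rewrite -real_normK ?num_real //.
by apply: measurable_funX; exact: measurable_abs_sdist.
Qed.

(* The sets [hits (eball x r)] only see the even functions [sdist _ x ^+ 2] of
   (normal, offset); polarization recovers their products, and the sign is then
   fixed by the first nonzero coordinate of the normal. *)
Lemma measurable_dotr_sqr x : measurable_fun setT (fun H => dotr (normal H) x ^+ 2).
Proof.
rewrite (_ : (fun H => _) = (fun H => 2^-1 * (sdist H x ^+ 2 + sdist H (- x) ^+ 2)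
    - sdist H 0 ^+ 2)); last first.
  apply/funext => H; rewrite /sdist !dotrE -(scale0r (0 : E)) !dotrE mul0r.
  by field.
apply: measurable_funB; last exact: measurable_sqr_sdist.
by apply: measurable_funM => //; apply: measurable_funD; exact: measurable_sqr_sdist.
Qed.

Lemma measurable_dotrM x y :
  measurable_fun setT (fun H => dotr (normal H) x * dotr (normal H) y).
Proof.
rewrite (_ : (fun H => _) = (fun H => 2^-1 * (dotr (normal H) (x + y) ^+ 2
    - dotr (normal H) x ^+ 2 - dotr (normal H) y ^+ 2))); last first.
  by apply/funext => H; rewrite !dotrE; field.
by apply: measurable_funM => //; do 2?[apply: measurable_funB];
  exact: measurable_dotr_sqr.
Qed.

Lemma measurable_offsetM x :
  measurable_fun setT (fun H => dotr (normal H) x * offset H).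
Proof.
rewrite (_ : (fun H => _) = (fun H => 4^-1 * (sdist H (- x) ^+ 2 - sdist H x ^+ 2)));
  last first.
  by apply/funext => H; rewrite /sdist !dotrE; field.
apply: measurable_funM => //; apply: measurable_funB; exact: measurable_sqr_sdist.
Qed.

Lemma normal_coord H i : normal H 0 i = dotr (normal H) (delta_mx 0 i).
Proof.
rewrite /dotr (bigD1 i) //= big1 ?addr0 ?mxE ?eqxx ?mulr1 // => j ji.
by rewrite mxE /= (negbTE ji) mulr0.
Qed.

Definition leading H (i : 'I_n.+1) : bool :=
  (normal H 0 i != 0) && [forall j : 'I_n.+1, (j < i)%N ==> (normal H 0 j == 0)].

Lemma measurable_leading i : measurable [set H | leading H i].
Proof.
have mz j : measurable [set H : Hy | normal H 0 j == 0].
  rewrite (_ : [set _ | _] = [set H : Hy | dotr (normal H) (delta_mx 0 j) ^+ 2 = 0]).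
    by apply: measurable_set_eq; [exact: measurable_dotr_sqr|exact: measurable_cst].
  apply/seteqP; split=> H /=; rewrite normal_coord.
    by move=> /eqP ->; rewrite expr0n.
  by move/eqP; rewrite sqrf_eq0.
rewrite (_ : [set _ | _] = ~` [set H | normal H 0 i == 0] `&`
    \bigcap_(j in [set j : 'I_n.+1 | (j < i)%N]) [set H | normal H 0 j == 0]).
  apply: measurableI; first exact/measurableC.
  by apply: fin_bigcap_measurable.
apply/seteqP; split=> H /=; rewrite /leading.
  by move=> /andP[/negP ? /forallP h]; split => // j /= ji; have := h j; rewrite ji.
move=> [/negP -> h] /=; apply/forallP => j; apply/implyP => ji.
exact: (h j).
Qed.

Lemma leading_unique H i j : leading H i -> leading H j -> i = j.
Proof.
move=> /andP[i0 /forallP hi] /andP[j0 /forallP hj]; apply/val_inj => /=.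
case: (ltngtP i j) => // ij.
  by have := hj i; rewrite ij /= (negbTE i0).
by have := hi j; rewrite ij /= (negbTE j0).
Qed.

Lemma leading_exists H : exists2 i, leading H i & 0 < normal H 0 i.
Proof.
have /andP[_ /existsP[i /andP[ui h]]] := valP H.
by exists i => //; rewrite /leading h gt_eqF.
Qed.

Lemma sum_leading H (F : 'I_n.+1 -> R) i : leading H i ->
  \sum_j (leading H j)%:R * F j = F i.
Proof.
move=> Hi; rewrite (bigD1 i) //= Hi mul1r big1 ?addr0 // => j ji.
case Hj : (leading H j); last by rewrite mul0r.
by move: ji; rewrite (leading_unique Hi Hj) eqxx.
Qed.

Lemma measurable_leadingM i (f : Hy -> R) : measurable_fun setT f ->
  measurable_fun setT (fun H => (leading H i)%:R * f H).
Proof.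
move=> mf; apply: measurable_funM => //.
rewrite (_ : (fun _ => _) = \1_[set H | leading H i]).
  by apply: measurable_indic; exact: measurable_leading.
apply/funext => H; rewrite indicE; congr (nat_of_bool _)%:R.
by apply/idP/idP; rewrite inE.
Qed.

Lemma measurable_abs_normal i : measurable_fun setT (fun H => `|normal H 0 i|^-1).
Proof.
rewrite (_ : (fun H => _) = (fun H => `|dotr (normal H) (delta_mx 0 i) ^+ 2| `^ (- 2^-1))).
  have mp := @measurable_powR R (- 2^-1).
  apply: (measurableT_comp mp (g := fun H => `|dotr (normal H) (delta_mx 0 i) ^+ 2|)).
  by apply: measurableT_comp => //; exact: measurable_dotr_sqr.

apply/funext => H; rewrite -normal_coord powRN powR12_sqrt //.
by rewrite [`|_ ^+ 2|]ger0_norm ?sqr_ge0 // sqrtr_sqr.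
Qed.

(** At the leading index the coordinate of the normal is positive, hence equals its absolute value
    and cancels. When F is a coordinate of the normal or the offset, the right side contains only
    products that are unchanged under a common change of sign, and those are already measurable. *)
Lemma leading_norm H (F : R) :
  F = \sum_i (leading H i)%:R * ((dotr (normal H) (delta_mx 0 i) * F) * `|normal H 0 i|^-1).
Proof.
have [i Hi ui] := leading_exists H.
rewrite (sum_leading (fun i => _) Hi) -normal_coord gtr0_norm //.
by rewrite mulrAC mulfV ?mul1r // gt_eqF.
Qed.

Lemma measurable_normal_coord j : measurable_fun setT (fun H => normal H 0 j).
Proof.
rewrite (_ : (fun H => _) = (fun H => \sum_i (leading H i)%:R *
    ((dotr (normal H) (delta_mx 0 i) * dotr (normal H) (delta_mx 0 j)) * `|normal H 0 i|^-1))); last first.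
  by apply/funext => H; rewrite -[RHS]leading_norm -normal_coord.
apply: measurable_sum => i; apply: measurable_leadingM.
apply: measurable_funM; first exact: measurable_dotrM.
exact: measurable_abs_normal.
Qed.

Lemma measurable_normal : measurable_fun setT (@normal R n).
Proof. by apply/measurable_fun_coordP => i; exact: measurable_normal_coord. Qed.

Lemma measurable_offset : measurable_fun setT (@offset R n).
Proof.
rewrite (_ : @offset R n = (fun H => \sum_i (leading H i)%:R *
    ((dotr (normal H) (delta_mx 0 i) * offset H) * `|normal H 0 i|^-1))); last first.
  by apply/funext => H; rewrite -[RHS]leading_norm.
apply: measurable_sum => i; apply: measurable_leadingM.
apply: measurable_funM; first exact: measurable_offsetM.
exact: measurable_abs_normal.
Qed.

Lemma measurable_fun_dotr d (T : measurableType d) (f g : T -> E) :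
  measurable_fun setT f -> measurable_fun setT g ->
  measurable_fun setT (fun z => dotr (f z) (g z)).
Proof.
move=> mf mg; apply: measurable_sum => i.
by apply: measurable_funM; exact: (measurableT_comp (measurable_coord i)).
Qed.

Lemma measurable_fun_sdist d (T : measurableType d) (f : T -> Hy) (g : T -> E) :
  measurable_fun setT f -> measurable_fun setT g ->
  measurable_fun setT (fun z => sdist (f z) (g z)).
Proof.
move=> mf mg; apply: measurable_funB.
  by apply: measurable_fun_dotr => //; exact: measurableT_comp measurable_normal mf.
exact: measurableT_comp measurable_offset mf.
Qed.

Lemma hyperplane_eq H K : normal H = normal K -> offset H = offset K -> H = K.
Proof.
move=> nE oE; apply: val_inj; rewrite /= [LHS]surjective_pairing.
by rewrite [RHS]surjective_pairing; congr pair.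
Qed.

Lemma measurable_set1_hyperplane K : measurable ([set K] : set Hy).
Proof.
rewrite (_ : [set K] = (\bigcap_(i in [set: 'I_n.+1]) [set H : Hy | normal H 0 i = normal K 0 i])
    `&` [set H : Hy | offset H = offset K]).
  apply: measurableI; last by apply: measurable_set_eq => //; exact: measurable_offset.
  apply: fin_bigcap_measurable => // i _.
  by apply: measurable_set_eq => //; exact: measurable_normal_coord.
apply/seteqP; split=> [H -> //|H [/= h1 h2]].
by apply: hyperplane_eq => //; apply/rowP => i; exact: h1.
Qed.

(** With [w] the part of [v] orthogonal to [u], both [offset H *: u] and its translate by [w] lie in
    H, hence in K. So [w] is orthogonal to [v] as well and vanishes, the normals are parallel, and
    the two equations have the same solutions. *)
Lemma points_sub H K : points H `<=` points K -> H = K.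
Proof.
move=> HK; have u1 := dotr_normal H; have v1 := dotr_normal K.
set u := normal H in u1; set v := normal K in v1.
have onH x : dotr u x = offset H -> dotr v x = offset K by move=> /HK.
pose w := v - dotr u v *: u.
have uw : dotr u w = 0 by rewrite !dotrE u1 mulr1 subrr.
have r0 : dotr v (offset H *: u) = offset K.
  by apply: onH; rewrite dotrE u1 mulr1.
have vw : dotr v w = 0.
  have := onH (offset H *: u + w).
  rewrite !(dotrDr (offset H *: u)) r0 dotrZr u1 mulr1 uw addr0 => /(_ erefl).
  by move/eqP; rewrite -subr_eq0 addrAC subrr add0r => /eqP.
apply: points_inj; apply/seteqP; split=> // y Ky.
have vE : v = dotr u v *: u.
  apply/eqP; rewrite -subr_eq0 -dotr_eq0 -/w {1}/w dotrDl dotrNl dotrZl.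
  by rewrite uw vw mulr0 subr0.
have c0 : dotr u v != 0.
  by apply: contra_eq_neq v1 => c0; rewrite vE c0 scale0r -(scale0r (0:E)) dotrZl mul0r eq_sym oner_eq0.
have := Ky; rewrite /points /= -/v -r0 vE !dotrZl dotrZr u1 mulr1 => /(mulfI c0).
by [].
Qed.

End hyperplane_measurability.

(** * Lebesgue measure on hyperplanes *)

Section lebesgue_rV_facts.
Variable R : realType.

(** Induction on the dimension. If the coefficients [b'] of the later coordinates are not all zero,
    every slice at fixed first coordinate is null. Otherwise the set is a point times a full
    space. *)
Lemma lebesgue_rV_lin0 n (b : 'rV[R]_n) (s : R) : b != 0 ->
  lebesgue_rV R n [set x | \sum_i b 0 i * x 0 i = s] = 0%E.
Proof.
elim: n b s => [|n IH] b s b0.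
  by case/eqP: b0; apply/rowP => -[].
pose b' : 'rV[R]_n := \row_i b 0 (lift ord0 i).
rewrite /= /lebesgue_cons /pushforward.
rewrite (_ : _ @^-1` _ = [set p : R * 'rV[R]_n |
    \sum_i b' 0 i * p.2 0 i = s - b 0 0 * p.1]); last first.
  have tE (p : R * 'rV[R]_n) : \sum_i b 0 (lift ord0 i) * cons_rV p 0 (lift ord0 i) =
      \sum_i b' 0 i * p.2 0 i.
    by apply: eq_bigr => i _; rewrite cons_rVS mxE.
  by apply/seteqP; split=> p /=; rewrite big_ord_recl cons_rV0 tE; lra.
have [b'0|b'0] := eqVneq b' 0; last first.
  rewrite /product_measure1; apply: integral0_eq => x _ /=.
  rewrite -[RHS](IH b' (s - b 0 0 * x) b'0); congr (lebesgue_rV R n _).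
  by apply/seteqP; split=> y; rewrite /xsection /= inE.
have b00 : b 0 0 != 0.
  apply: contra_neq b0 => b00; apply/rowP => i; rewrite mxE.
  case: (unliftP ord0 i) => [j|] -> //.
  by have /rowP/(_ j) := b'0; rewrite !mxE.
rewrite (_ : [set _ | _] = [set s / b 0 0] `*` setT); last first.
  apply/seteqP; split=> [[x y]|[x y] [/= -> _]] /=; rewrite b'0;
    under eq_bigr do rewrite mxE mul0r; rewrite big1 //.
    move=> h; split=> //; apply: (mulfI b00); rewrite mulrCA mulfV // mulr1; lra.
  by rewrite mulrCA mulfV // mulr1 subrr.
rewrite product_measure1E //.
by rewrite [X in (X * _)%E](lebesgue_measure_set1 (s / b 0 0)) mul0e.
Qed.

Definition cube n (a : 'rV[R]_n) (r : R) : set 'rV[R]_n :=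
  [set x | forall i, `|x 0 i - a 0 i| <= r].

Lemma measurable_cube n (a : 'rV[R]_n) r : measurable (cube a r).
Proof.
rewrite (_ : cube a r = \bigcap_(i in [set: 'I_n]) [set x | `|x 0 i - a 0 i| <= r]).
  apply: fin_bigcap_measurable => // i _; apply: measurable_set_le => //.
  apply: measurableT_comp => //; apply: measurable_funB => //.
  exact: measurable_coord.
by apply/seteqP; split=> x h i; [move=> _|]; exact: h.
Qed.

Lemma lebesgue_rV_cube n (a : 'rV[R]_n) r : 0 <= r ->
  lebesgue_rV R n (cube a r) = ((2 * r) ^+ n)%:E.
Proof.
move=> r0; elim: n a => [|n IH] a.
  rewrite /= expr0 diracE mem_set // => -[].
  by case.
rewrite /= /lebesgue_cons /pushforward.
pose a' : 'rV[R]_n := \row_i a 0 (lift ord0 i).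
rewrite (_ : _ @^-1` _ = `[a 0 0 - r, a 0 0 + r]%classic `*` cube a' r); last first.
  apply/seteqP; split=> [[x y]|[x y]] /=.
    move=> h; split.
      have := h 0; rewrite cons_rV0 /= in_itv /= ler_norml.
      by move=> /andP[? ?]; apply/andP; split; lra.
    by move=> i; have := h (lift ord0 i); rewrite cons_rVS /= mxE.
  move=> [/= h1 h2] i; case: (unliftP ord0 i) => [j|] ->.
    by have := h2 j; rewrite cons_rVS mxE.
  move: h1; rewrite cons_rV0 /= in_itv /= ler_norml.
  by move=> /andP[? ?]; apply/andP; split; lra.
rewrite product_measure1E //; last exact: measurable_cube.
have := lebesgue_measure_itv `[a 0 0 - r, a 0 0 + r]%R; rewrite /= lte_fin => lE.
rewrite IH [X in (X * _)%E]lE exprS.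
case: ltP => h; first by rewrite -EFinD -EFinM; congr (_ * _)%:E; ring.
have -> : r = 0 by lra.
by rewrite mulr0 !mul0r mul0e.
Qed.

End lebesgue_rV_facts.

Section hyperplane_volume.
Variables (R : realType) (n : nat).
Local Notation E := 'rV[R]_n.+1.
Local Notation Hy := (hyperplane R n).
Implicit Types (H K : Hy).

(** The reflection in [chart] is symmetric, so it can be moved to [u]. The vector [w] is the
    reflected [u] up to a multiple of the first basis vector, which is invisible because the
    coordinate inserted by [cons_rV] is 0. *)
Lemma dotr_chart (u : E) K (x : 'rV[R]_n) :
  let v := normal K in
  let w := u - (dotr u (v + delta_mx 0 0) / (1 + v 0 0)) *: v in
  dotr u (chart K x) = offset K * dotr u v + \sum_i w 0 (lift ord0 i) * x 0 i.
Proof.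
move=> v w; have -> : \sum_i w 0 (lift ord0 i) * x 0 i = dotr w (cons_rV (0, x)).
  rewrite /dotr [RHS]big_ord_recl cons_rV0 mulr0 add0r.
  by apply: eq_bigr => i _; rewrite cons_rVS.
rewrite /chart -/v /w; set x' := cons_rV _.
by rewrite (dotrC x') !(dotrDl, dotrDr, dotrZl, dotrZr, dotrNl, dotrNr); ring.
Qed.

(** In the chart of K, H becomes the affine equation with coefficients [b] and constant [s]. It is a
    null set if [b] is nonzero and empty if [b = 0] and [s] is not. The remaining case would put K
    inside H, which [points_sub] excludes. *)
Lemma hyperplane_lebesgue_points H K : H <> K ->
  hyperplane_lebesgue K (points H) = 0%E.
Proof.
move=> HK; rewrite /hyperplane_lebesgue /pushforward.
set w := normal H - (dotr (normal H) (normal K + delta_mx 0 0) /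
  (1 + normal K 0 0)) *: normal K.
pose b : 'rV[R]_n := \row_i w 0 (lift ord0 i).
pose s := offset H - offset K * dotr (normal H) (normal K).
have E1 : chart K @^-1` points H = [set x | \sum_i b 0 i * x 0 i = s].
  have sE (x : 'rV[R]_n) : \sum_i b 0 i * x 0 i = \sum_i w 0 (lift ord0 i) * x 0 i.
    by apply: eq_bigr => i _; rewrite mxE.
  by apply/seteqP; split=> x; rewrite /points /= dotr_chart /= -/w /s sE; lra.
rewrite E1; have [b0|b0] := eqVneq b 0; last exact: lebesgue_rV_lin0.
have [s0|s0] := eqVneq 0 s; last first.
  rewrite (_ : [set _ | _] = set0) ?measure0 //.
  apply/seteqP; split=> // x /=; rewrite b0 big1 => [/eqP|i _]; first by rewrite (negbTE s0).
  by rewrite mxE mul0r.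
case: HK; apply/esym/points_sub; rewrite -range_chart => _ [x _ <-].
have : (chart K @^-1` points H) x.
  by rewrite E1 /= b0 big1 // => i _; rewrite mxE mul0r.
by [].
Qed.

(** The bound has to be uniform in H, because it later dominates integrands that vary with the
    hyperplane. It follows from the charts being isometries: a section of W has at most the diameter
    of W. *)
Lemma hyperplane_lebesgue_bounded (W : set E) : bounded_set W -> measurable W ->
  exists2 C : R, 0 <= C & forall H, (hyperplane_lebesgue H W <= C%:E)%E.
Proof.
move=> [M0 [_ hM]] mW; pose M := Num.max 0 (M0 + 1).
have WM x : W x -> `|x| <= M.
  move=> Wx; apply: (hM M) => //; rewrite /M lt_max; apply/orP; right; lra.
have M_ge0 : 0 <= M by rewrite le_max lexx.
(* Two points of W differ by at most 2M in each of the n+1 coordinates, so [r] bounds their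
   Euclidean distance. The chart preimage of W then lies in the cube of half-width [r] around any of
   its points. *)
pose r := Num.sqrt (n.+1%:R * (2 * M) ^+ 2).
have r0 : 0 <= r by exact: sqrtr_ge0.
exists ((2 * r) ^+ n); first by rewrite exprn_ge0 // mulr_ge0.
move=> H; rewrite /hyperplane_lebesgue /pushforward.
have [[a Wa]|/set0P/negP] := pselect (chart H @^-1` W !=set0); last first.
  by rewrite negbK => /eqP ->; rewrite measure0 lee_fin exprn_ge0 // mulr_ge0.
rewrite -(lebesgue_rV_cube a r0); apply: le_measure.
- rewrite inE -[X in measurable X]setTI; exact: measurable_chart.
- by rewrite inE; exact: measurable_cube.
move=> x Wx i.
rewrite -(ler_pXn2r (_ : 0 < 2)%N) // ?nnegrE // real_normK ?num_real //.
rewrite sqr_sqrtr ?mulr_ge0 ?sqr_ge0 //.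
apply: (@le_trans _ _ (\sum_i (x 0 i - a 0 i) ^+ 2)).
  by rewrite (bigD1 i) //= lerDl sumr_ge0 // => j _; rewrite sqr_ge0.
rewrite -(chart_isometry H) /dotr.
apply: (@le_trans _ _ (\sum_(j < n.+1) (2 * M) ^+ 2)); last first.
  by rewrite sumr_const card_ord [X in _ <= X]mulr_natl lexx.
apply: ler_sum => j _; rewrite -expr2 -real_normK ?num_real //.
rewrite ler_pXn2r ?nnegrE ?mulr_ge0 //.
have hx : `|chart H x 0 j| <= M by have /rV_norm_leP/(_ j) := WM _ Wx; apply.
have ha : `|chart H a 0 j| <= M by have /rV_norm_leP/(_ j) := WM _ Wa; apply.
rewrite !mxE [X in `|X|]lock -lock.
move: hx ha; rewrite /chart !mxE => hx ha.
by apply: le_trans (ler_normB _ _) _; rewrite mulr_natl mulr2n lerD.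
Qed.

Lemma measurable_chart2 :
  measurable_fun setT (fun p : Hy * 'rV[R]_n => chart p.1 p.2).
Proof.
have mx' i : measurable_fun setT (fun p : Hy * 'rV[R]_n => (cons_rV (0, p.2) : E) 0 i).
  case: (unliftP ord0 i) => [j|] ->.
    under eq_fun do rewrite cons_rVS /=.
    exact: (measurableT_comp (measurable_coord j) measurable_snd).
  under eq_fun do rewrite cons_rV0 /=.
  exact: measurable_cst.
have mn i : measurable_fun setT (fun p : Hy * 'rV[R]_n => normal p.1 0 i).
  exact: (measurableT_comp (measurable_normal_coord i) measurable_fst).
apply/measurable_fun_coordP => i.
rewrite (_ : (fun t : Hy * 'rV[R]_n => chart t.1 t.2 0 i) = fun p : Hy * 'rV[R]_n =>
    offset p.1 * normal p.1 0 i + (cons_rV (0, p.2) 0 i -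
    (dotr (cons_rV (0, p.2)) (normal p.1) * ((1 + normal p.1 0 0) `^ (-1))) *
    (normal p.1 0 i + (delta_mx 0 0 : E) 0 i))); last first.
  apply/funext => p; rewrite powR_inv1; last first.
    by rewrite addr_ge0 // oriented_unit_ge0 //; exact: (valP p.1).
  by rewrite /chart; move: (cons_rV _) => x'; rewrite !mxE.
apply: measurable_funD.
  apply: measurable_funM => //.
  exact: (measurableT_comp (@measurable_offset R n) measurable_fst).
apply: measurable_funB => //; apply: measurable_funM; last first.
  by apply: measurable_funD => //; exact: measurable_cst.
apply: measurable_funM.
  by apply: measurable_sum => j; apply: measurable_funM.
apply: (measurableT_comp (@measurable_powR R (-1)) (g := fun p : Hy * 'rV[R]_n => 1 + normal p.1 0 0)).
by apply: measurable_funD => //; exact: measurable_cst.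
Qed.

End hyperplane_volume.

(** * Cells *)

Section compact_approximation.
Variables (R : realType) (n : nat).
Local Notation E := 'rV[R]_n.+1.

(** Finite 1/(k+1)-nets of W for all k, listed in one sequence by pickling pairs of a net and a
    position in it; the default [x0] keeps the sequence inside W. *)
Lemma compact_dense_sequence (W : set E) : compact W -> W !=set0 ->
  exists2 d : nat -> E, (forall k, W (d k)) &
    forall x e, W x -> 0 < e -> exists k, `|x - d k| < e.
Proof.
move=> cW [x0 Wx0].
have fin k : exists F : seq E, (forall x, x \in F -> W x) /\
    forall x, W x -> exists2 y, y \in F & `|x - y| < k.+1%:R^-1.
  have : cover_compact W by rewrite -compact_cover.
  move=> /(_ E W (fun y => ball y (k.+1%:R^-1 : R))) [].
  - by move=> y _; exact: ball_open.
  - by move=> y Wy; exists y => //; apply: ballxx; rewrite invr_gt0 ltr0n.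
  - move=> F FW cF; exists (finmap.enum_fset F); split; first by move=> x /FW; rewrite inE.
    move=> x Wx; have [y yF] := cF x Wx.
    rewrite -ball_normE /ball_ /= distrC => xy.
    by exists y.
have [F FP] := choice fin.
pose d k := if (unpickle k : option (nat * nat)) is Some (i, j)
  then nth x0 (F i) j else x0.
exists d.
  move=> k; rewrite /d; case: (unpickle k) => [[i j]|] //.
  have [ij|ij] := ltnP j (size (F i)); last by rewrite nth_default.
  exact/(FP i).1/mem_nth.
move=> x e Wx e0; have [i ie] : exists i, i.+1%:R^-1 < e.
  have [N _ /(_ N (leqnn _))] := near_infty_natSinv_lt (PosNum e0).
  by exists N.
have [y yF xy] := (FP i).2 x Wx.
exists (pickle (i, index y (F i))).
by rewrite /d pickleK nth_index //; exact: lt_trans xy ie.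
Qed.

(** Trades an existential over W for countable quantifiers over a dense sequence: continuity gives
    one direction, and the minimum attained on the compact set gives the other. This is how hitting
    a random cell becomes a measurable event. *)
Lemma compact_exists_le0 (W : set E) (d : nat -> E) (Phi : E -> R) :
  compact W -> (forall k, W (d k)) ->
  (forall x e, W x -> 0 < e -> exists k, `|x - d k| < e) ->
  continuous Phi ->
  (exists2 x, W x & Phi x <= 0) <->
  (forall k, exists i, Phi (d i) < k.+1%:R^-1).
Proof.
move=> cW Wd dd cPhi; split.
  move=> [x Wx Px] k.
  have k0 : 0 < (k.+1%:R^-1 : R) by rewrite invr_gt0 ltr0n.
  have /cvgrPdist_lt/(_ _ k0) := cPhi x.
  rewrite -nbhs_ballE => -[e /= e0 he].
  have [i xi] := dd x e Wx e0.
  have := he (d i); rewrite -ball_normE /ball_ /= => /(_ xi).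
  by rewrite ltr_norml => /andP[h _]; exists i; move: h; move: (_^-1) => q h; lra.
move=> h; have W0 : W !=set0 by exists (d 0%N).
have [c Wc cmin] := EVT_min_rV W0 cW (continuous_subspaceT cPhi).
exists c; first by rewrite inE in Wc.
rewrite leNgt; apply/negP => c0.
have [N _ /(_ N (leqnn _))] := near_infty_natSinv_lt (PosNum c0).
move=> /= hN; have [i hi] := h N.
have := cmin (d i); rewrite inE => /(_ (Wd i)) hc.
by have := lt_trans hi hN; rewrite ltNge hc.
Qed.

(** The sigma-algebra is generated by coordinates, so compact sets have to be built from cubes: W
    consists of the points that are approximated arbitrarily well by its dense sequence. *)
Lemma measurable_compact (W : set E) : compact W -> measurable W.
Proof.
move=> cW; have [W0|/set0P/negP] := pselect (W !=set0); last first.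
  by rewrite negbK => /eqP ->.
have [d Wd dd] := compact_dense_sequence cW W0.
rewrite (_ : W = \bigcap_k \bigcup_i cube (d i) (k.+1%:R^-1)).
  by apply: bigcapT_measurable => k; apply: bigcup_measurable => i _;
    exact: measurable_cube.
apply/seteqP; split=> x.
  move=> Wx k _; have [|i xi] := dd x (k.+1%:R^-1) Wx; first by rewrite invr_gt0.
  exists i => // j; have /rV_norm_leP : `|x - d i| <= k.+1%:R^-1 by exact: ltW.
  by move=> /(_ _ j); rewrite !mxE; apply.
move=> h; have cl : closed W by apply: compact_closed => //; exact: norm_hausdorff.
apply: cl => B; rewrite -nbhs_ballE => -[e /= e0 he].
have [N _ /(_ N (leqnn _)) hN] := near_infty_natSinv_lt (PosNum e0).
have [i _ hi] := h N I; exists (d i); split => //; apply: he.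
rewrite -ball_normE /ball_ /=; apply: le_lt_trans hN.
by apply/rV_norm_leP => [|j]; rewrite ?invr_ge0 // !mxE; exact: hi.
Qed.

End compact_approximation.

Section cells.
Variables (R : realType) (n : nat).
Local Notation E := 'rV[R]_n.+1.
Local Notation Hy := (hyperplane R n).
Implicit Types (H K : Hy) (g : seq bool -> Hy) (v : seq bool).

Definition side (b : bool) H x : R := if b then - sdist H x else sdist H x.

Lemma halfspaceE b H : halfspace b H = [set x | side b H x <= 0].
Proof.
by case: b; apply/seteqP; split=> x; rewrite /side /sdist /=; lra.
Qed.

(** Collects all constraints of a cell into one continuous function. The base value 0 makes it
    nonnegative, so inside W the cell is its zero set. *)
Fixpoint excess g v (x : E) : R :=
  if v is b :: v' then Num.max (excess g v' x) (side b (g v') x) else 0.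

Lemma cell_excess (W : set E) g v :
  cell W g v = W `&` [set x | excess g v x <= 0].
Proof.
elim: v => [|b v IH] /=.
  by apply/seteqP; split=> x /= => [|[]//]; split=> //; rewrite lexx.
rewrite IH halfspaceE -setIA; congr (_ `&` _).
by apply/seteqP; split=> x /=; rewrite ge_max => /andP.
Qed.

Lemma continuous_side b H : continuous (side b H).
Proof.
rewrite /side; case: b; last exact: continuous_sdist.
by move=> x; apply: (@continuousN _ R^o); exact: continuous_sdist.
Qed.

Lemma continuous_excess g v : continuous (excess g v).
Proof.
elim: v => [|b v IH] /= x; first exact: cst_continuous.
by apply: continuous_max; [exact: IH|exact: continuous_side].
Qed.

Lemma cell_sub (W : set E) g v : cell W g v `<=` W.
Proof. by rewrite cell_excess => x []. Qed.

Lemma cell_compact (W : set E) g v : compact W -> compact (cell W g v).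
Proof.
move=> cW; rewrite cell_excess; apply: (@subclosed_compact _ _ W) => //.
  apply: closedI; first by apply: compact_closed => //; exact: norm_hausdorff.
  apply: (@preimage_closed _ _ (excess g v) [set z | z <= 0]); last exact: closed_le.
  by move=> x _; exact: continuous_excess.
Qed.

Lemma hits_cellP (W : set E) g v K :
  hits (cell W g v) K <->
  exists2 x, W x & Num.max (excess g v x) `|sdist K x| <= 0.
Proof.
rewrite cell_excess; split.
  move=> [x [/points_sdist Kx [Wx vx]]]; exists x => //.
  by rewrite ge_max vx Kx normr0 lexx.
move=> [x Wx]; rewrite ge_max => /andP[vx]; rewrite normr_le0 => /eqP Kx.
by exists x; split=> //; exact/points_sdist.
Qed.

Lemma segment_convex (W : set E) (x y : E) : convex_set W -> W x -> W y ->
  segment x y `<=` W.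
Proof.
move=> cW Wx Wy _ [s /= + <-]; rewrite in_itv /= => /andP[s0 s1].
have := cW y x (@Itv01 R s s0 s1).
rewrite !inE => /(_ Wy Wx); rewrite /conv /=.
suff -> : s *: y + (1 - s) *: x = x + s *: (y - x) by [].
by rewrite scalerBr scalerBl scale1r addrCA.
Qed.

Section measurability.
Context d (T : measurableType d).
Variables (g : seq bool -> T -> Hy) (v : seq bool).
Hypothesis mg : forall u, (size u < size v)%N -> measurable_fun setT (g u).

Lemma measurable_side b (H : T -> Hy) (e : T -> E) :
  measurable_fun setT H -> measurable_fun setT e ->
  measurable_fun setT (fun s => side b (H s) (e s)).
Proof.
move=> mH me; have mS := measurable_fun_sdist mH me.
by rewrite /side; case: b => //; exact: measurable_funN.
Qed.

Lemma measurable_excess (e : T -> E) : measurable_fun setT e ->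
  measurable_fun setT (fun s => excess (g^~ s) v (e s)).
Proof.
move=> me; elim: v mg => [|b u IH] mgu /=; first exact: measurable_cst.
apply: measurable_maxr; first by apply: IH => w wu; apply: mgu => /=; exact: ltnW.
by apply: measurable_side => //; exact: mgu.
Qed.

Lemma measurable_cell (W : set E) (e : T -> E) : measurable W ->
  measurable_fun setT e ->
  measurable [set s | cell W (g^~ s) v (e s)].
Proof.
move=> mW me; rewrite (_ : [set _ | _] = e @^-1` W `&`
    [set s | excess (g^~ s) v (e s) <= 0]).
  apply: measurableI; first by rewrite -[X in measurable X]setTI; exact: me.
  by apply: measurable_set_le; [exact: measurable_excess|exact: measurable_cst].
by apply/seteqP; split=> s /=; rewrite cell_excess.
Qed.

(** Cell and hyperplane may both vary. Being hit means that the nonnegative continuous function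
    [Num.max (excess ..) |sdist ..|] vanishes somewhere on W, and [compact_exists_le0] reduces this
    to comparisons at countably many points. Only splits of shorter addresses have to be measurable,
    which permits the use over the sigma-algebra of the past. *)
Lemma measurable_hits_cell (W : set E) (K : T -> Hy) : compact W ->
  measurable_fun setT K ->
  measurable [set s | hits (cell W (g^~ s) v) (K s)].
Proof.
move=> cW mK; have [W0|W0] := pselect (W !=set0); last first.
  rewrite (_ : [set _ | _] = set0) //; apply/seteqP; split=> // s.
  by move=> [x [_ /cell_sub Wx]]; apply: W0; exists x.
have [D WD DD] := compact_dense_sequence cW W0.
rewrite (_ : [set _ | _] = \bigcap_k \bigcup_i [set s |
    Num.max (excess (g^~ s) v (D i)) `|sdist (K s) (D i)| < k.+1%:R^-1]).
  apply: bigcapT_measurable => k; apply: bigcup_measurable => i _.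
  apply: measurable_set_lt; last exact: measurable_cst.
  apply: measurable_maxr; first by apply: measurable_excess; exact: measurable_cst.
  apply: measurableT_comp => //.
  by apply: measurable_fun_sdist => //; exact: measurable_cst.
have aux s := @compact_exists_le0 R n W D
  (fun x => Num.max (excess (g^~ s) v x) `|sdist (K s) x|) cW WD DD.
have cPhi s : continuous (fun x => Num.max (excess (g^~ s) v x) `|sdist (K s) x|).
  move=> x; apply: continuous_max; first exact: continuous_excess.
  by apply: (continuous_comp (@continuous_sdist _ _ (K s) x)); exact: norm_continuous.
apply/seteqP; split=> s /=.
  move=> /hits_cellP/(aux s (cPhi s)).1 h k _.
  by have [i hi] := h k; exists i.
move=> h; apply/hits_cellP/(aux s (cPhi s)).2 => k.
by have [i _ hi] := h k I; exists i.
Qed.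

End measurability.
End cells.

(** * Volumes of sections and hyperplanes hitting a segment *)

Lemma measurable_measure_section d1 d2 (T1 : measurableType d1)
    (T2 : measurableType d2) (R : realType)
    (m : {sigma_finite_measure set T2 -> \bar R}) (A : T1 -> set T2) :
  measurable [set p : T1 * T2 | A p.1 p.2] ->
  measurable_fun setT (fun s => m (A s)).
Proof.
move=> mA; have := measurable_fun_xsection m mA.
congr (measurable_fun _ _); apply/funext => s /=; congr (m _).
by apply/seteqP; split=> x; rewrite /xsection /= inE.
Qed.

Section segment_and_volume.
Variables (R : realType) (n : nat).
Local Notation E := 'rV[R]_n.+1.
Local Notation Hy := (hyperplane R n).
Implicit Types (H K : Hy) (c : set E).

(** Along the segment [sdist] is affine, so it has a zero exactly when its endpoint values do not
    share a strict sign. This polynomial form also makes the condition jointly measurable in H, x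
    and y. *)
Lemma hits_segmentP (x y : E) H :
  hits (segment x y) H <-> sdist H x * sdist H y <= 0.
Proof.
split.
  move=> [z [/points_sdist Hz [s /= + sz]]]; rewrite in_itv /= => /andP[s0 s1].
  move: Hz; rewrite -sz sdist_line.
  move: (sdist H x) (sdist H y) => a b ab.
  rewrite leNgt; apply/negP => ab0.
  have e1 : (1 - s) * a ^+ 2 + s * (a * b) = 0.
    by transitivity (((1 - s) * a + s * b) * a); [ring|rewrite ab mul0r].
  have h1 : 0 <= (1 - s) * a ^+ 2 by rewrite mulr_ge0 ?sqr_ge0 // subr_ge0.
  have h2 : 0 <= s * (a * b) by rewrite mulr_ge0 // ltW.
  have : s * (a * b) == 0 by apply/eqP; lra.
  rewrite mulf_eq0 (gt_eqF ab0) orbF => /eqP s00; move: e1.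
  rewrite s00 subr0 mul1r mul0r addr0 => /eqP; rewrite sqrf_eq0 => /eqP a0.
  by move: ab0; rewrite a0 mul0r ltxx.
move=> ab; suff [s s01 hs] : exists2 s : R, 0 <= s <= 1 &
    (1 - s) * sdist H x + s * sdist H y = 0.
  exists (x + s *: (y - x)); split.
    by apply/points_sdist; rewrite sdist_line.
  by exists s => //=; rewrite in_itv.
move: (sdist H x) (sdist H y) ab => a b ab.
have [abE|abN] := eqVneq a b.
  exists 0; first by rewrite lexx ler01.
  have : a ^+ 2 == 0 by rewrite eq_le sqr_ge0 andbT expr2 {2}abE.
  by rewrite sqrf_eq0 => /eqP ->; rewrite mulr0 mul0r addr0.
have ab0 : a - b != 0 by rewrite subr_eq0.
(* The zero of the affine interpolation between [a] and [b]. *)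
exists (a / (a - b)); last by field.
have sq : 0 < (a - b) ^+ 2 by rewrite exprn_even_gt0.
have -> : a / (a - b) = (a * (a - b)) / (a - b) ^+ 2 by field.
rewrite divr_ge0 ?(ltW sq) //=; last nra.
by rewrite ler_pdivrMr // mul1r; nra.
Qed.

Lemma segment_compact (x y : E) : compact (segment x y).
Proof.
have -> : segment x y = (fun s : R => x + s *: (y - x)) @` `[0, 1]%classic by [].
apply: continuous_compact; last exact: segment_compact.
apply: continuous_subspaceT => s; apply: cvgD; first exact: cvg_cst.
by apply: cvgZr_tmp.
Qed.

Definition vol H c : R := fine (hyperplane_lebesgue H c).

Lemma hyperplane_lebesgue_setI H c :
  hyperplane_lebesgue H (c `&` points H) = hyperplane_lebesgue H c.
Proof.
rewrite /hyperplane_lebesgue /pushforward; congr (lebesgue_rV R n _).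
apply/seteqP; split=> x /= => [[]//|cx]; split => //.
by rewrite -range_chart; exists x.
Qed.

Lemma measurable_points H : measurable (points H).
Proof.
rewrite (_ : points H = [set x | sdist H x = 0]).
  apply: measurable_set_eq; last exact: measurable_cst.
  by apply: measurable_fun_sdist => //; exact: measurable_cst.
by apply/seteqP; split=> x /points_sdist.
Qed.

Lemma measurable_halfspace b H : measurable (halfspace b H).
Proof.
rewrite halfspaceE; apply: measurable_set_le; last exact: measurable_cst.
by apply: measurable_side => //; exact: measurable_cst.
Qed.

(** The closed half-spaces overlap in [points H], which is null for the measure on a different
    hyperplane K. *)
Lemma hyperplane_lebesgue_split H K c : H <> K -> measurable c ->
  (hyperplane_lebesgue K (c `&` halfspace true H) +
   hyperplane_lebesgue K (c `&` halfspace false H))%E = hyperplane_lebesgue K c.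
Proof.
move=> HK mc; have mh b := measurable_halfspace b H.
have mP := measurable_points H.
have z A : measurable A -> A `<=` points H -> hyperplane_lebesgue K A = 0%E.
  move=> mA AH; apply/eqP; rewrite eq_le measure_ge0 andbT.
  rewrite -(hyperplane_lebesgue_points HK); apply: le_measure; rewrite ?inE //.
rewrite [RHS](measureDI (hyperplane_lebesgue K) mc (mh true)) addeC; congr (_ + _)%E.
transitivity (hyperplane_lebesgue K ((c `\` halfspace true H) `|` (c `&` points H)));
  last first.
  apply: measureU0; [exact: measurableD|exact: measurableI|].
  by apply: z => [|x []]; first exact: measurableI.
congr (hyperplane_lebesgue K _); rewrite !halfspaceE; apply/seteqP; split=> x /=.
  move=> [cx hx]; have [/eqP x0|x0] := boolP (sdist H x == 0).
    by right; split=> //; exact/points_sdist.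
  by left; split=> //; move: hx x0; rewrite /side oppr_le0 => ?; case: ltgtP; lra.
move=> [[cx]|[cx /points_sdist x0]]; rewrite /side.
  by move=> h; split=> //; move/negP: h; rewrite oppr_le0 -ltNge => /ltW.
by rewrite x0 lexx.
Qed.

(** [facet_hyperplane] is a choice and may return some K other than H when the facet is degenerate.
    The facet then lies in both hyperplanes and is null for both measures, so the two sides are
    0. *)
Lemma facet_phi_points (zeta : E -> R) H c : measurable c ->
  facet_phi zeta (c `&` points H) = vol H c * zeta (normal H).
Proof.
move=> mc; rewrite /facet_phi /facet_volume /facet_normal.
set f := c `&` points H; set K := facet_hyperplane f.
have fK : f `<=` points K.
  have : [set H | f `<=` points H] K by apply: xgetPex; exists H => x [].
  by [].
have [KH|KH] := pselect (K = H).
  by rewrite KH /vol -(hyperplane_lebesgue_setI H c).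
have mf : measurable f by apply: measurableI => //; exact: measurable_points.
have z (K1 H1 : Hy) : H1 <> K1 -> f `<=` points H1 -> hyperplane_lebesgue K1 f = 0%E.
  move=> HK fH; apply/eqP; rewrite eq_le measure_ge0 andbT.
  rewrite -(hyperplane_lebesgue_points HK); apply: le_measure; rewrite ?inE //.
  exact: measurable_points.
rewrite (z K H) //; last 2 first.
- by move=> e; apply: KH.
- by move=> x [].
by rewrite /vol -(hyperplane_lebesgue_setI H c) -/f (z H K) // !mul0r.
Qed.

End segment_and_volume.

(** * Fundamental theorem of calculus and change of density *)

Section calculus.
Variable R : realType.
Notation mu := (@lebesgue_measure R).

Lemma integral_derive (G g : R -> R) (tau : R) : 0 <= tau ->
  (forall x, is_derive x (1 : R) G (g x)) -> continuous g ->
  (\int[mu]_(x in `[0%R, tau]) (g x)%:E = (G tau - G 0)%:E)%E.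
Proof.
rewrite le_eqVlt => /orP[/eqP <-|tau0] dG cg.
  by rewrite set_itv1 integral_set1 subrr.
have cG : continuous G.
  by move=> x; apply/differentiable_continuous/derivable1_diffP; exact: (@ex_derive _ _ _ _ _ _ _ (dG x)).
rewrite (@continuous_FTC2 _ g G) //.
- by apply: continuous_subspaceT.
- split.
  + by move=> x _; exact: (@ex_derive _ _ _ _ _ _ _ (dG x)).
  + by apply: cvg_at_right_filter; exact: cG.
  + by apply: cvg_at_left_filter; exact: cG.
- by move=> x _; rewrite derive1E; exact: (@derive_val _ _ _ _ _ _ _ (dG x)).
Qed.

End calculus.

Section change_of_density.
Local Open Scope ereal_scope.
Context d1 d2 d3 (T1 : measurableType d1) (T2 : measurableType d2)
  (Y : measurableType d3) (R : realType).
Variables (m1 : {finite_measure set T1 -> \bar R}) (m2 : {measure set T2 -> \bar R}).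
Variables (X : T1 -> Y) (iota : T2 -> Y) (rho : T2 -> \bar R) (G : set (set Y)).
Hypotheses (mX : measurable_fun setT X) (miota : measurable_fun setT iota)
  (mrho : measurable_fun setT rho) (rho0 : forall y, 0 <= rho y)
  (rhofin : forall y, rho y \is a fin_num)
  (GE : @measurable _ Y = <<s G >>) (GI : setI_closed G) (GT : G setT)
  (Geq : forall A, G A -> m1 (X @^-1` A) = \int[m2]_(y in iota @^-1` A) rho y).

Let mXp A : measurable A -> measurable (X @^-1` A).
Proof. by move=> mA; rewrite -[X in measurable X]setTI; exact: mX. Qed.

Let mip A : measurable A -> measurable (iota @^-1` A).
Proof. by move=> mA; rewrite -[X in measurable X]setTI; exact: miota. Qed.

(** Dynkin induction from the pi-system [G]. Complements can be subtracted because [GT] and the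
    finiteness of [m1] make the total mass of [rho] finite. The two maps [X] and [iota] into a
    common space allow the measures to live on different spaces, and the target to carry a smaller
    sigma-algebra such as that of the past. *)
Lemma measure_density A : measurable A ->
  m1 (X @^-1` A) = \int[m2]_(y in iota @^-1` A) rho y.
Proof.
rewrite [in X in X -> _]GE.
have total : \int[m2]_y rho y < +oo.
  have := Geq GT; rewrite !preimage_setT => <-.
  by rewrite ltey_eq fin_num_measure.
have sub D : measurable D -> \int[m2]_(y in D) rho y \is a fin_num.
  move=> mD; rewrite ge0_fin_numE ?integral_ge0 //; apply: le_lt_trans total.
  by apply: ge0_subset_integral => //; exact: mD.
apply: (@dynkin_induction _ Y G (fun A => m1 (X @^-1` A) = \int[m2]_(y in iota @^-1` A) rho y)) => //.
- exact: Geq.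
- move=> S mS SE; have := Geq GT; rewrite !preimage_setT -(setUv (iota @^-1` S)).
  rewrite ge0_integral_setU //=; last 4 first.
  + exact: mip.
  + exact/measurableC/mip.
  + by rewrite setUv.
  + by apply/disj_setPCl.
  rewrite -SE -(setUv (X @^-1` S)) measureU //; last 3 first.
  + exact: mXp.
  + exact/measurableC/mXp.
  + by rewrite setICr.
  rewrite -!preimage_setC => /(congr1 (fun z => z - m1 (X @^-1` S))).
  have fX : m1 (X @^-1` S) \is a fin_num by rewrite fin_num_measure //; exact: mXp.
  by rewrite [in LHS]addeAC subee // add0e [in RHS]addeAC subee // add0e.
- move=> F mF tF FE; rewrite !preimage_bigcup.
  rewrite measure_bigcup //; last 2 first.
  + by move=> i _; exact: mXp.
  + by move/trivIsetP: tF => tF'; apply/trivIsetP => i j _ _ ij; rewrite -preimage_setI tF' // preimage_set0.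
  rewrite ge0_integral_bigcup //.
  + apply: congr_lim; apply/funext => k.
    by apply: eq_big => [i|i _]; [exact: in_setT|exact: FE].
  + by move=> i; exact: mip.
  + exact: measurable_funTS.
  + by move/trivIsetP: tF => tF'; apply/trivIsetP => i j _ _ ij; rewrite -preimage_setI tF' // preimage_set0.
Qed.

Import HBNNSimple.

Lemma ge0_integral_density (g : Y -> \bar R) : measurable_fun setT g ->
  (forall y, 0 <= g y) ->
  \int[m1]_x g (X x) = \int[m2]_y (g (iota y) * rho y).
Proof.
move=> mg g0; pose g_ := nnsfun_approx measurableT mg.
have indE (A : set Y) : measurable A ->
    \int[m1]_x (\1_A (X x))%:E = \int[m2]_y ((\1_A (iota y))%:E * rho y).
  move=> mA; transitivity (m1 (X @^-1` A)).
    have := integral_indic m1 measurableT (mXp mA); rewrite setIT => <-.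
    by apply: eq_integral => x _; rewrite !indicE.
  rewrite measure_density // integral_mkcond; apply: eq_integral => y _.
  rewrite patchE indicE (_ : (iota y \in A) = (y \in iota @^-1` A)).
    by case: ifPn => h; rewrite ?mul1e ?mul0e.
  by apply/idP/idP; rewrite !inE.
have stepE n : \int[m1]_x (g_ n (X x))%:E = \int[m2]_y ((g_ n (iota y))%:E * rho y).
  have gE y : (g_ n y)%:E = \sum_(r \in range (g_ n)) (r * \1_(g_ n @^-1` [set r]) y)%:E.
    by rewrite fimfunE -fsumEFin.
  have t0 r y : 0 <= (r * \1_(g_ n @^-1` [set r]) y)%:E by rewrite nnfun_muleindic_ge0.
  have ms r : measurable_fun setT (fun y => (\1_(g_ n @^-1` [set r]) y : R)).
    exact: measurable_indic.
  under [LHS]eq_integral do rewrite gE.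
  rewrite ge0_integral_fsum //; last first.
    move=> r; apply/measurable_EFinP; apply: measurable_funM => //.
    exact: (measurableT_comp (ms r) mX).
  under [RHS]eq_integral do rewrite gE ge0_mule_fsuml//.
  rewrite ge0_integral_fsum //; last 2 first.
  - move=> r; apply: emeasurable_funM => //; apply/measurable_EFinP.
    by apply: measurable_funM => //; exact: (measurableT_comp (ms r) miota).
  - by move=> r y _; apply: mule_ge0.
  apply: eq_fsbigr => r; rewrite inE => -[y0 _ ry]; have r0 : (0 <= r)%R by rewrite -ry.
  under [LHS]eq_integral do rewrite EFinM.
  under [RHS]eq_integral do rewrite EFinM -muleA.
  rewrite !ge0_integralZl //; first by rewrite indE.
  - apply: emeasurable_funM => //; apply/measurable_EFinP.
    exact: (measurableT_comp (ms r) miota).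
  - by move=> y _; apply: mule_ge0 => //; rewrite lee_fin indicE.
  - apply/measurable_EFinP; exact: (measurableT_comp (ms r) mX).
transitivity (limn (fun n => \int[m1]_x (g_ n (X x))%:E)).
  rewrite -monotone_convergence //.
  - apply: eq_integral => x _; apply/esym/cvg_lim => //.
    exact: cvg_nnsfun_approx.
  - by move=> n; apply/measurable_EFinP; exact: (measurableT_comp _ mX).
  - by move=> n x _; rewrite lee_fin.
  - by move=> x _ a b ab; rewrite lee_fin; exact/lefP/nd_nnsfun_approx.
rewrite (_ : (fun n => _) = (fun n => \int[m2]_y ((g_ n (iota y))%:E * rho y))); last first.
  by apply/funext => n; exact: stepE.
rewrite -monotone_convergence //.
- apply: eq_integral => y _; apply/cvg_lim => //.
  by apply: cvgeZr => //; exact: cvg_nnsfun_approx.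
- move=> n; apply: emeasurable_funM => //; apply/measurable_EFinP.
  exact: (measurableT_comp _ miota).
- by move=> n y _; apply: mule_ge0 => //; rewrite lee_fin.
- move=> y _ a b ab; apply: lee_wpmul2r => //; rewrite lee_fin.
  exact/lefP/nd_nnsfun_approx.
Qed.

(** No integrability is assumed: since [rho] is nonnegative, multiplying by it commutes with taking
    positive and negative parts, and each part is treated separately. *)
Lemma integral_density (g : Y -> R) : measurable_fun setT g ->
  \int[m1]_x (g (X x))%:E = \int[m2]_y ((g (iota y))%:E * rho y).
Proof.
move=> mg; rewrite [LHS]integralE [RHS]integralE; congr (_ - _).
  transitivity (\int[m1]_x ((EFin \o g)^\+ (X x))).
    by apply: eq_integral => x _; rewrite !funeposE.
  rewrite ge0_integral_density //; last exact/measurable_funepos/measurable_EFinP.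
  by apply: eq_integral => y _; rewrite !funeposE maxe_pMl //= ?mul0e.
transitivity (\int[m1]_x ((EFin \o g)^\- (X x))).
  by apply: eq_integral => x _; rewrite !funenegE.
rewrite ge0_integral_density //; last exact/measurable_funeneg/measurable_EFinP.
by apply: eq_integral => y _; rewrite !funenegE -mulNe maxe_pMl //= ?mul0e.
Qed.


End change_of_density.

(** * The law of one splitting step given the past *)

Section restricted_measure.
Local Open Scope ereal_scope.
Context d (T : measurableType d) (R : realType).

Lemma sigma_algebra_measurable_id :
  @measurable _ T = <<s (@measurable _ T) >>.
Proof. by rewrite sigma_algebra_id //; exact: sigma_algebra_measurable. Qed.

Lemma integral_mfrestr (m : {measure set T -> \bar R}) (E : set T)
    (mE : measurable E) (Eoo : m E < +oo) (g : T -> \bar R) :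
  measurable_fun setT g -> (forall x, 0 <= g x) ->
  \int[mfrestr mE Eoo]_x g x = \int[m]_(x in E) g x.
Proof.
move=> mg g0.
rewrite (@ge0_integral_density _ _ _ T T T R (mfrestr mE Eoo) m id id
  (fun x => (\1_E x)%:E) measurable) //.
- rewrite [RHS]integral_mkcond; apply: eq_integral => x _.
  by rewrite patchE indicE; case: ifPn => _; rewrite ?mule1 ?mule0.
- by apply/measurable_EFinP; exact: measurable_indic.
- exact: sigma_algebra_measurable_id.
- by move=> A B; exact: measurableI.
- by move=> A mA; rewrite /= /mfrestr /mrestr /= integral_indic // setIC.
Qed.

End restricted_measure.

Section laws.
Variables (R : realType).
Local Open Scope ereal_scope.
Notation mu := (@lebesgue_measure R).

Lemma measurable_funV_ge0 d (T : measurableType d) (a : T -> R) :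
  measurable_fun setT a -> (forall s, 0 <= a s)%R ->
  measurable_fun setT (fun s => (a s)^-1%R).
Proof.
move=> ma a0; under eq_fun do rewrite -(powR_inv1 (a0 _)).
exact: (measurableT_comp (@measurable_powR R (-1)) ma).
Qed.

Lemma measurable_expR_rate d (T : measurableType d) (a : T -> R) (l : T -> R) :
  measurable_fun setT a -> measurable_fun setT l ->
  measurable_fun setT (fun s => expR (- a s * l s)).
Proof.
move=> ma ml; apply: measurableT_comp; first exact: measurable_expR.
by apply: measurable_funM => //; exact: measurable_funN.
Qed.


(** The exponential law without its factor [a]: the part left once the rate has cancelled, and still
    meaningful at [a = 0]. *)
Definition expint (a : R) (S : set R) : \bar R :=
  \int[mu]_x (\1_S x * (\1_(`[0%R, +oo[%classic) x * expR (- a * x)))%:E.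

Lemma measurable_expint_integrand d (T : measurableType d) (a l : T -> R)
    (S : set R) : measurable_fun setT a -> measurable_fun setT l -> measurable S ->
  measurable_fun setT (fun s => \1_S (l s) *
    (\1_(`[0%R, +oo[%classic) (l s) * expR (- a s * l s)))%R.
Proof.
move=> ma ml mS.
have mi (A : set R) : measurable A -> measurable_fun setT (fun s => \1_A (l s) : R).
  by move=> mA; apply: (measurableT_comp (f := \1_A : R -> R)) => //; exact: measurable_indic.
apply: measurable_funM; first exact: mi.
apply: measurable_funM; last exact: measurable_expR_rate.
by apply: mi; exact: measurable_itv.
Qed.

Lemma exponential_probE a S : (0 <= a)%R -> measurable S ->
  exponential_prob a S = a%:E * expint a S.
Proof.
move=> a0 mS; rewrite /expint -ge0_integralZl //; last first.
  apply/measurable_EFinP.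
  by apply: (measurable_expint_integrand (measurable_cst a) (@measurable_id _ _ _)).
rewrite [LHS]integral_mkcond; apply: eq_integral => x _.
rewrite !patchE /exponential_pdf patchE !indicE -EFinM.
case: (x \in S); last by rewrite mul0r mulr0.
by case: (x \in _); rewrite !mul1r // mul0r mulr0.
Qed.

Lemma measurable_expint d (T : measurableType d) (a : T -> R) (S : set R) :
  measurable_fun setT a -> measurable S ->
  measurable_fun setT (fun s => expint (a s) S).
Proof.
move=> ma mS; pose f (p : T * R) : \bar R := (\1_S p.2 *
  (\1_(`[0%R, +oo[%classic) p.2 * (expR (- a p.1 * p.2))))%:E.
have := @measurable_fun_fubini_tonelli_F _ _ T _ R mu f; apply.
  apply/measurable_EFinP; apply: measurable_expint_integrand => //.
  exact: (measurableT_comp ma measurable_fst).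
by move=> p; rewrite lee_fin !mulr_ge0 // ?expR_ge0 // indicE.
Qed.

Lemma measurable_preimage_EFin (S : set (\bar R)) : measurable S ->
  measurable (EFin @^-1` S).
Proof. by move=> mS; rewrite -[X in measurable X]setTI; exact: EFin_measurable. Qed.

Lemma lifetime_lawE a S : (0 <= a)%R -> measurable S ->
  lifetime_law a S = if a == 0%R then \d_(+oo : \bar R) S
                     else a%:E * expint a (EFin @^-1` S).
Proof.
move=> a0 mS; rewrite /lifetime_law exponential_probE //.
exact: measurable_preimage_EFin.
Qed.

Lemma measurable_lifetime_law d (T : measurableType d) (a : T -> R)
    (S : set (\bar R)) : measurable_fun setT a -> (forall s, 0 <= a s)%R ->
  measurable S -> measurable_fun setT (fun s => lifetime_law (a s) S).
Proof.
move=> ma a0 mS; under eq_fun do rewrite lifetime_lawE //.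
apply: measurable_fun_ifT.
- by apply: measurable_fun_eqr => //; exact: measurable_cst.
- exact: measurable_cst.
apply: emeasurable_funM; first exact/measurable_EFinP.
by apply: measurable_expint => //; exact: measurable_preimage_EFin.
Qed.

Lemma lifetime_law_ge0 (a : R) S : (0 <= a)%R -> 0 <= lifetime_law a S.
Proof.
move=> a0; rewrite /lifetime_law; case: ifP => _; first exact: measure_ge0.
by apply: integral_ge0 => x _; rewrite lee_fin exponential_pdf_ge0.
Qed.

Lemma lifetime_lawT (a : R) : (0 <= a)%R -> lifetime_law a setT = 1.
Proof.
move=> a0; rewrite /lifetime_law; case: ifPn => [_|an0].
  by rewrite diracE mem_set.
rewrite preimage_setT /exponential_prob integral_exponential_pdf //.
by rewrite lt_neqAle eq_sym an0.
Qed.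

Lemma lifetime_law_le1 (a : R) S : (0 <= a)%R -> measurable S ->
  lifetime_law a S <= 1.
Proof.
move=> a0 mS; rewrite -(lifetime_lawT a0) /lifetime_law; case: ifP => _.
  by apply: le_measure; rewrite ?inE.
apply: ge0_subset_integral => //.
- exact: measurable_preimage_EFin.
- by rewrite preimage_setT.
- by apply/measurable_EFinP/measurable_funTS; exact: measurable_exponential_pdf.
- by move=> x _; rewrite lee_fin exponential_pdf_ge0.
Qed.

End laws.

Section split.
Variables (R : realType) (n : nat).
Local Notation E := 'rV[R]_n.+1.
Local Notation Hy := (hyperplane R n).
Local Open Scope ereal_scope.
Variables (W : set E) (Lambda : {measure set Hy -> \bar R}).
Hypotheses (cW : compact W) (hWoo : Lambda (hits W) < +oo).

(** The restriction of Lambda to [W], a finite measure to which the Fubini theorems apply. All cells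
    lie in W, so it agrees with Lambda on every set [c]. *)
Definition hitting_measure : set Hy -> \bar R := mfrestr (measurable_hits cW) hWoo.
Local Notation LW := hitting_measure.
HB.instance Definition _ := FiniteMeasure.on hitting_measure.

Lemma hits_subset (c c' : set E) : c `<=` c' -> hits c `<=` hits c'.
Proof. by move=> cc' H [x [Hx cx]]; exists x; split => //; exact: cc'. Qed.

Lemma hitting_measureE A : A `<=` hits W -> LW A = Lambda A.
Proof. by move=> AW; rewrite /hitting_measure /mfrestr /mrestr setIidl. Qed.

Lemma hitting_measure_hits c : c `<=` W -> LW (hits c) = Lambda (hits c).
Proof. by move=> cc; apply: hitting_measureE; exact: hits_subset. Qed.

Lemma measurable_hits_cell1 g v : measurable (hits (cell W g v)).
Proof. by apply: measurable_hits; exact: cell_compact. Qed.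

Section kernel.
Context d (T : measurableType d).
Variables (g : seq bool -> T -> Hy) (v : seq bool).
Hypothesis mg : forall u, (size u < size v)%N -> measurable_fun setT (g u).

Definition rate (s : T) : R := fine (Lambda (hits (cell W (g^~ s) v))).

Lemma Lambda_hits_cell s : Lambda (hits (cell W (g^~ s) v)) = (rate s)%:E.
Proof.
rewrite /rate fineK // -hitting_measure_hits; last exact: cell_sub.
by rewrite fin_num_measure //; exact: measurable_hits_cell1.
Qed.

Lemma rate_ge0 s : (0 <= rate s)%R.
Proof. by rewrite fine_ge0. Qed.

Lemma rate_le s : (rate s <= fine (Lambda (hits W)))%R.
Proof.
rewrite -lee_fin -Lambda_hits_cell fineK; last first.
  by rewrite ge0_fin_numE.
apply: le_measure; rewrite ?inE; [exact: measurable_hits_cell1|exact: measurable_hits|].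
by apply: hits_subset; exact: cell_sub.
Qed.

Lemma measurable_hits_cell_prod :
  measurable [set p : T * Hy | hits (cell W (g^~ p.1) v) p.2].
Proof.
apply: (@measurable_hits_cell _ _ _ _ (fun u p => g u p.1)) => //.
by move=> u uv; apply: (measurableT_comp (mg uv) measurable_fst).
Qed.

Lemma measurable_setI_hits_cell (B : set Hy) : measurable B ->
  measurable_fun setT (fun s => LW (B `&` hits (cell W (g^~ s) v))).
Proof.
move=> mB; apply: (@measurable_measure_section _ _ _ _ _ LW
  (fun s => B `&` hits (cell W (g^~ s) v))).
rewrite (_ : [set _ | _] = (setT `*` B) `&`
    [set p : T * Hy | hits (cell W (g^~ p.1) v) p.2]).
  by apply: measurableI; [exact: measurableX|exact: measurable_hits_cell_prod].
by apply/seteqP; split=> p /= => [[]|[[]]].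
Qed.

Lemma measurable_rate : measurable_fun setT rate.
Proof.
rewrite (_ : rate = fine \o (fun s => LW (setT `&` hits (cell W (g^~ s) v)))).
  by apply: measurableT_comp => //; exact: measurable_setI_hits_cell.
by apply/funext => s /=; rewrite setTI hitting_measure_hits //; exact: cell_sub.
Qed.

(** The conditional probability that the lifetime and the splitting hyperplane of [v] fall in S and
    B. It depends on the hyperplanes of shorter addresses only. *)
Definition transition (S : set (\bar R)) (B : set Hy) (s : T) : \bar R :=
  lifetime_law (rate s) S * split_law Lambda (cell W (g^~ s) v) B.

Lemma split_lawE (B : set Hy) s : split_law Lambda (cell W (g^~ s) v) B =
  if rate s == 0%R then \d_(point : Hy) B
  else LW (B `&` hits (cell W (g^~ s) v)) * ((rate s)^-1)%:E.
Proof.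
rewrite /split_law Lambda_hits_cell eqe hitting_measureE //.
by move=> H [_]; apply: hits_subset; exact: cell_sub.
Qed.

Lemma measurable_split_law (B : set Hy) : measurable B ->
  measurable_fun setT (fun s => split_law Lambda (cell W (g^~ s) v) B).
Proof.
move=> mB; under eq_fun do rewrite split_lawE.
apply: measurable_fun_ifT.
- by apply: measurable_fun_eqr; [exact: measurable_rate|exact: measurable_cst].
- exact: measurable_cst.
apply: emeasurable_funM; first exact: measurable_setI_hits_cell.
apply/measurable_EFinP; apply: measurable_funV_ge0; first exact: measurable_rate.
exact: rate_ge0.
Qed.

Lemma split_law_ge0 B s : 0 <= split_law Lambda (cell W (g^~ s) v) B.
Proof.
rewrite split_lawE; case: ifP => _; first exact: measure_ge0.
by apply: mule_ge0 => //; rewrite lee_fin invr_ge0 rate_ge0.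
Qed.

Lemma split_lawT s : split_law Lambda (cell W (g^~ s) v) setT = 1.
Proof.
rewrite split_lawE; case: ifPn => [_|r0]; first by rewrite diracE mem_set.
rewrite setTI hitting_measure_hits; last exact: cell_sub.
by rewrite Lambda_hits_cell -EFinM mulfV.
Qed.

Lemma split_law_le1 B s : measurable B -> split_law Lambda (cell W (g^~ s) v) B <= 1.
Proof.
move=> mB; rewrite -(split_lawT s) !split_lawE; case: ifPn => _.
  by apply: le_measure; rewrite ?inE.
apply: lee_wpmul2r; first by rewrite lee_fin invr_ge0 rate_ge0.
apply: le_measure; rewrite ?inE //; first by apply: measurableI => //; exact: measurable_hits_cell1.
  by apply: measurableI => //; exact: measurable_hits_cell1.
exact: setSI.
Qed.

Lemma measurable_transition S B : measurable S -> measurable B ->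
  measurable_fun setT (transition S B).
Proof.
move=> mS mB; apply: emeasurable_funM; last exact: measurable_split_law.
by apply: measurable_lifetime_law => //; [exact: measurable_rate|exact: rate_ge0].
Qed.

Lemma transition_ge0 S B s : 0 <= transition S B s.
Proof. by apply: mule_ge0; [apply: lifetime_law_ge0; exact: rate_ge0|exact: split_law_ge0]. Qed.

Lemma transition_fin_num S B s : measurable S -> measurable B ->
  transition S B s \is a fin_num.
Proof.
move=> mS mB; rewrite fin_numM // ge0_fin_numE.
- by apply: le_lt_trans (lifetime_law_le1 _ mS) (ltry _); exact: rate_ge0.
- by apply: lifetime_law_ge0; exact: rate_ge0.
- by apply: le_lt_trans (split_law_le1 _ mB) (ltry _).
- exact: split_law_ge0.
Qed.

Lemma transitionT s : transition setT setT s = 1.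
Proof. by rewrite /transition split_lawT lifetime_lawT ?mule1 // rate_ge0. Qed.

(* The rate cancels against the normalization of the splitting law. *)
Lemma transition_EFin (S : set R) B s : measurable S -> measurable B ->
  transition (EFin @` S) B s =
  expint (rate s) S * LW (B `&` hits (cell W (g^~ s) v)).
Proof.
move=> mS mB; rewrite /transition split_lawE lifetime_lawE ?rate_ge0 //; last first.
  exact: measurable_image_EFin.
rewrite (_ : EFin @^-1` (EFin @` S) = S); last first.
  by apply/seteqP; split=> [x [y Sy [<-]]|x Sx] //; exists x.
(* At rate 0 the lifetime is [+oo] and misses every set of reals, while the right side is 0 because
   [c] is a null set. *)
have [r0|r0] := eqVneq (rate s) 0%R.
  rewrite diracE memNset ?mul0e; last by move=> [].
  suff -> : LW (B `&` hits (cell W (g^~ s) v)) = 0 by rewrite mule0.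
  apply/eqP; rewrite eq_le measure_ge0 andbT.
  have <- : LW (hits (cell W (g^~ s) v)) = 0.
    by rewrite hitting_measure_hits ?Lambda_hits_cell ?r0 //; exact: cell_sub.
  apply: le_measure; rewrite ?inE //; last exact: measurable_hits_cell1.
  by apply: measurableI => //; exact: measurable_hits_cell1.
rewrite muleAC muleA -[X in X * _ = _]muleA [_%:E * _]muleC.
by rewrite -[X in X * _]muleA -EFinM mulVf // mule1 muleC.
Qed.

End kernel.
End split.

Section sigma_finite_product.
Local Open Scope ereal_scope.
Context d1 d2 (T1 : measurableType d1) (T2 : measurableType d2) (R : realType).
Variables (m1 : {sigma_finite_measure set T1 -> \bar R})
  (m2 : {sigma_finite_measure set T2 -> \bar R}).

(* [m1 \x m2] is only canonically a measure; this alias also carries its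
   sigma-finiteness, so that products can be nested. *)
Definition sf_product : set (T1 * T2) -> \bar R := m1 \x m2.

Let sf_product0 : sf_product set0 = 0.
Proof. exact: (measure0 (m1 \x m2)). Qed.

Let sf_product_ge0 A : 0 <= sf_product A.
Proof. exact: (measure_ge0 (m1 \x m2)). Qed.

Let sf_product_sigma_additive : semi_sigma_additive sf_product.
Proof. exact: (@measure_semi_sigma_additive _ _ _ (m1 \x m2)). Qed.

HB.instance Definition _ := isMeasure.Build _ _ _ sf_product
  sf_product0 sf_product_ge0 sf_product_sigma_additive.

Let sf_product_sigma_finite : sigma_finite setT sf_product.
Proof.
have /sigma_finiteP[F [TF ndF Foo]] := sigma_finiteT m1.
have /sigma_finiteP[G [TG ndG Goo]] := sigma_finiteT m2.
exists (fun k => F k `*` G k).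
  apply/seteqP; split=> // -[x y] _.
  have [i _ Fi] : (\bigcup_i F i) x by rewrite -TF.
  have [j _ Gj] : (\bigcup_j G j) y by rewrite -TG.
  exists (maxn i j) => //; split => /=.
    exact: (subsetPset _ _ (ndF _ _ (leq_maxl i j))).
  exact: (subsetPset _ _ (ndG _ _ (leq_maxr i j))).
move=> k; have [mFk Fkoo] := Foo k; have [mGk Gkoo] := Goo k; split.
  exact: measurableX.
by rewrite /sf_product product_measure1E // lte_mul_pinfty // ge0_fin_numE.
Qed.

HB.instance Definition _ := Measure_isSigmaFinite.Build _ _ _ sf_product
  sf_product_sigma_finite.

Lemma sf_tonelli (f : T1 * T2 -> \bar R) : measurable_fun setT f ->
  (forall p, 0 <= f p) ->
  \int[sf_product]_p f p = \int[m1]_x \int[m2]_y f (x, y).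
Proof. by move=> mf f0; exact: fubini_tonelli1. Qed.

Lemma sf_fubini (f : T1 * T2 -> \bar R) : sf_product.-integrable setT f ->
  \int[sf_product]_p f p = \int[m1]_x \int[m2]_y f (x, y).
Proof. by move=> intf; rewrite -(integral12_prod_meas1 intf). Qed.

End sigma_finite_product.

Section conditional_law.
Variables (R : realType) (n : nat).
Local Notation E := 'rV[R]_n.+1.
Local Notation Hy := (hyperplane R n).
Local Open Scope ereal_scope.
Notation mu := (@lebesgue_measure R).
Local Notation RT := (measurableTypeR R).
Variables (W : set E) (Lambda : {measure set Hy -> \bar R}).
Hypotheses (cW : compact W) (hWoo : Lambda (hits W) < +oo).
Variables (d : measure_display) (Omega : measurableType d) (P : probability Omega R).
Variables (L : seq bool -> Omega -> \bar R) (h : seq bool -> Omega -> Hy).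
Hypothesis Y_mnw : mnw_process Lambda L h P W.
Local Notation LW := (hitting_measure cW hWoo).

Let mL v : measurable_fun setT (L v). Proof. by have [] := Y_mnw. Qed.
Let mh v : measurable_fun setT (h v). Proof. by have [] := Y_mnw. Qed.

Definition events (U : set (seq bool)) : set (set Omega) :=
  [set X | exists v, U v /\
     ((exists2 S, measurable S & X = L v @^-1` S) \/
      (exists2 B, measurable B & X = h v @^-1` B))].

(** A copy of Omega carrying the sigma-algebra of the cells in U. Measurability of a function on
    this type says that it is determined by those cells, which takes the place of a filtration. *)
Definition events_type U := g_sigma_algebraType (events U).

Lemma measurable_L_events (U : set (seq bool)) v : U v ->
  measurable_fun [set: events_type U] (L v : events_type U -> \bar R).
Proof.
move=> Uv _ S mS; rewrite setTI; apply: sub_sigma_algebra.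
by exists v; split => //; left; exists S.
Qed.

Lemma measurable_h_events (U : set (seq bool)) v : U v ->
  measurable_fun [set: events_type U] (h v : events_type U -> Hy).
Proof.
move=> Uv _ B mB; rewrite setTI; apply: sub_sigma_algebra.
by exists v; split => //; right; exists B.
Qed.

Lemma events_measurable U (A : set Omega) : <<s events U >> A -> measurable A.
Proof.
move: A; apply: smallest_sub; first exact: sigma_algebra_measurable.
move=> _ [v [_ [[S mS ->]|[B mB ->]]]]; rewrite -[X in measurable X]setTI.
  exact: mL.
exact: mh.
Qed.

Lemma measurable_id_events U : measurable_fun setT (id : Omega -> events_type U).
Proof. by move=> _ A mA; rewrite setTI; apply: events_measurable mA. Qed.

Lemma measurable_fun_events U d' (T : measurableType d') (f : Omega -> T) :
  measurable_fun [set: events_type U] (f : events_type U -> T) ->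
  measurable_fun setT f.
Proof. move=> mf _ Y mY; rewrite setTI; apply: (@events_measurable U).
by have := mf measurableT Y mY; rewrite setTI. Qed.

Lemma events_sub U V (A : set Omega) : U `<=` V -> <<s events U >> A -> <<s events V >> A.
Proof.
move=> UV; apply: sub_smallest2r; first exact: smallest_sigma_algebra.
by move=> X [v [Uv hv]]; exists v; split => //; exact: UV.
Qed.

Definition before k : set (seq bool) := [set u | (size u < k)%N].
(** Besides the earlier generations this contains the other cells of the generation of [v].
    Conditioning on all of them is what later separates contributions of cells that live side by
    side. *)
Definition past v : set (seq bool) := [set u | (size u <= size v)%N /\ u <> v].

Lemma before_past v : before (size v) `<=` past v.
Proof.
move=> u /= uv; split; first exact: ltnW.
by move=> uE; move: uv; rewrite /before /= uE ltnn.
Qed.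

Local Notation trans := (transition W Lambda h).

Lemma measurable_trans U v S B : before (size v) `<=` U ->
  measurable S -> measurable B ->
  measurable_fun [set: events_type U] (trans v S B : events_type U -> \bar R).
Proof.
move=> vU mS mB; apply: (measurable_transition cW hWoo) => // u uv.
by apply: measurable_h_events; apply: vU.
Qed.

Lemma mnw_step (v : seq bool) (A : set Omega)
    (S : (size v).-tuple bool -> set (\bar R)) (B : (size v).-tuple bool -> set Hy) :
  <<s events (before (size v)) >> A ->
  (forall u, measurable (S u)) -> (forall u, measurable (B u)) ->
  P (A `&` [set w | forall u : (size v).-tuple bool, S u (L u w) /\ B u (h u w)]) =
  \int[P]_(w in A) \prod_(u : (size v).-tuple bool) trans u (S u) (B u) w.
Proof. by have [_ _] := Y_mnw; apply. Qed.

Lemma measurable_eprod (T : measurableType d) (I : Type) (r : seq I) (Q : pred I)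
    (f : I -> T -> \bar R) : (forall i, measurable_fun setT (f i)) ->
  measurable_fun setT (fun w => \prod_(i <- r | Q i) f i w).
Proof.
move=> mf; elim: r => [|i r IH].
  by under eq_fun do rewrite big_nil; exact: measurable_cst.
under eq_fun do rewrite big_cons; case: (Q i) => //.
exact: emeasurable_funM.
Qed.

Section generation.
Variable v : seq bool.
Local Notation k := (size v).
Local Notation tv := (in_tuple v).
Variables (S : k.-tuple bool -> set (\bar R)) (B : k.-tuple bool -> set Hy).
Hypotheses (mS : forall u, measurable (S u)) (mB : forall u, measurable (B u)).

Definition others : set Omega :=
  [set w | forall u : k.-tuple bool, u != tv -> S u (L u w) /\ B u (h u w)].

Lemma measurable_others U : past v `<=` U -> <<s events U >> others.
Proof.
move=> vU.
have -> : others = \bigcap_(u in [set u : k.-tuple bool | u != tv])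
    ((L u @^-1` S u) `&` (h u @^-1` B u)).
  by apply/seteqP; split=> w hw u uv; exact: hw.
suff : measurable (\bigcap_(u in [set u : k.-tuple bool | u != tv])
    ((L u @^-1` S u) `&` (h u @^-1` B u)) : set (events_type U)) by [].
apply: fin_bigcap_measurable => // u /= utv.
have Uu : U u.
  apply: vU; split; first by rewrite size_tuple.
  by move=> uv; case/eqP: utv; apply: val_inj.
apply: measurableI; rewrite -[X in measurable X]setTI.
  exact: (measurable_L_events Uu).
exact: (measurable_h_events Uu).
Qed.

Let rho w := \prod_(u : k.-tuple bool | u != tv) trans u (S u) (B u) w.

Let mtrans u S' B' : measurable S' -> measurable B' -> measurable_fun setT (trans u S' B').
Proof.
by move=> mS' mB'; apply: (measurable_transition cW hWoo) => // w _; exact: mh.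
Qed.

Let mrho : measurable_fun setT rho.
Proof. by apply: measurable_eprod => u; exact: mtrans. Qed.

Let rho_ge0 w : 0 <= rho w.
Proof. by apply: prode_ge0 => u _; exact: transition_ge0. Qed.

Let rho_fin w : rho w \is a fin_num.
Proof. by apply: prode_fin_num => u _; exact: transition_fin_num. Qed.

(** Given the earlier generations, [rho] is the conditional probability of [others]. Functions of
    the earlier generations can thus exchange restriction to this event for the factor [rho]. *)
Lemma others_density (g : Omega -> \bar R) :
  measurable_fun [set: events_type (before k)] (g : events_type (before k) -> \bar R) ->
  (forall w, 0 <= g w) ->
  \int[P]_(w in others) g w = \int[P]_w (g w * rho w).
Proof.
move=> mg g0; have mO : measurable others by apply: (@events_measurable (past v)); apply: measurable_others.
have Ooo : P others < +oo by rewrite ltey_eq fin_num_measure.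
rewrite -(integral_mfrestr mO Ooo) //; last exact: measurable_fun_events mg.
apply: (@ge0_integral_density _ _ _ Omega Omega (events_type (before k)) R
  (mfrestr mO Ooo) P id id rho measurable) => //.
- exact: measurable_id_events.
- exact: measurable_id_events.
- exact: sigma_algebra_measurable_id.
- by move=> A C; exact: measurableI.
move=> A mA; rewrite /= /mfrestr /mrestr /=.
(* The cell [v] is left unconstrained, so its factor in the product formula is the total mass 1. *)
pose S' u := if u == tv then setT else S u.
pose B' u := if u == tv then setT else B u.
have := @mnw_step v A S' B' mA; rewrite (_ : _ `&` _ = A `&` others); last first.
  congr (_ `&` _); apply/seteqP; split=> w hw u.
    by move=> utv; have := hw u; rewrite /S' /B' (negbTE utv).
  by rewrite /S' /B'; case: (eqVneq u tv) => // utv; exact: hw.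
move=> ->.
- apply: eq_integral => w _; rewrite (bigD1 tv) //= /S' /B' eqxx (transitionT cW hWoo) mul1e.
  by apply: eq_bigr => u utv; rewrite (negbTE utv).
- by move=> u; rewrite /S'; case: ifP.
- by move=> u; rewrite /B'; case: ifP.
Qed.

(** The factor of [v] in the product depends on earlier generations only. Hence [others_density]
    turns the remaining factors back into restriction to [others], leaving the transition of [v]
    alone. *)
Lemma others_step (A : set Omega) S0 B0 : <<s events (before k) >> A ->
  measurable S0 -> measurable B0 ->
  P ((A `&` others) `&` [set w | S0 (L v w) /\ B0 (h v w)]) =
  \int[P]_(w in A `&` others) trans v S0 B0 w.
Proof.
move=> mA mS0 mB0.
pose S' u := if u == tv then S0 else S u.
pose B' u := if u == tv then B0 else B u.
have := @mnw_step v A S' B' mA; rewrite (_ : _ `&` _ =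
    (A `&` others) `&` [set w | S0 (L v w) /\ B0 (h v w)]); last first.
  apply/seteqP; split=> w /=.
    move=> [Aw hw]; split; last by have := hw tv; rewrite /S' /B' eqxx.
    by split=> // u utv; have := hw u; rewrite /S' /B' (negbTE utv).
  move=> [[Aw hw] hv]; split=> // u; rewrite /S' /B'.
  by case: (eqVneq u tv) => [->|utv]; [exact: hv|exact: hw].
move=> ->; last 2 first.
- by move=> u; rewrite /S'; case: ifP.
- by move=> u; rewrite /B'; case: ifP.
have mA' := events_measurable mA.
have mO : measurable others by apply: (@events_measurable (past v)); apply: measurable_others.
rewrite setIC [RHS]integral_mkcondr others_density; last 2 first.
- apply/(measurable_restrictT _ (_ : measurable (A : set (events_type (before k))))) => //.
  by apply: measurable_funTS; exact: measurable_trans.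
- by move=> w; rewrite patchE; case: ifP => // _; exact: transition_ge0.
rewrite [LHS]integral_mkcond; apply: eq_integral => w _.
rewrite !patchE; case: ifP => _; last by rewrite mul0e.
rewrite (bigD1 tv) //= /S' /B' eqxx; congr (_ * _).
by apply: eq_bigr => u utv; rewrite (negbTE utv).
Qed.

End generation.

(** The transition of [v] is unchanged when the conditioning is enlarged from the earlier
    generations to the whole past: [others_step] gives this on a generating pi-system. *)
Lemma past_rect (v : seq bool) (A : set Omega) S0 B0 : <<s events (past v) >> A ->
  measurable S0 -> measurable B0 ->
  P (A `&` [set w | S0 (L v w) /\ B0 (h v w)]) =
  \int[P]_(w in A) trans v S0 B0 w.
Proof.
move=> mA mS0 mB0.
(* An event of the earlier generations intersected with a rectangle for the other cells of the same
   generation. Such sets are stable under intersection and generate the past. *)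
pose G : set (set Omega) := [set C | exists A0 S B, [/\ <<s events (before (size v)) >> A0,
  forall u : (size v).-tuple bool, measurable (S u : set (\bar R)),
  forall u : (size v).-tuple bool, measurable (B u : set Hy) &
  C = A0 `&` others S B]].
have mE : measurable [set w | S0 (L v w) /\ B0 (h v w)].
  rewrite (_ : [set _ | _] = (L v @^-1` S0) `&` (h v @^-1` B0)) //.
  by apply: measurableI; rewrite -[X in measurable X]setTI; [exact: mL|exact: mh].
have Eoo : P [set w | S0 (L v w) /\ B0 (h v w)] < +oo by rewrite ltey_eq fin_num_measure.
have GE : <<s events (past v) >> = <<s G >>.
  apply/seteqP; split; apply: smallest_sub; try exact: smallest_sigma_algebra.
    move=> X [u [[uv uN] hX]]; apply: sub_sigma_algebra.
    have [us|us] := ltnP (size u) (size v).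
      exists X, (fun=> setT), (fun=> setT); split => //; first by apply: sub_sigma_algebra; exists u.
      by rewrite (_ : others _ _ = setT) ?setIT //; apply/seteqP; split.
    have usv : size u == size v by rewrite eqn_leq uv us.
    pose tu := Tuple usv.
    have tuN : tu != in_tuple v by apply/eqP => /(congr1 val).
    case: hX => [[S mS ->]|[B mB ->]].
      exists setT, (fun u' => if u' == tu then S else setT), (fun=> setT); split.
      - exact: (@measurableT _ (events_type (before (size v)))).
      - by move=> u'; case: ifP.
      - by [].
      rewrite setTI; apply/seteqP; split=> w /=.
        by move=> Sw u' u'N; case: eqP => // ->.
      by move=> /(_ tu tuN); rewrite eqxx => -[].
    exists setT, (fun=> setT), (fun u' => if u' == tu then B else setT); split.
    - exact: (@measurableT _ (events_type (before (size v)))).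
    - by [].
    - by move=> u'; case: ifP.
    rewrite setTI; apply/seteqP; split=> w /=.
      by move=> Sw u' u'N; case: eqP => // ->.
    by move=> /(_ tu tuN); rewrite eqxx => -[].
  move=> _ [A0 [S [B [mA0 mS mB ->]]]].
  suff : measurable (A0 `&` others S B : set (events_type (past v))) by [].
  apply: measurableI; last exact: measurable_others.
  exact: events_sub (@before_past v) mA0.
apply: (@measure_density _ _ _ Omega Omega (events_type (past v)) R (mfrestr mE Eoo) P
  id id (trans v S0 B0) G _ _ _ _ _ _ _ _ A mA).
- exact: measurable_id_events.
- exact: measurable_id_events.
- by apply: (@measurable_fun_events (past v)); apply: measurable_trans => //; exact: before_past.
- by move=> w; exact: transition_ge0.
- exact: GE.
- move=> _ _ [A1 [S1 [B1 [mA1 mS1 mB1 ->]]]] [A2 [S2 [B2 [mA2 mS2 mB2 ->]]]].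
  exists (A1 `&` A2), (fun u => S1 u `&` S2 u), (fun u => B1 u `&` B2 u); split.
  + exact: (@measurableI _ (events_type (before (size v)))).
  + by move=> u; exact: measurableI.
  + by move=> u; exact: measurableI.
  apply/seteqP; split=> w /=.
    by move=> [[a1 h1] [a2 h2]]; split=> // u uN; have [? ?] := h1 u uN; have [? ?] := h2 u uN.
  move=> [[a1 a2] hh]; split; split=> // u uN; have [[? ?] [? ?]] := hh u uN; split => //.
- exists setT, (fun=> setT), (fun=> setT); split => //.
    exact: (@measurableT _ (events_type (before (size v)))).
  by rewrite setTI; apply/seteqP; split.
- move=> _ [A1 [S1 [B1 [mA1 mS1 mB1 ->]]]].
  by rewrite /= /mfrestr /mrestr /= -others_step.
Qed.

(** Off this event the lifetime is infinite or equal to [-oo], [fine] returns a default, and the law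
    of the lifetime has no density. *)
Definition finite_lifetime v : set Omega := L v @^-1` (EFin @` setT).

Lemma measurable_finite_lifetime v : measurable (finite_lifetime v).
Proof.
rewrite -[X in measurable X]setTI; apply: mL => //.
exact: (measurable_image_EFin measurableT).
Qed.

Lemma finite_lifetime_lty v : P (finite_lifetime v) < +oo.
Proof. by rewrite ltey_eq fin_num_measure //; exact: measurable_finite_lifetime. Qed.

Definition outcome v (w : Omega) : events_type (past v) * (RT * Hy) :=
  (w, (fine (L v w), h v w)).

Lemma measurable_outcome v : measurable_fun setT (outcome v).
Proof.
apply: measurable_fun_pair; first exact: measurable_id_events.
by apply: measurable_fun_pair => //; exact: measurableT_comp.
Qed.

(** Joint density of the past, the finite lifetime and the splitting hyperplane with respect to
    [ref_measure]. The factor [rate] is missing because it has cancelled, as in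
    [transition_EFin]. *)
Definition intensity v (p : Omega * (RT * Hy)) : \bar R :=
  ((\1_(hits (cell W (h^~ p.1) v)) p.2.2) *
   (\1_(`[0%R, +oo[%classic) p.2.1 * expR (- rate W Lambda h v p.1 * p.2.1)))%:E.

Lemma measurable_intensity v : measurable_fun setT (intensity v).
Proof.
apply/measurable_EFinP; apply: measurable_funM.
  rewrite (_ : (fun p => _) = \1_[set p : Omega * (RT * Hy) |
      hits (cell W (h^~ p.1) v) p.2.2]); last first.
    by apply/funext => p; rewrite !indicE; congr (nat_of_bool _)%:R; apply/idP/idP; rewrite !inE.
  apply: measurable_indic.
  apply: (@measurable_hits_cell _ _ _ _ (fun u (p : Omega * (RT * Hy)) => h u p.1) v _ W
    (fun p => p.2.2)) => //.
    by move=> u _; exact: (measurableT_comp (mh u) measurable_fst).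
  exact: (measurableT_comp measurable_snd measurable_snd).
have ml : measurable_fun setT (fun p : Omega * (RT * Hy) => p.2.1).
  exact: (measurableT_comp measurable_fst measurable_snd).
apply: measurable_funM.
  apply: (measurableT_comp (f := \1_(`[0%R, +oo[%classic) : R -> R)) => //.
apply: measurable_expR_rate => //.
apply: (measurableT_comp (f := rate W Lambda h v)); last exact: measurable_fst.
by apply: (measurable_rate cW hWoo) => u _; exact: mh.
Qed.

Lemma intensity_ge0 v p : 0 <= intensity v p.
Proof. by rewrite lee_fin !mulr_ge0 ?expR_ge0 // indicE. Qed.

Definition clock_measure : {sigma_finite_measure set (RT * Hy)%type -> \bar R} :=
  sf_product mu LW.
Definition ref_measure : {sigma_finite_measure set (Omega * (RT * Hy))%type -> \bar R} :=
  sf_product P clock_measure.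
Local Notation nu := ref_measure.

Lemma clock_tonelli (f : RT * Hy -> \bar R) : measurable_fun setT f ->
  (forall p, 0 <= f p) ->
  \int[clock_measure]_p f p = \int[mu]_l \int[LW]_H f (l, H).
Proof. by move=> mf f0; exact: (@sf_tonelli _ _ _ _ R mu LW). Qed.

Lemma ref_tonelli (f : Omega * (RT * Hy) -> \bar R) : measurable_fun setT f ->
  (forall p, 0 <= f p) ->
  \int[nu]_p f p = \int[P]_w \int[clock_measure]_p f (w, p).
Proof. by move=> mf f0; exact: (@sf_tonelli _ _ _ _ R P clock_measure). Qed.

Lemma intensity_rect v (A : set Omega) (S : set R) (B : set Hy) :
  measurable A -> measurable S -> measurable B ->
  \int[nu]_(p in A `*` (S `*` B)) intensity v p =
  \int[P]_(w in A) trans v (EFin @` S) B w.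
Proof.
move=> mA mS mB.
rewrite [LHS]integral_mkcond.
rewrite ref_tonelli; last 2 first.
- have mR : measurable (A `*` (S `*` B) : set (Omega * (RT * Hy))).
    by do 2 (apply: measurableX => //).
  by apply/(measurable_restrictT _ mR)/measurable_funTS; exact: measurable_intensity.
- by move=> p; rewrite patchE; case: ifP => // _; exact: intensity_ge0.
rewrite [RHS]integral_mkcond; apply: eq_integral => w _; rewrite patchE.
have [wA|wA] := boolP (w \in A); last first.
  apply: integral0_eq => p _; rewrite patchE; case: ifPn => //.
  by rewrite inE => -[/= Aw _]; move: wA; rewrite notin_setE.
rewrite (transition_EFin cW hWoo) //.
pose f (p : RT * Hy) : \bar R := ((\1_S p.1 * (\1_(`[0%R, +oo[%classic) p.1 *
    expR (- rate W Lambda h v w * p.1))) * \1_(B `&` hits (cell W (h^~ w) v)) p.2)%:E.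
have mc : measurable (hits (cell W (h^~ w) v)) by exact: measurable_hits_cell1.
have mi1 : measurable_fun setT (fun l : R => (\1_S l * (\1_(`[0%R, +oo[%classic) l *
    expR (- rate W Lambda h v w * l)))%R).
  exact: (measurable_expint_integrand (measurable_cst _) (@measurable_id _ _ _)).
transitivity (\int[clock_measure]_p f p).
  apply: eq_integral => -[l H] _; rewrite /f patchE /intensity /= !indicE.
  have -> : ((w, (l, H)) \in A `*` (S `*` B)) = (l \in S) && (H \in B).
    by rewrite !in_setX /= wA.
  rewrite in_setI; case: (l \in S); case: (H \in B) => /=; rewrite ?mul0r ?mulr0 ?mul1r //.
  by rewrite mulrC.
rewrite clock_tonelli; last 2 first.
- apply/measurable_EFinP; apply: measurable_funM.
    exact: (measurableT_comp mi1 measurable_fst).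
  apply: (measurableT_comp (f := \1_(B `&` hits (cell W (h^~ w) v)) : Hy -> R)) => //.
  by apply: measurable_indic; exact: measurableI.
- by move=> p; rewrite lee_fin !mulr_ge0 ?expR_ge0 // indicE.
rewrite /expint muleC -ge0_integralZl //; last exact/measurable_EFinP.
apply: eq_integral => l _; rewrite /f /=.
under eq_integral do rewrite EFinM.
rewrite ge0_integralZl //.
- by rewrite integral_indic ?setIT // 1?muleC //; exact: measurableI.
- by apply/measurable_EFinP; apply: measurable_indic; exact: measurableI.
Qed.

(** The form of the conditional law that is used from here on: functions [g] may depend on the past,
    the lifetime and the hyperplane jointly. Two nested monotone class arguments lead from the
    rectangles of [past_rect] to general measurable sets and then to functions. *)
Lemma past_law v (g : events_type (past v) * (RT * Hy) -> R) :
  measurable_fun setT g ->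
  \int[mfrestr (measurable_finite_lifetime v) (finite_lifetime_lty v)]_w
    (g (outcome v w))%:E =
  \int[nu]_p ((g p)%:E * intensity v p).
Proof.
move=> mg.
have mid : measurable_fun setT (id : Omega * (RT * Hy) -> events_type (past v) * (RT * Hy)).
  apply/measurable_fun_pairP; split; last exact: measurable_snd.
  exact: (measurableT_comp (@measurable_id_events (past v)) measurable_fst).
apply: (@integral_density _ _ _ Omega (Omega * (RT * Hy))%type
  (events_type (past v) * (RT * Hy))%type R
  (mfrestr (measurable_finite_lifetime v) (finite_lifetime_lty v)) nu
  (outcome v) id (intensity v)
  [set A `*` D | A in @measurable _ (events_type (past v)) & D in @measurable _ (RT * Hy)%type]).
- exact: measurable_outcome.
- exact: mid.
- exact: measurable_intensity.
- by move=> p; exact: intensity_ge0.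
- by [].
- exact: measurable_prod_measurableType.
- move=> _ _ [A1 mA1 [D1 mD1 <-]] [A2 mA2 [D2 mD2 <-]].
  exists (A1 `&` A2); first exact: measurableI.
  by exists (D1 `&` D2); [exact: measurableI|rewrite setXI].
- by exists setT => //; exists setT => //; rewrite setXTT.
- move=> _ [A mA [D mD <-]].
  have mA' := events_measurable mA.
  have mE : measurable ((A : set Omega) `&` finite_lifetime v).
    by apply: measurableI => //; exact: measurable_finite_lifetime.
  have Eoo : P ((A : set Omega) `&` finite_lifetime v) < +oo by rewrite ltey_eq fin_num_measure.
  have mX : measurable_fun setT (fun w => (fine (L v w), h v w)).
    by apply: measurable_fun_pair => //; exact: measurableT_comp.
  (* The inner argument: the past event A is fixed while D grows from rectangles [S * B] to
     arbitrary measurable sets of times and hyperplanes. *)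
  have e : mfrestr mE Eoo ((fun w => (fine (L v w), h v w)) @^-1` D) =
      \int[nu]_(p in snd @^-1` D) (intensity v \_ (A `*` setT)) p.
    have mAT : measurable (A `*` setT : set (Omega * (RT * Hy))) by exact: measurableX.
    apply: (@measure_density _ _ _ Omega (Omega * (RT * Hy))%type (RT * Hy)%type R
      (mfrestr mE Eoo) nu (fun w => (fine (L v w), h v w)) snd
      (intensity v \_ (A `*` setT))
      [set S `*` B | S in @measurable _ RT & B in @measurable _ Hy] mX measurable_snd
      _ _ _ _ _ _ D mD).
    + by apply/(measurable_restrictT _ mAT)/measurable_funTS; exact: measurable_intensity.
    + by move=> p; rewrite patchE; case: ifP => // _; exact: intensity_ge0.
    + exact: measurable_prod_measurableType.
    + move=> _ _ [A1 mA1 [D1 mD1 <-]] [A2 mA2 [D2 mD2 <-]].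
      exists (A1 `&` A2); first exact: measurableI.
      by exists (D1 `&` D2); [exact: measurableI|rewrite setXI].
    + by exists setT => //; exists setT => //; rewrite setXTT.
    move=> _ [S mS [B mB <-]]; rewrite -integral_mkcondr.
    rewrite (_ : _ `&` _ = (A : set Omega) `*` (S `*` B)); last first.
      by apply/seteqP; split=> p /=; [move=> [[? ?] [? ?]]|move=> [? [? ?]]].
    rewrite intensity_rect // -past_rect //; last exact: measurable_image_EFin.
    rewrite /mfrestr /mrestr; congr (P _); apply/seteqP; split=> w /=.
      by move=> [[Sw Bw] [Aw [l _ lE]]]; move: Sw; rewrite -lE /= => Sl; split=> //; split=> //; exists l.
    by move=> [Aw [[l Sl lE] Bw]]; rewrite -lE /=; do 2 split=> //; exists l.
  transitivity (mfrestr mE Eoo ((fun w => (fine (L v w), h v w)) @^-1` D)).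
    rewrite /mfrestr /mrestr; congr (P _).
    by apply/seteqP; split=> w /=; [move=> [[? ?] ?]|move=> [? [? ?]]].
  rewrite e -integral_mkcondr; congr (integral _ _ _).
  by apply/seteqP; split=> p /=; [move=> [? [? ?]]|move=> [? ?]].
- exact: mg.
Qed.

End conditional_law.

Lemma supported_integrable d (T : measurableType d) (R : realType)
    (m : {measure set T -> \bar R}) (f : T -> R) (A : set T) (C : R) :
  measurable_fun setT f -> measurable A -> (m A < +oo)%E ->
  (forall x, `|f x| <= C) -> (forall x, ~ A x -> f x = 0) ->
  m.-integrable setT (EFin \o f).
Proof.
move=> mf mA Aoo fC f0.
have intA : m.-integrable A (EFin \o f).
  apply: measurable_bounded_integrable => //; first exact: measurable_funTS.
  exists C; split; first by rewrite num_real.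
  by move=> x Cx y _; apply: le_trans (fC y) _; exact: ltW.
have := (@integrable_mkcond _ _ _ m A (EFin \o f) mA).1 intA.
congr (integrable _ _ _); apply/funext => x; rewrite patchE /=.
by case: ifPn => // /negP; rewrite inE => /f0 ->.
Qed.

Lemma integral_mfrestr_EFin d (T : measurableType d) (R : realType)
    (m : {measure set T -> \bar R}) (E : set T)
    (mE : measurable E) (Eoo : (m E < +oo)%E) (g : T -> R) :
  measurable_fun setT g ->
  (\int[mfrestr mE Eoo]_x (g x)%:E = \int[m]_x (\1_E x * g x)%:E)%E.
Proof.
move=> mg.
rewrite (@integral_density _ _ _ T T T R (mfrestr mE Eoo) m id id
  (fun x => (\1_E x)%:E) measurable) //.
- by apply: eq_integral => x _; rewrite -EFinM mulrC.
- by apply/measurable_EFinP; exact: measurable_indic.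
- exact: sigma_algebra_measurable_id.
- by move=> A B; exact: measurableI.
- by move=> A mA; rewrite /= /mfrestr /mrestr /= integral_indic // setIC.
Qed.

(** * Remaining time of a cell *)

Section clocks.
Variables (R : realType) (t : R).
Implicit Types (L : seq bool -> \bar R) (v : seq bool).

(* The value -1 encodes a cell that is not born before time t. *)
Fixpoint remaining L v : R :=
  if v is _ :: u then
    if (0 <= L u)%E && (L u <= (remaining L u)%:E)%E
    then remaining L u - fine (L u) else -1
  else t.

(** The sign condition on the lifetime is part of the test because lifetimes are nonnegative only
    almost surely. With it, bounds such as [remaining_le] hold for every outcome. *)
Definition splits L v : bool := (0 <= L v)%E && (L v <= (remaining L v)%:E)%E.

Lemma splitsP L v : splits L v ->
  exists l, [/\ L v = l%:E, 0 <= l & l <= remaining L v].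
Proof.
rewrite /splits; case: (L v) => [l| |] //=.
  by rewrite !lee_fin => /andP[? ?]; exists l.
by rewrite leye_eq andbF.
Qed.

Lemma splits_fine L v : splits L v = (L v \is a fin_num) &&
  ((0 <= fine (L v)) && (fine (L v) <= remaining L v)).
Proof.
rewrite /splits; case: (L v) => [l| |] //=.
by rewrite leye_eq andbF.
Qed.

Lemma remaining_cons L b v :
  remaining L (b :: v) = if splits L v then remaining L v - fine (L v) else -1.
Proof. by []. Qed.

Lemma remaining_splits L v : splits L v -> 0 <= remaining L v.
Proof. by move=> /splitsP[l [_ l0 lr]]; exact: le_trans lr. Qed.

Lemma remaining_child_ge0 L b v : (0 <= remaining L (b :: v)) = splits L v.
Proof.
rewrite remaining_cons; case: ifP => [/splitsP[l [-> _ lr]]|_] /=.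
  by rewrite subr_ge0.
by rewrite oppr_ge0 ler10.
Qed.

Lemma remaining_le L v : 0 <= t -> remaining L v <= t.
Proof.
move=> t0; elim: v => [|b v IH] //; rewrite remaining_cons; case: ifP => [|_].
  by move=> /splitsP[l [-> l0 _]] /=; lra.
lra.
Qed.

Section measurability.
Context d (T : measurableType d).
Variables (L : seq bool -> T -> \bar R) (v : seq bool).

Lemma measurable_splits_gen u (r : T -> R) :
  measurable_fun setT (L u) -> measurable_fun setT r ->
  measurable_fun setT (fun s => (0 <= L u s)%E && (L u s <= (r s)%:E)%E).
Proof.
move=> mL mr; apply: measurable_and; apply: measurable_fun_lee => //.
exact/measurable_EFinP.
Qed.

Lemma measurable_remaining :
  (forall u, (size u < size v)%N -> measurable_fun setT (L u)) ->
  measurable_fun setT (fun s => remaining (L^~ s) v).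
Proof.
elim: v => [|b u IH] mL /=; first exact: measurable_cst.
have mu : measurable_fun setT (fun s => remaining (L^~ s) u).
  by apply: IH => w wu; apply: mL => /=; exact: ltnW.
apply: measurable_fun_ifT.
- by apply: measurable_splits_gen => //; exact: mL.
- apply: measurable_funB => //; apply: measurableT_comp => //; exact: mL.
- exact: measurable_cst.
Qed.

End measurability.
End clocks.

Lemma measurable_bool_natr d (T : measurableType d) (R : realType) (b : T -> bool) :
  measurable_fun setT b -> measurable_fun setT (fun x => (b x)%:R : R).
Proof.
move=> mb; rewrite (_ : (fun x => _) = (fun x => if b x then 1 else 0)).
  by apply: measurable_fun_ifT => //; exact: measurable_cst.
by apply/funext => x; case: (b x).
Qed.

(** * The expectation formula for one split *)

Section step.
Variables (R : realType) (n : nat).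
Local Notation E := 'rV[R]_n.+1.
Local Notation Hy := (hyperplane R n).
Notation mu := (@lebesgue_measure R).
Local Notation RT := (measurableTypeR R).
Variables (W : set E) (Lambda : {measure set Hy -> \bar R}).
Hypotheses (cW : compact W) (hWoo : (Lambda (hits W) < +oo)%E).
Variables (d : measure_display) (Omega : measurableType d) (P : probability Omega R).
Variables (L : seq bool -> Omega -> \bar R) (h : seq bool -> Omega -> Hy).
Hypothesis Y_mnw : mnw_process Lambda L h P W.
Local Notation LW := (hitting_measure cW hWoo).
Variables (t : R) (t_ge0 : 0 <= t).

Local Notation rem v w := (remaining t (L^~ w) v).
Local Notation spl v w := (splits t (L^~ w) v).
Local Notation c v w := (cell W (h^~ w) v).
Local Notation a := (rate W Lambda h).

(** J is the value of the integral of [g] over [c], and G is an antiderivative of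
    [expR (- a * l) * J] supplied at the point of use, so that the integral over the lifetime
    becomes a boundary term. Bounds on [g] are required only for lifetimes that end before time
    t. *)
Lemma mnw_step_formula v (g : Omega -> R -> Hy -> R) (C : R) (J G : Omega -> R -> R) :
  measurable_fun [set: events_type L h (past v) * (RT * Hy)]
    (fun p => g p.1 p.2.1 p.2.2) ->
  (forall w l H, 0 <= l -> l <= rem v w -> `|g w l H| <= C) ->
  (forall w l, 0 <= l -> l <= rem v w ->
    (\int[LW]_(H in hits (c v w)) (g w l H)%:E = (J w l)%:E)%E) ->
  (forall w, 0 <= rem v w ->
    forall l, is_derive l (1 : R) (G w) (expR (- a v w * l) * J w l)) ->
  (forall w, 0 <= rem v w -> continuous (fun l => expR (- a v w * l) * J w l)) ->
  (\int[P]_w ((spl v w)%:R * g w (fine (L v w)) (h v w))%:E =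
   \int[P]_w (if 0 <= rem v w then G w (rem v w) - G w 0 else 0)%:E)%E.
Proof.
move=> mg gC gJ dG cG.
have [mL mh _] := Y_mnw.
pose T := events_type L h (past v).
have mremT : measurable_fun [set: T] (fun w : T => rem v w).
  apply: measurable_remaining => u uv; apply: (measurable_L_events (U := past v)).
  exact: before_past.
have Tid : measurable_fun [set: Omega * (RT * Hy)]
    (id : Omega * (RT * Hy) -> T * (RT * Hy)).
  apply/measurable_fun_pairP; split; last exact: measurable_snd.
  exact: (measurableT_comp (measurable_id_events Y_mnw (U := past v)) measurable_fst).
(* The indicator of a split before t; it cuts [g] down to the range of times where it is
   controlled. *)
pose ind (p : T * (RT * Hy)) : bool := (0 <= p.2.1) && (p.2.1 <= rem v p.1).
have ml : measurable_fun [set: T * (RT * Hy)] (fun p => p.2.1).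
  exact: (measurableT_comp measurable_fst measurable_snd).
have mind : measurable_fun [set: T * (RT * Hy)] (fun p => (ind p)%:R : R).
  apply: measurable_bool_natr; apply: measurable_and; apply: measurable_fun_ler => //.
  exact: (measurableT_comp mremT measurable_fst).
pose g1 (p : T * (RT * Hy)) : R := (ind p)%:R * g p.1 p.2.1 p.2.2.
have mg1 : measurable_fun [set: T * (RT * Hy)] g1 by exact: measurable_funM.
have g1C p : `|g1 p| <= `|C|.
  rewrite /g1 normrM; case Hi : (ind p); last by rewrite normr0 mul0r.
  move/andP: Hi => [l0 lr]; rewrite normr1 mul1r.
  exact: le_trans (gC _ _ _ l0 lr) (ler_norm _).
have mo := measurable_outcome Y_mnw (v := v).
have mF := measurable_finite_lifetime Y_mnw v.
transitivity (\int[mfrestr mF (finite_lifetime_lty Y_mnw v)]_w (g1 (outcome L h v w))%:E)%E.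
  rewrite integral_mfrestr_EFin; last exact: (measurableT_comp mg1 mo).
  apply: eq_integral => w _; congr EFin.
  rewrite /g1 /outcome /ind /= indicE splits_fine mulrA; congr (_ * _).
  have -> : (w \in finite_lifetime L v) = (L v w \is a fin_num).
    apply/idP/idP; rewrite /finite_lifetime inE /=; first by move=> [l _ <-].
    by case: (L v w) => // l _; exists l.
  by case: (_ \is a fin_num); rewrite ?mul1r ?mul0r.
rewrite (past_law cW hWoo Y_mnw mg1).
pose den (p : Omega * (RT * Hy)) : R := \1_(hits (c v p.1)) p.2.2 *
   (\1_(`[0%R, +oo[%classic) p.2.1 * expR (- a v p.1 * p.2.1)).
have mden : measurable_fun setT den.
  by have /measurable_EFinP := measurable_intensity cW hWoo Y_mnw v.
pose f (p : Omega * (RT * Hy)) : R := g1 p * den p.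
have mf : measurable_fun setT f.
  by apply: measurable_funM => //; exact: (measurableT_comp mg1 Tid).
have fC p : `|f p| <= `|C|.
  have [Hi|Hi] := boolP (ind p); last first.
    by rewrite /f /g1 (negbTE Hi) !mul0r normr0.
  rewrite /f normrM -[leRHS]mulr1; apply: ler_pM => //.
  move/andP: Hi => [l0 _].
  rewrite /den ger0_norm ?mulr_ge0 ?expR_ge0 //.
  have e1 : expR (- a v p.1 * p.2.1) <= 1.
    rewrite -[leRHS]expR0 ler_expR mulNr oppr_le0 mulr_ge0 //; exact: rate_ge0.
  rewrite !indicE; case: (_ \in _); last by rewrite mul0r.
  by rewrite mul1r; case: (_ \in _); rewrite ?mul1r ?mul0r.
(* The clock carries infinite Lebesgue measure. The cutoff confines the integrand to times in
   [0, t], where the reference measure is finite, and the bounded integrand becomes integrable. *)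
have f0 (p : Omega * (RT * Hy)) : ~ (0 <= p.2.1 <= t) -> f p = 0.
  move=> np; rewrite /f /g1; case Hi : (ind p); last by rewrite !mul0r.
  case: np; move/andP: Hi => [l0 lr]; rewrite l0 /=.
  by apply: le_trans lr _; exact: remaining_le.
pose I0 : set RT := `[0, t]%classic.
have I0P l : 0 <= l <= t -> I0 l by rewrite /I0 /= in_itv.
have mI : measurable I0 by exact: measurable_itv.
have mIH : measurable (I0 `*` [set: Hy]) by exact: measurableX.
have clock_lty : (clock_measure cW hWoo (I0 `*` [set: Hy]) < +oo)%E.
  rewrite /clock_measure /= /sf_product product_measure1E //.
  rewrite lte_mul_pinfty //.
  - have := lebesgue_measure_itv `[0, t]%R; rewrite /= => lE.
    by rewrite [X in X \is a fin_num]lE; case: ifP => _.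
  - by rewrite ltey_eq fin_num_measure.
transitivity (\int[ref_measure cW hWoo P]_p (f p)%:E)%E.
  by apply: eq_integral => p _.
rewrite sf_fubini; last first.
  apply: (@supported_integrable _ _ _ _ f (setT `*` (I0 `*` [set: Hy])) `|C|) => //.
  - exact: measurableX.
  - have e := @product_measure1E _ _ _ _ R P (clock_measure cW hWoo) setT (I0 `*` setT) measurableT mIH.
    rewrite [X in (X < _)%E]e lte_mul_pinfty //.
    exact: fin_num_measure.
  - move=> p np; apply: f0 => lt; apply: np; do 2 (split=> //); exact: I0P.
apply: eq_integral => w _.
have mfw : measurable_fun setT (fun p => f (w, p)).
  exact: (measurableT_comp mf (pair1_measurable w)).
rewrite sf_fubini; last first.
  apply: (@supported_integrable _ _ _ _ (fun p => f (w, p)) (I0 `*` [set: Hy]) `|C|) => //.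
  move=> p np; apply: f0 => lt; apply: np; split=> //; exact: I0P.
have mc : measurable (hits (c v w)) by exact: measurable_hits_cell1.
have [r0|r0] := leP 0 (rem v w); last first.
  apply: integral0_eq => l _; apply: integral0_eq => H _.
  rewrite /f /g1; case Hi : (ind (w, (l, H))); last by rewrite !mul0r.
  by move/andP: Hi => [/= l0 lr]; have := le_trans l0 lr; rewrite leNgt r0.
rewrite -(integral_derive r0 (dG w r0) (cG w r0)) [RHS]integral_mkcond.
apply: eq_integral => l _; rewrite patchE mem_setE in_itv /=.
have [lr|nlr] := boolP (0 <= l <= rem v w); last first.
  apply: integral0_eq => H _; rewrite /f /g1.
  by rewrite (_ : ind (w, (l, H)) = false) ?mul0r //; exact: negbTE.
have /andP[l0 lr'] := lr.
transitivity (\int[LW]_(H in hits (c v w)) ((expR (- a v w * l))%:E * (g w l H)%:E))%E.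
  rewrite [RHS]integral_mkcond; apply: eq_integral => H _; rewrite patchE.
  rewrite /f /g1 /den (_ : ind (w, (l, H)) = true) // mul1r /= !indicE.
  rewrite (mem_set (_ : `[0, +oo[%classic l)) /=; last by rewrite in_itv /= l0.
  case: ifPn => Hc; last by rewrite mul0r mulr0.
  by rewrite !mul1r -EFinM mulrC.
rewrite integralZl //; first by rewrite gJ // -EFinM.
have mgl : measurable_fun setT (g w l).
  apply: (measurableT_comp (f := fun p : T * (RT * Hy) => g p.1 p.2.1 p.2.2) mg
     (g := fun H => (w : T, (l, H)))).
  by apply/measurable_fun_pairP; split; [exact: measurable_cst|exact: pair1_measurable].
apply: measurable_bounded_integrable => //.
- by rewrite ltey_eq fin_num_measure.
- exact: measurable_funTS.
- exists `|C|; split; first by rewrite num_real.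
  move=> x Cx H _; apply: le_trans (ltW Cx).
  by apply: le_trans (gC w l H l0 lr') (ler_norm _).
Qed.

End step.

(** * Expectations and the exponential kernel *)

Section exp_kernel_calculus.
Variable R : realType.
Implicit Types a b l tau : R.

Lemma is_derive_expRM a l :
  is_derive l (1 : R) (fun l => expR (- a * l)) (- a * expR (- a * l)).
Proof.
have dg : is_derive l (1 : R) (fun l : R => - a * l) (- a).
  have := is_deriveZ (- a) (is_derive_id l (1 : R)).
  by rewrite /GRing.scale /= mulr1.
by have := is_derive1_comp (is_derive_expR (- a * l)) dg; rewrite mulrC.
Qed.

Lemma is_derive_mul_expR (p : R -> R) (p' a l : R) : is_derive l (1 : R) p p' ->
  is_derive l (1 : R) (fun l => p l * expR (- a * l)) ((p' - a * p l) * expR (- a * l)).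
Proof.
move=> dp; have de := is_derive_expRM a l.
have -> : (fun l => p l * expR (- a * l)) = p \* (fun l => expR (- a * l)) by [].
apply: is_derive_eq; rewrite /GRing.scale /=; ring.
Qed.

(** The relation without division, valid also at [b = 0], so that later identities need no case
    distinction. *)
Lemma exp_kernelE tau b : b * exp_kernel tau b = 1 - expR (- b * tau).
Proof.
rewrite /exp_kernel; have [->|b0] := eqVneq b 0.
  by rewrite !mul0r oppr0 mul0r expR0 subrr.
by rewrite mulrC divfK // mulNr (mulrC tau).
Qed.

Lemma exp_kernel0 b : exp_kernel 0 b = 0 :> R.
Proof.
by rewrite /exp_kernel; case: ifP => // _; rewrite mul0r oppr0 expR0 subrr mul0r.
Qed.

Lemma is_derive_exp_kernel b l :
  is_derive l (1 : R) (fun x : R => exp_kernel x b) (expR (- b * l)).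
Proof.
rewrite /exp_kernel; have [->|b0] := eqVneq b 0.
  by rewrite oppr0 mul0r expR0; exact: is_derive_id.
have de := is_derive_expRM b l.
rewrite (_ : (fun x : R => _) = (fun l => b^-1 * (1 - expR (- b * l)))); last first.
  by apply/funext => x; rewrite mulrC mulNr (mulrC x).
apply: is_derive_eq; rewrite /GRing.scale /=.
by field.
Qed.

Lemma is_derive_reflect (f : R -> R) (f' tau l : R) :
  is_derive (tau - l) (1 : R) f f' ->
  is_derive l (1 : R) (fun l => f (tau - l)) (- f').
Proof.
move=> df; have dg : is_derive l (1 : R) (fun l : R => tau - l) (- 1).
  have := is_deriveB (is_derive_cst tau l (1 : R)) (is_derive_id l (1 : R)).
  by rewrite sub0r.
by have := @is_derive1_comp R f (fun l => tau - l) l _ _ df dg; rewrite mulrN1.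
Qed.

Lemma exp_kernel_bounds tau b : 0 <= tau -> 0 <= b -> 0 <= exp_kernel tau b <= tau.
Proof.
move=> t0 b0; rewrite /exp_kernel; case: ifPn => [_|bn0]; first by rewrite t0 lexx.
have bp : 0 < b by rewrite lt_neqAle eq_sym bn0.
rewrite ler_pdivrMr // divr_ge0 //=; last first.
  by rewrite subr_ge0 -[leRHS]expR0 ler_expR oppr_le0 mulr_ge0.
by have := expR_ge1Dx (- (tau * b)); lra.
Qed.

Lemma continuous_derivable (f f' : R -> R) :
  (forall l, is_derive l (1 : R) f (f' l)) -> continuous f.
Proof.
move=> df l; apply/differentiable_continuous/derivable1_diffP.
exact: (@ex_derive _ _ _ _ _ _ _ (df l)).
Qed.

Lemma continuous_mulR (f g : R -> R) : continuous f -> continuous g ->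
  continuous (fun l => f l * g l).
Proof. by move=> cf cg l; apply: (@continuousM R R^o f g); [exact: cf|exact: cg]. Qed.

Lemma continuous_expRM a : continuous (fun l => expR (- a * l)).
Proof. by apply: continuous_derivable => l; exact: is_derive_expRM. Qed.

End exp_kernel_calculus.

(** * Generations of cells and expectations of bounded functions *)

Section generations.

Fixpoint generation (k : nat) : seq (seq bool) :=
  if k is k'.+1 then [seq b :: v | v <- generation k', b <- [:: true; false]]
  else [:: [::]].

Lemma generationS k :
  generation k.+1 = [seq b :: v | v <- generation k, b <- [:: true; false]].
Proof. by []. Qed.

Lemma mem_generation k v : (v \in generation k) = (size v == k).
Proof.
elim: k v => [|k IH] v; first by rewrite mem_seq1; case: v.
rewrite generationS.
apply/allpairsP/idP => [[[u b] /= [ug _ ->]] /=|].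
  by rewrite eqSS -IH.
case: v => [//|b u]; rewrite /= eqSS -IH => ug.
by exists (u, b); split => //=; case: b.
Qed.

Lemma uniq_generation k : uniq (generation k).
Proof.
elim: k => [//|k IH]; rewrite generationS; apply: allpairs_uniq => //.
by move=> [u b] [u' b'] _ _ /= [-> ->].
Qed.

Lemma size_generation k v : v \in generation k -> size v = k.
Proof. by rewrite mem_generation => /eqP. Qed.

Lemma sum_generationS (V : nmodType) k (F : seq bool -> V) :
  \sum_(v <- generation k.+1) F v =
  \sum_(v <- generation k) (F (true :: v) + F (false :: v)).
Proof.
rewrite generationS big_allpairs_dep; apply: eq_bigr => v _.
by rewrite big_cons big_seq1.
Qed.

End generations.

Section bounded_expectation.
Context d (Omega : measurableType d) (R : realType).
Implicit Types f g : Omega -> R.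

(** The class on which [mean] with respect to a finite measure is a finite, linear and monotone
    functional; it is stable under sums, products and integration over one variable. *)
Definition bounded_rv f : Prop :=
  measurable_fun setT f /\ exists C, forall w, `|f w| <= C.

Definition mean (P : set Omega -> \bar R) f : R := fine (\int[P]_w (f w)%:E)%E.

Variable P : {finite_measure set Omega -> \bar R}.

Lemma bounded_rv_integrable f : bounded_rv f -> P.-integrable setT (EFin \o f).
Proof.
move=> [mf [C fC]]; apply: (@supported_integrable _ _ _ _ f setT C) => //.
- by rewrite ltey_eq fin_num_measure.
- by move=> x [].
Qed.

Lemma integral_mean f : bounded_rv f -> (\int[P]_w (f w)%:E = (mean P f)%:E)%E.
Proof.
move=> bf; rewrite /mean fineK //.
exact: (integrable_fin_num measurableT (bounded_rv_integrable bf)).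
Qed.

Lemma bounded_rvD f g : bounded_rv f -> bounded_rv g -> bounded_rv (fun w => f w + g w).
Proof.
move=> [mf [C fC]] [mg [D gD]]; split; first exact: measurable_funD.
by exists (C + D) => w; apply: le_trans (ler_normD _ _) _; exact: lerD.
Qed.

Lemma bounded_rvM f g : bounded_rv f -> bounded_rv g -> bounded_rv (fun w => f w * g w).
Proof.
move=> [mf [C fC]] [mg [D gD]]; split; first exact: measurable_funM.
by exists (C * D) => w; rewrite normrM; apply: ler_pM.
Qed.

Lemma bounded_rv_cst k : bounded_rv (fun=> k).
Proof. by split; [exact: measurable_cst|exists `|k|]. Qed.

Lemma bounded_rvB f g : bounded_rv f -> bounded_rv g -> bounded_rv (fun w => f w - g w).
Proof.
move=> [mf [C fC]] [mg [D gD]]; split; first exact: measurable_funB.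
by exists (C + D) => w; apply: le_trans (ler_normB _ _) _; exact: lerD.
Qed.

Lemma bounded_rv_sum (I : eqType) (s : seq I) (F : I -> Omega -> R) :
  (forall i, i \in s -> bounded_rv (F i)) -> bounded_rv (fun w => \sum_(i <- s) F i w).
Proof.
elim: s => [|i s IH] bF.
  by under eq_fun do rewrite big_nil; exact: bounded_rv_cst.
under eq_fun do rewrite big_cons; apply: bounded_rvD.
  by apply: bF; rewrite mem_head.
by apply: IH => j js; apply: bF; rewrite in_cons js orbT.
Qed.

Lemma meanD f g : bounded_rv f -> bounded_rv g ->
  mean P (fun w => f w + g w) = mean P f + mean P g.
Proof.
move=> bf bg; apply: EFin_inj; rewrite -integral_mean; last exact: bounded_rvD.
rewrite EFinD -!integral_mean //.
by apply: integralD_EFin => //; exact: bounded_rv_integrable.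
Qed.

Lemma meanZ k f : bounded_rv f -> mean P (fun w => k * f w) = k * mean P f.
Proof.
move=> bf; apply: EFin_inj.
rewrite -integral_mean; last by apply: bounded_rvM => //; exact: bounded_rv_cst.
rewrite EFinM -integral_mean //.
rewrite -integralZl //; exact: bounded_rv_integrable.
Qed.

Lemma mean_indic (A : set Omega) : measurable A -> mean P \1_A = fine (P A).
Proof. by move=> mA; rewrite /mean integral_indic // setIT. Qed.

Lemma bounded_rv_indic (A : set Omega) : measurable A -> bounded_rv \1_A.
Proof.
move=> mA; split; first exact: measurable_indic.
by exists 1 => w; rewrite indicE; case: (_ \in _); rewrite ?normr1 ?normr0.
Qed.

Lemma mean_cst k : mean P (fun=> k) = k * fine (P setT).
Proof.
rewrite -mean_indic // -meanZ; last exact: bounded_rv_indic.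
by congr mean; apply/funext => w; rewrite indicT mulr1.
Qed.

Lemma mean_off_null (N : set Omega) f g : measurable N -> P N = 0%E ->
  bounded_rv f -> bounded_rv g -> (forall w, ~ N w -> f w = g w) ->
  mean P f = mean P g.
Proof.
move=> mN N0 [mf _] [mg _] fg; congr fine; apply: ae_eq_integral => //.
- exact/measurable_EFinP.
- exact/measurable_EFinP.
- exists N; split => // w /= /not_implyP[_ fgw].
  by apply: contra_notP fgw => /fg ->.
Qed.

Lemma meanB f g : bounded_rv f -> bounded_rv g ->
  mean P (fun w => f w - g w) = mean P f - mean P g.
Proof.
move=> bf bg; rewrite -[X in _ = _ + X]mulN1r -meanZ // -meanD //; last first.
  by apply: bounded_rvM => //; exact: bounded_rv_cst.
by congr mean; apply/funext => w; rewrite mulN1r.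
Qed.

Lemma mean_sum (I : eqType) (s : seq I) (F : I -> Omega -> R) :
  (forall i, i \in s -> bounded_rv (F i)) ->
  mean P (fun w => \sum_(i <- s) F i w) = \sum_(i <- s) mean P (F i).
Proof.
elim: s => [|i s IH] bF.
  rewrite big_nil; under eq_fun do rewrite big_nil.
  by rewrite mean_cst mul0r.
have bFs j : j \in s -> bounded_rv (F j) by move=> js; apply: bF; rewrite in_cons js orbT.
rewrite big_cons -IH // -meanD.
- by congr mean; apply/funext => w; rewrite big_cons.
- by apply: bF; rewrite mem_head.
- exact: bounded_rv_sum.
Qed.

Lemma mean_le f g : bounded_rv f -> bounded_rv g -> (forall w, f w <= g w) ->
  mean P f <= mean P g.
Proof.
move=> bf bg fg; rewrite -lee_fin -!integral_mean //.
apply: le_integral => //; try exact: bounded_rv_integrable.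
by move=> w _; rewrite lee_fin.
Qed.

Lemma mean_ge0 f : (forall w, 0 <= f w) -> 0 <= mean P f.
Proof. by move=> f0; apply: fine_ge0; apply: integral_ge0 => w _; rewrite lee_fin. Qed.

Lemma mean_norm_le f C : bounded_rv f -> (forall w, `|f w| <= C) ->
  `|mean P f| <= C * fine (P setT).
Proof.
move=> bf fC; rewrite -(mean_cst C) ler_norml -mulN1r -meanZ; last exact: bounded_rv_cst.
by rewrite !mean_le //; try (by move=> w; have := fC w; rewrite ler_norml => /andP[? ?]; lra);
  rewrite ?mulN1r; exact: bounded_rv_cst.
Qed.

Lemma bounded_rvX f : bounded_rv f -> bounded_rv (fun w => f w ^+ 2).
Proof. by move=> bf; under eq_fun do rewrite expr2; exact: bounded_rvM. Qed.

Lemma integral_affine (A : set Omega) f a b : measurable A -> bounded_rv f ->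
  (forall w, ~ A w -> f w = 0) ->
  (\int[P]_(w in A) (a * f w + b)%:E = (a * mean P f + b * fine (P A))%:E)%E.
Proof.
move=> mA bf f0.
have b1 := bounded_rv_indic mA.
have baf : bounded_rv (fun w => a * f w) by apply: bounded_rvM => //; exact: bounded_rv_cst.
have bbA : bounded_rv (fun w => b * \1_A w) by apply: bounded_rvM => //; exact: bounded_rv_cst.
rewrite -mean_indic // -!meanZ // -meanD // -integral_mean; last exact: bounded_rvD.
rewrite integral_mkcond; apply: eq_integral => w _; rewrite patchE indicE.
by case: ifPn => [_|/negP]; rewrite ?mulr1 ?inE // => /f0 ->; rewrite !mulr0 addr0.
Qed.

End bounded_expectation.

Lemma mean_prob_cst d (Omega : measurableType d) (R : realType)
  (P : probability Omega R) (k : R) : mean P (fun=> k) = k.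
Proof. by rewrite mean_cst [X in fine X]probability_setT mulr1. Qed.

Lemma measurable_mean d1 d2 (T1 : measurableType d1) (T2 : measurableType d2)
    (R : realType) (nu : {finite_measure set T2 -> \bar R}) (f : T1 * T2 -> R) :
  bounded_rv f -> measurable_fun setT (fun s => mean nu (fun x => f (s, x))).
Proof.
move=> [mf [C fC]].
have bfs s : bounded_rv (fun x => f (s, x)).
  by split; [exact: (measurableT_comp mf (pair1_measurable s))|exists C].
(* Adding the bound C makes the integrand nonnegative, and Tonelli then yields measurability in
   [s]. *)
have -> : (fun s => mean nu (fun x => f (s, x))) =
    (fun s => mean nu (fun x => f (s, x) + C) - C * fine (nu setT)).
  apply/funext => s; rewrite meanD //; last exact: bounded_rv_cst.
  by rewrite mean_cst addrK.
apply: measurable_funB; last exact: measurable_cst.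
apply: measurableT_comp; first exact: fine_measurable.
apply: (@measurable_fun_fubini_tonelli_F _ _ _ _ _ nu (fun p => (f p + C)%:E)).
  by apply/measurable_EFinP; apply: measurable_funD.
by move=> p; rewrite lee_fin; have := fC p; rewrite ler_norml => /andP[? ?]; lra.
Qed.

(** * Moments of the facet functional over a cell *)

Section flux.
Variables (R : realType) (n : nat).
Local Notation E := 'rV[R]_n.+1.
Local Notation Hy := (hyperplane R n).
Variables (W : set E) (Lambda : {measure set Hy -> \bar R}).
Hypotheses (cW : compact W) (hWoo : (Lambda (hits W) < +oo)%E).
Local Notation LW := (hitting_measure cW hWoo).
Hypothesis Lambda_null : forall H : Hy, Lambda [set H] = 0%E.
Variables (z : Hy -> R) (Mz : R).
Hypotheses (mz : measurable_fun setT z) (zM : forall H, `|z H| <= Mz).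
Implicit Types (c : set E) (H : Hy).

Definition weight c H : R := z H * vol H c.
(** The integral runs over [W] instead of [c]; this makes no difference for a cell, because
    [weight c] vanishes on hyperplanes missing c. *)
Definition first_moment c : R := mean LW (weight c).
Definition second_moment c : R := mean LW (fun H => weight c H ^+ 2).

Lemma hitting_measure_null H : LW [set H] = 0%E.
Proof.
apply/eqP; rewrite eq_le measure_ge0 andbT -(Lambda_null H).
rewrite /hitting_measure /mfrestr /mrestr.
apply: le_measure; rewrite ?inE.
- by apply: measurableI; [exact: measurable_set1_hyperplane|exact: measurable_hits].
- exact: measurable_set1_hyperplane.
- exact: subIsetl.
Qed.

Lemma vol_ge0 H c : 0 <= vol H c.
Proof. by rewrite fine_ge0 // measure_ge0. Qed.

Lemma volume_bound : {C : R | 0 <= C & forall H, (hyperplane_lebesgue H W <= C%:E)%E}.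
Proof.
apply: cid2; apply: hyperplane_lebesgue_bounded.
- exact: compact_bounded.
- exact: measurable_compact.
Qed.

Definition vol_max : R := let: exist2 C _ _ := volume_bound in C.

Lemma hyperplane_lebesgue_le c H : measurable c -> c `<=` W ->
  (hyperplane_lebesgue H c <= vol_max%:E)%E.
Proof.
move=> mc cc; rewrite /vol_max; case: volume_bound => C C0 HC.
by apply: le_trans (HC H); apply: le_measure; rewrite ?inE //; exact: measurable_compact.
Qed.

Lemma hyperplane_lebesgue_vol c H : measurable c -> c `<=` W ->
  hyperplane_lebesgue H c = (vol H c)%:E.
Proof.
move=> mc cc; rewrite /vol fineK // ge0_fin_numE ?measure_ge0 //.
exact: le_lt_trans (hyperplane_lebesgue_le H mc cc) (ltry _).
Qed.

Lemma vol_le c H : measurable c -> c `<=` W -> vol H c <= vol_max.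
Proof.
by move=> mc cc; rewrite -lee_fin -hyperplane_lebesgue_vol //; exact: hyperplane_lebesgue_le.
Qed.

Lemma measurable_cell1 g v : measurable (cell W g v).
Proof. by apply: measurable_compact; exact: cell_compact. Qed.

Definition weight_max : R := Mz * vol_max.

Lemma weight_le g v H : `|weight (cell W g v) H| <= weight_max.
Proof.
rewrite /weight /weight_max normrM (ger0_norm (vol_ge0 _ _)).
apply: ler_pM => //; first exact: vol_ge0.
by apply: vol_le; [exact: measurable_cell1|exact: cell_sub].
Qed.

Lemma weight_max_ge0 : 0 <= weight_max.
Proof. exact: le_trans (normr_ge0 _) (weight_le (fun=> point) [::] point). Qed.

Lemma vol_not_hits c H : ~ hits c H -> vol H c = 0.
Proof.
move=> Hc; rewrite /vol /hyperplane_lebesgue /pushforward.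
rewrite (_ : chart H @^-1` c = set0) ?measure0 //.
apply/seteqP; split => // x /= cx; apply: Hc; exists (chart H x); split => //.
by rewrite -range_chart; exists x.
Qed.

Lemma weight_not_hits c H : ~ hits c H -> weight c H = 0.
Proof. by move=> /vol_not_hits; rewrite /weight => ->; rewrite mulr0. Qed.

Section measurability.
Context d (T : measurableType d).
Variables (g : seq bool -> T -> Hy) (v : seq bool).
Hypothesis mg : forall u, (size u < size v)%N -> measurable_fun setT (g u).

Lemma measurable_vol_prod :
  measurable_fun [set: T * Hy] (fun p => vol p.2 (cell W (g^~ p.1) v)).
Proof.
apply: measurableT_comp; first exact: fine_measurable.
apply: (@measurable_measure_section _ _ _ _ _ (lebesgue_rV R n)
  (fun p : T * Hy => chart p.2 @^-1` cell W (g^~ p.1) v)).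
apply: (@measurable_cell _ _ _ _ (fun u (p : (T * Hy) * 'rV[R]_n) => g u p.1.1)
  v _ W (fun p : (T * Hy) * 'rV[R]_n => chart p.1.2 p.2)).
- move=> u uv; apply: (measurableT_comp (mg uv)).
  exact: (measurableT_comp measurable_fst measurable_fst).
- exact: measurable_compact.
- have mp : measurable_fun setT (fun p : (T * Hy) * 'rV[R]_n => (p.1.2, p.2)).
    apply/measurable_fun_pairP; split; last exact: measurable_snd.
    exact: (measurableT_comp measurable_snd measurable_fst).
  exact: (measurableT_comp (@measurable_chart2 R n) mp).
Qed.

Lemma bounded_weight_prod :
  bounded_rv (fun p : T * Hy => weight (cell W (g^~ p.1) v) p.2).
Proof.
split; last by exists weight_max => p; exact: weight_le.
by apply: measurable_funM; [exact: (measurableT_comp mz measurable_snd)|exact: measurable_vol_prod].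
Qed.

Lemma measurable_first_moment :
  measurable_fun setT (fun s => first_moment (cell W (g^~ s) v)).
Proof. exact: (@measurable_mean _ _ _ _ _ LW _ bounded_weight_prod). Qed.

End measurability.

Lemma bounded_weight g v : bounded_rv (weight (cell W g v)).
Proof.
split; last by exists weight_max => p; exact: weight_le.
have [m _] := @bounded_weight_prod _ Hy (fun u _ => g u) v (fun u _ => measurable_cst _).
exact: (measurableT_comp m (pair1_measurable (point : Hy))).
Qed.

Definition moment_max : R := (1 + weight_max + weight_max ^+ 2) * fine (LW setT).

Lemma total_ge0 : 0 <= fine (LW setT).
Proof. by rewrite fine_ge0. Qed.

Lemma first_moment_le g v : `|first_moment (cell W g v)| <= moment_max.
Proof.
apply: le_trans (@mean_norm_le _ _ _ LW _ _ (bounded_weight g v) (weight_le g v)) _.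
apply: ler_wpM2r; first exact: total_ge0.
by have := sqr_ge0 weight_max; lra.
Qed.

(** For every hyperplane other than the splitting one, the volumes of the two sections add up. The
    splitting hyperplane itself has measure 0, and this is where the absence of atoms enters the
    martingale. *)
Lemma first_moment_split g v :
  first_moment (cell W g (true :: v)) + first_moment (cell W g (false :: v)) =
  first_moment (cell W g v).
Proof.
rewrite /first_moment -meanD; try exact: bounded_weight.
apply: (@mean_off_null _ _ _ _ [set g v]).
- exact: measurable_set1_hyperplane.
- exact: hitting_measure_null.
- by apply: bounded_rvD; exact: bounded_weight.
- exact: bounded_weight.
move=> K Kg; rewrite /weight -mulrDr; congr (_ * _).
apply: EFin_inj; rewrite EFinD -!hyperplane_lebesgue_vol;
  try exact: measurable_cell1; try exact: cell_sub.
apply: hyperplane_lebesgue_split; last exact: measurable_cell1.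
by move=> gK; apply: Kg; rewrite gK.
Qed.

End flux.

(** * Expectation identities for one cell *)

Section mean_step.
Variables (R : realType) (n : nat).
Local Notation E := 'rV[R]_n.+1.
Local Notation Hy := (hyperplane R n).
Local Notation RT := (measurableTypeR R).
Variables (W : set E) (Lambda : {measure set Hy -> \bar R}).
Hypotheses (cW : compact W) (hWoo : (Lambda (hits W) < +oo)%E).
Variables (d : measure_display) (Omega : measurableType d) (P : probability Omega R).
Variables (L : seq bool -> Omega -> \bar R) (h : seq bool -> Omega -> Hy).
Hypothesis Y_mnw : mnw_process Lambda L h P W.
Local Notation LW := (hitting_measure cW hWoo).
Variables (t : R) (t_ge0 : 0 <= t).

Local Notation rem v w := (remaining t (L^~ w) v).
Local Notation spl v w := (splits t (L^~ w) v).
Local Notation c v w := (cell W (h^~ w) v).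
Local Notation a := (rate W Lambda h).

(** If the integral over [c] has the form p' - a p + ga, then its product with exp(-al) has the
    antiderivative p exp(-al) + ga K(l,a). Each application thus amounts to finding [p] and [ga] and
    checking one algebraic identity. The function [F] extends [f] by 0 outside [c], so that means
    over [W] can be used. *)
Lemma mnw_step_mean v (f F : Omega -> Hy -> R) (al be p dp : Omega -> R -> R)
    (ga : Omega -> R) (C : R) :
  measurable_fun [set: events_type L h (past v) * (RT * Hy)]
    (fun q => al q.1 q.2.1 * f q.1 q.2.2 + be q.1 q.2.1) ->
  (forall w l H, 0 <= l -> l <= rem v w -> `|al w l * f w H + be w l| <= C) ->
  (forall w H, hits (c v w) H -> f w H = F w H) ->
  (forall w, bounded_rv (F w)) ->
  (forall w H, ~ hits (c v w) H -> F w H = 0) ->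
  (forall w (l : R), is_derive l (1 : R) (p w) (dp w l)) ->
  (forall w, continuous (dp w)) ->
  (forall w l, al w l * mean LW (F w) + be w l * a v w =
     dp w l - a v w * p w l + ga w) ->
  mean P (fun w => (spl v w)%:R *
    (al w (fine (L v w)) * f w (h v w) + be w (fine (L v w)))) =
  mean P (fun w => if 0 <= rem v w then p w (rem v w) * expR (- a v w * rem v w) -
    p w 0 + ga w * exp_kernel (rem v w) (a v w) else 0).
Proof.
move=> mg gC fF bF F0 dpp cdp eqn.
pose J w l := dp w l - a v w * p w l + ga w.
pose G w l := p w l * expR (- a v w * l) + ga w * exp_kernel l (a v w).
have gJ w l : 0 <= l -> l <= rem v w ->
    (\int[LW]_(H in hits (c v w)) (al w l * f w H + be w l)%:E = (J w l)%:E)%E.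
  move=> l0 lr; have mc : measurable (hits (c v w)) by exact: measurable_hits_cell1.
  transitivity (\int[LW]_(H in hits (c v w)) (al w l * F w H + be w l)%:E)%E.
    by apply: eq_integral => H; rewrite inE => Hc; rewrite fF.
  rewrite (@integral_affine _ _ _ LW _ _ _ _ mc (bF w) (F0 w)).
  rewrite [X in fine X]hitting_measure_hits; last exact: cell_sub.
  by rewrite -/(rate W Lambda h v w) eqn.
have dG w : 0 <= rem v w ->
    forall l : R, is_derive l (1 : R) (G w) (expR (- a v w * l) * J w l).
  move=> r0 l; have d1 := is_derive_mul_expR (a v w) (dpp w l).
  have d2 := is_deriveZ (ga w) (is_derive_exp_kernel (a v w) l).
  have := is_deriveD d1 d2; rewrite /GRing.scale /= => H.
  by apply: is_derive_eq H _; rewrite /J; ring.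
have cG w : 0 <= rem v w -> continuous (fun l : R => expR (- a v w * l) * J w l).
  move=> r0; apply: continuous_mulR; first exact: continuous_expRM.
  have cp : continuous (p w) by apply: continuous_derivable; exact: dpp.
  move=> l; apply: (@continuousD R R^o R^o (fun l => dp w l - a v w * p w l)); last exact: cst_continuous.
  apply: (@continuousB R R^o R^o (dp w)); first exact: cdp.
  by apply: (@continuousM R R^o (fun=> a v w)); [exact: cst_continuous|exact: cp].
rewrite /mean (mnw_step_formula Y_mnw t_ge0 mg gC gJ dG cG).
congr fine; apply: eq_integral => w _; congr EFin; case: ifP => // r0.
by rewrite /G exp_kernel0 !mulr0 expR0 mulr1 addr0; ring.
Qed.

End mean_step.

Section derivatives.
Variable R : realType.
Implicit Types s l tau k : R.

Lemma is_derive_sqr s : is_derive s (1 : R) (fun s : R => s ^+ 2) (2 * s).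
Proof.
have := is_deriveM (is_derive_id s (1 : R)) (is_derive_id s (1 : R)).
rewrite /GRing.scale /= mulr1 => H.
have -> : (fun s : R => s ^+ 2) = (fun s : R => s) * (fun s : R => s) by [].
by apply: is_derive_eq H _; ring.
Qed.

Lemma is_derive_affine tau k l : is_derive l (1 : R) (fun l : R => k * (tau - l)) (- k).
Proof.
have := is_derive_reflect (f := fun s => k * s) (tau := tau) (l := l) (f' := k).
apply; have := is_deriveZ k (is_derive_id (tau - l) (1 : R)).
by rewrite /GRing.scale /= mulr1.
Qed.

Lemma is_derive_sqr_reflect tau k l :
  is_derive l (1 : R) (fun l : R => k * (tau - l) ^+ 2) (- (2 * k * (tau - l))).
Proof.
apply: (is_derive_reflect (f := fun s => k * s ^+ 2)).
have := is_deriveZ k (is_derive_sqr (tau - l)); rewrite /GRing.scale /= => H.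
by apply: is_derive_eq H _; ring.
Qed.

Lemma is_derive_exp_reflect tau k b l :
  is_derive l (1 : R) (fun l : R => k * expR (b * (tau - l))) (- (k * b * expR (b * (tau - l)))).
Proof.
apply: (is_derive_reflect (f := fun s => k * expR (b * s))).
have := is_deriveZ k (is_derive_expRM (- b) (tau - l)); rewrite opprK /GRing.scale /= => H.
by apply: is_derive_eq H _; ring.
Qed.

Lemma is_derive_kernel_reflect tau k b l :
  is_derive l (1 : R) (fun l : R => k * exp_kernel (tau - l) b)
    (- (k * expR (- b * (tau - l)))).
Proof.
apply: (is_derive_reflect (f := fun s => k * exp_kernel s b)).
exact: (is_deriveZ k (is_derive_exp_kernel b (tau - l))).
Qed.

Lemma continuous_exp_reflect tau k b : continuous (fun l : R => k * expR (b * (tau - l))).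
Proof. by apply: continuous_derivable => l; exact: is_derive_exp_reflect. Qed.

Lemma measurable_exp_kernel d (T : measurableType d) (f g : T -> R) :
  measurable_fun setT f -> measurable_fun setT g -> (forall w, 0 <= g w) ->
  measurable_fun setT (fun w => exp_kernel (f w) (g w)).
Proof.
move=> mf mg g0; apply: measurable_fun_ifT => //.
  by apply: measurable_fun_eqr => //; exact: measurable_cst.
apply: measurable_funM; last exact: measurable_funV_ge0.
apply: measurable_funB; first exact: measurable_cst.
apply: measurableT_comp; first exact: measurable_expR.
by apply: measurable_funN; exact: measurable_funM.
Qed.

End derivatives.

(** * Pairs of points relative to a hyperplane *)

Section cell_pairs.
Variables (R : realType) (n : nat).
Local Notation E := 'rV[R]_n.+1.
Local Notation Hy := (hyperplane R n).
Implicit Types (W : set E) (x y : E) (H : Hy).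

Lemma segment_halfspace b H x y : halfspace b H x -> halfspace b H y ->
  segment x y `<=` halfspace b H.
Proof.
rewrite halfspaceE => /= hx hy _ [s /= + <-]; rewrite in_itv /= => /andP[s0 s1].
have -> : side b H (x + s *: (y - x)) = (1 - s) * side b H x + s * side b H y.
  by rewrite /side sdist_line; case: b {hx hy}; ring.
have s1' : 0 <= 1 - s by rewrite subr_ge0.
have := mulr_ge0_le0 s1' hx; have := mulr_ge0_le0 s0 hy; lra.
Qed.

Lemma segment_cell W g v x y : convex_set W -> cell W g v x -> cell W g v y ->
  segment x y `<=` cell W g v.
Proof.
move=> kW; elim: v => [|b v IH] /=; first exact: segment_convex.
by move=> [cx hx] [cy hy] p sp; split; [exact: IH|exact: (segment_halfspace hx hy)].
Qed.

(** The sum over the two closed half-spaces is exactly what the two sub-cells contribute. It equals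
    2 when both points lie on H, whence the bound in [same_side_norm]. *)
Definition same_side x y H : R :=
  \1_(halfspace true H) x * \1_(halfspace true H) y +
  \1_(halfspace false H) x * \1_(halfspace false H) y.

Lemma same_sideE x y H : ~ points H x -> ~ points H y ->
  same_side x y H = 1 - \1_(hits (segment x y)) H.
Proof.
rewrite !points_sdist => hx hy.
have ih b p : \1_(halfspace b H) p = (side b H p <= 0)%R%:R :> R.
  rewrite indicE halfspaceE; congr ((nat_of_bool _)%:R).
  by apply/idP/idP; rewrite inE.
have -> : \1_(hits (segment x y)) H = (sdist H x * sdist H y <= 0)%R%:R :> R.
  rewrite indicE; congr ((nat_of_bool _)%:R).
  by apply/idP/idP; rewrite inE => /hits_segmentP.
rewrite /same_side !ih /side /=.
move: (sdist H x) (sdist H y) hx hy => p q /eqP p0 /eqP q0.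
case: (ltgtP p 0) p0 => // p0 _; case: (ltgtP q 0) q0 => // q0 _;
 rewrite !oppr_le0.
- by rewrite !leNgt p0 q0 nmulr_rgt0 // q0 /= mulr0 add0r mulr1 subr0.
- by rewrite !leNgt p0 nmulr_rgt0 // (ltNge q) (ltW q0) /= mul0r mulr0 addr0 subrr.
- by rewrite !leNgt q0 pmulr_rgt0 // (ltNge 0 q) (ltW q0) /= mul0r mulr0 addr0 subrr.
- by rewrite (ltW p0) (ltW q0) leNgt pmulr_rgt0 // q0 /= !mulr0 !mulr1 addr0 subr0.
Qed.

Lemma same_side_norm x y H : `|same_side x y H| <= 2.
Proof.
rewrite /same_side !indicE; do 4 case: (_ \in _);
 rewrite ?mulr0 ?mul0r ?mulr1 ?addr0 ?add0r ?normr0 ?normr1 //; rewrite ?ger0_norm //; lra.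
Qed.

Lemma measurable_halfspace_point b x : measurable [set H : Hy | halfspace b H x].
Proof.
under eq_set do rewrite halfspaceE.
apply: (measurable_set_le (f := fun H : Hy => side b H x)); last exact: measurable_cst.
by apply: measurable_side; [exact: measurable_id|exact: measurable_cst].
Qed.

Lemma measurable_same_side x y : measurable_fun setT (same_side x y).
Proof.
have m b p : measurable_fun setT (fun H : Hy => \1_(halfspace b H) p : R).
  have -> : (fun H : Hy => \1_(halfspace b H) p : R) = \1_[set H : Hy | halfspace b H p].
    by apply/funext => H; rewrite !indicE; congr ((nat_of_bool _)%:R); apply/idP/idP; rewrite !inE.
  by apply: measurable_indic; exact: measurable_halfspace_point.
by apply: measurable_funD; apply: measurable_funM.
Qed.

Lemma measurable_points_through x : measurable [set H : Hy | points H x].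
Proof.
have -> : [set H : Hy | points H x] = [set H | sdist H x = 0].
  by apply/seteqP; split => H /=; rewrite points_sdist.
apply: measurable_set_eq; last exact: measurable_cst.
by apply: measurable_fun_sdist; [exact: measurable_id|exact: measurable_cst].
Qed.

End cell_pairs.

Section values.
Variables (R : realType) (n : nat).
Local Notation E := 'rV[R]_n.+1.
Local Notation Hy := (hyperplane R n).
Variables (W : set E) (Lambda : {measure set Hy -> \bar R}).
Hypotheses (cW : compact W) (hWoo : (Lambda (hits W) < +oo)%E).
Variables (z : Hy -> R) (t : R).

Section definitions.
Variables (T : Type) (L : seq bool -> T -> \bar R) (h : seq bool -> T -> Hy).

Definition facet_value v w : R :=
  (splits t (L^~ w) v)%:R * weight z (cell W (h^~ w) v) (h v w).

(* Expected contribution of the cell v and its descendants up to time t, given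
   the past at the birth of v. *)
Definition drift v w : R := if 0 <= remaining t (L^~ w) v
  then remaining t (L^~ w) v * first_moment cW hWoo z (cell W (h^~ w) v) else 0.

(** The facet created by [v] together with the drift of its two sub-cells at their birth; additivity
    of the first moment allows it to be written with the moment of the cell itself. *)
Definition gain v w : R := (splits t (L^~ w) v)%:R *
  (weight z (cell W (h^~ w) v) (h v w) +
   (remaining t (L^~ w) v - fine (L v w)) * first_moment cW hWoo z (cell W (h^~ w) v)).

End definitions.

Section measurability.
Context d (T : measurableType d).
Variables (L : seq bool -> T -> \bar R) (h : seq bool -> T -> Hy) (Mz : R) (v : seq bool).
Hypotheses (mz : measurable_fun setT z) (zM : forall H, `|z H| <= Mz).
Hypotheses (mL : forall u, (size u < size v)%N -> measurable_fun setT (L u))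
  (mh : forall u, (size u < size v)%N -> measurable_fun setT (h u)).

Lemma measurable_drift : measurable_fun setT (drift L h v).
Proof.
have mr := measurable_remaining t mL.
apply: measurable_fun_ifT; last exact: measurable_cst.
  by apply: measurable_fun_ler => //; exact: measurable_cst.
by apply: measurable_funM => //; exact: (measurable_first_moment cW hWoo mz zM mh).
Qed.

Hypotheses (mLv : measurable_fun setT (L v)) (mhv : measurable_fun setT (h v)).

Lemma measurable_splits_natr : measurable_fun setT (fun w => (splits t (L^~ w) v)%:R : R).
Proof.
apply: measurable_bool_natr; apply: measurable_splits_gen => //.
exact: measurable_remaining.
Qed.

Lemma measurable_weight : measurable_fun setT (fun w => weight z (cell W (h^~ w) v) (h v w)).
Proof.
have [m _] := bounded_weight_prod cW mz zM mh.
apply: (measurableT_comp m (g := fun w => (w, h v w))).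
exact: measurable_fun_pair.
Qed.

Lemma measurable_facet_value : measurable_fun setT (facet_value L h v).
Proof. exact: measurable_funM measurable_splits_natr measurable_weight. Qed.

Lemma measurable_gain : measurable_fun setT (gain L h v).
Proof.
apply: measurable_funM; first exact: measurable_splits_natr.
apply: measurable_funD; first exact: measurable_weight.
apply: measurable_funM; last exact: (measurable_first_moment cW hWoo mz zM mh).
apply: measurable_funB; first exact: measurable_remaining.
exact: measurableT_comp.
Qed.

End measurability.
End values.

Section steps.
Variables (R : realType) (n : nat).
Local Notation E := 'rV[R]_n.+1.
Local Notation Hy := (hyperplane R n).
Local Notation RT := (measurableTypeR R).
Variables (W : set E) (Lambda : {measure set Hy -> \bar R}).
Hypotheses (cW : compact W) (hWoo : (Lambda (hits W) < +oo)%E).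
Variables (d : measure_display) (Omega : measurableType d) (P : probability Omega R).
Variables (L : seq bool -> Omega -> \bar R) (h : seq bool -> Omega -> Hy).
Hypothesis Y_mnw : mnw_process Lambda L h P W.
Local Notation LW := (hitting_measure cW hWoo).
Variables (t : R) (t_ge0 : 0 <= t).
Variables (z : Hy -> R) (Mz : R).
Hypotheses (mz : measurable_fun setT z) (zM : forall H, `|z H| <= Mz).

Local Notation rem v w := (remaining t (L^~ w) v).
Local Notation spl v w := (splits t (L^~ w) v).
Local Notation c v w := (cell W (h^~ w) v).
Local Notation a := (rate W Lambda h).
Local Notation m v w := (first_moment cW hWoo z (c v w)).
Local Notation q v w := (second_moment cW hWoo z (c v w)).
Local Notation wt v w := (weight z (c v w)).
Local Notation fac := (facet_value W z t L h).
Local Notation gn := (gain cW hWoo z t L h).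
Local Notation dr := (drift cW hWoo z t L h).
Local Notation mm := (moment_max cW hWoo Mz).
Local Notation wm := (weight_max cW Mz).

Let mL v : measurable_fun setT (L v). Proof. by have [] := Y_mnw. Qed.
Let mh v : measurable_fun setT (h v). Proof. by have [] := Y_mnw. Qed.

Lemma mm_ge0 : 0 <= mm.
Proof. exact: le_trans (normr_ge0 _) (first_moment_le cW hWoo mz zM (fun=> point) [::]). Qed.

Lemma bounded_splits_natr v : bounded_rv (fun w => (spl v w)%:R : R).
Proof.
split; first exact: measurable_splits_natr.
by exists 1 => w; case: splits; rewrite ?normr1 ?normr0.
Qed.

Lemma bounded_age v : bounded_rv (fun w => (spl v w)%:R * (rem v w - fine (L v w))).
Proof.
split.
  apply: measurable_funM; first by have [] := bounded_splits_natr v.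
  by apply: measurable_funB; [exact: measurable_remaining|exact: measurableT_comp].
exists t => w; have [/splitsP[l [-> l0 lr]]|_] := boolP (spl v w); last by rewrite mul0r normr0.
rewrite mul1r /= ger0_norm ?subr_ge0 //.
by have := remaining_le (L^~ w) v t_ge0; lra.
Qed.

Lemma bounded_first_moment v : bounded_rv (fun w => m v w).
Proof.
split; first by apply: (measurable_first_moment cW hWoo mz zM).
by exists mm => w; exact: first_moment_le.
Qed.

Lemma bounded_facet_value v : bounded_rv (fac v).
Proof.
apply: bounded_rvM; first exact: bounded_splits_natr.
split; first exact: (measurable_weight cW mz zM (fun u _ => mh u) (mh v)).
by exists wm => w; exact: weight_le.
Qed.

Lemma gainE v w : gn v w = fac v w + ((spl v w)%:R * (rem v w - fine (L v w))) * m v w.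
Proof. by rewrite /gain mulrDr mulrA. Qed.

Lemma bounded_gain v : bounded_rv (gn v).
Proof.
rewrite (_ : gn v = fun w => fac v w + ((spl v w)%:R * (rem v w - fine (L v w))) * m v w);
  last by apply/funext => w; exact: gainE.
apply: bounded_rvD; first exact: bounded_facet_value.
by apply: bounded_rvM; [exact: bounded_age|exact: bounded_first_moment].
Qed.

Lemma bounded_drift v : bounded_rv (dr v).
Proof.
split; first exact: measurable_drift.
exists (t * mm) => w; rewrite /drift; case: ifP => r0; last first.
  by rewrite normr0 mulr_ge0 // mm_ge0.
rewrite normrM (ger0_norm r0); apply: ler_pM => //; last exact: first_moment_le.
exact: remaining_le.
Qed.

Section past.
Variable v : seq bool.
Local Notation T := (events_type L h (past v)).

Let mLp u : (size u < size v)%N -> measurable_fun [set: T] (L u : T -> \bar R).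
Proof. by move=> uv; apply: (measurable_L_events (U := past v)); exact: before_past. Qed.
Let mhp u : (size u < size v)%N -> measurable_fun [set: T] (h u : T -> Hy).
Proof. by move=> uv; apply: (measurable_h_events (U := past v)); exact: before_past. Qed.

Lemma past_remaining : measurable_fun [set: T] (fun w : T => rem v w).
Proof. exact: measurable_remaining. Qed.

Lemma past_first_moment : measurable_fun [set: T] (fun w : T => m v w).
Proof. exact: (measurable_first_moment cW hWoo mz zM (T := T) mhp). Qed.

Lemma past_fst (f : T -> R) : measurable_fun [set: T] f ->
  measurable_fun [set: T * (RT * Hy)] (fun p => f p.1).
Proof. by move=> mf; exact: (measurableT_comp mf measurable_fst). Qed.

Lemma past_time : measurable_fun [set: T * (RT * Hy)] (fun p => p.2.1 : R).
Proof. exact: (measurableT_comp measurable_fst measurable_snd). Qed.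

Lemma past_hyperplane : measurable_fun [set: T * (RT * Hy)] (fun p => p.2.2).
Proof. exact: (measurableT_comp measurable_snd measurable_snd). Qed.

Lemma past_left : measurable_fun [set: T * (RT * Hy)] (fun p => rem v p.1 - p.2.1).
Proof. by apply: measurable_funB; [exact: (past_fst past_remaining)|exact: past_time]. Qed.

Lemma past_pair : measurable_fun [set: T * (RT * Hy)] (fun p => (p.1, p.2.2)).
Proof.
by apply/measurable_fun_pairP; split; [exact: measurable_fst|exact: past_hyperplane].
Qed.

Lemma past_weight : measurable_fun [set: T * (RT * Hy)] (fun p => wt v p.1 p.2.2).
Proof.
have [mw _] := bounded_weight_prod cW mz zM (T := T) mhp.
exact: (measurableT_comp mw past_pair).
Qed.

Lemma left_le w l : 0 <= l -> l <= rem v w -> `|rem v w - l| <= t.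
Proof.
move=> l0 lr; rewrite ger0_norm ?subr_ge0 //.
by have := remaining_le (L^~ w) v t_ge0; lra.
Qed.

(** Expresses that [drift v] is the conditional expectation of [gain v] given the past. The solution
    is p = - Z m (r - l) with ga = 0: it vanishes at l = r, and - p(0) = Z m r is the drift times
    Z. *)
Lemma gain_orthogonal (Z : Omega -> R) (CZ : R) :
  measurable_fun [set: T] (Z : T -> R) -> (forall w, `|Z w| <= CZ) ->
  mean P (fun w => Z w * gn v w) = mean P (fun w => Z w * dr v w).
Proof.
move=> mZ ZC.
have := @mnw_step_mean _ _ _ _ cW hWoo _ _ _ _ _ Y_mnw t t_ge0 v (fun w => wt v w) (fun w => wt v w)
  (fun w _ => Z w) (fun w l => (Z w * m v w) * (rem v w - l))
  (fun w l => - (Z w * m v w) * (rem v w - l)) (fun w _ => Z w * m v w) (fun=> 0)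
  (CZ * wm + CZ * mm * t).
move=> H; etransitivity; last (etransitivity; first apply: H).
- by congr mean; apply/funext => w; rewrite /gain; ring.
- apply: measurable_funD; apply: measurable_funM.
  + exact: past_fst.
  + exact: past_weight.
  + by apply: measurable_funM; [exact: past_fst|exact: (past_fst past_first_moment)].
  + exact: past_left.
- move=> w l H0 l0 lr; apply: le_trans (ler_normD _ _) _; apply: lerD.
    by rewrite normrM; apply: ler_pM => //; exact: weight_le.
  rewrite !normrM; apply: ler_pM; rewrite ?mulr_ge0 //; last exact: left_le.
  by apply: ler_pM => //; exact: first_moment_le.
- by [].
- by move=> w; exact: bounded_weight.
- by move=> w H0; exact: weight_not_hits.
- by move=> w l; rewrite -[X in is_derive _ _ _ X]opprK; exact: is_derive_affine.
- by move=> w; exact: cst_continuous.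
- by move=> w l; rewrite -/(first_moment cW hWoo z (c v w)); ring.
- congr mean; apply/funext => w; rewrite /drift; case: ifP => _; last by rewrite mulr0.
  by rewrite subrr subr0; ring.
Qed.

(** The formula is applied to the difference of the squared gain and the squared facet, which is
    affine in the weight. The solution is p = - m^2 (r - l)^2, and - p(0) is the squared drift. *)
Lemma gain_sqr : mean P (fun w => gn v w ^+ 2) =
  mean P (fun w => fac v w ^+ 2) + mean P (fun w => dr v w ^+ 2).
Proof.
have := @mnw_step_mean _ _ _ _ cW hWoo _ _ _ _ _ Y_mnw t t_ge0 v (fun w => wt v w) (fun w => wt v w)
  (fun w l => (2 * m v w) * (rem v w - l)) (fun w l => m v w ^+ 2 * (rem v w - l) ^+ 2)
  (fun w l => - m v w ^+ 2 * (rem v w - l) ^+ 2)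
  (fun w l => (2 * m v w ^+ 2) * (rem v w - l)) (fun=> 0)
  (2 * mm * t * wm + mm ^+ 2 * t ^+ 2).
move=> H; apply/eqP; rewrite addrC -subr_eq -meanB;
  [|by apply: bounded_rvX; exact: bounded_gain|by apply: bounded_rvX; exact: bounded_facet_value].
apply/eqP; etransitivity; last (etransitivity; first apply: H).
- congr mean; apply/funext => w; rewrite /gain /facet_value.
  by case: splits => /=; ring.
- apply: measurable_funD; apply: measurable_funM.
  + apply: measurable_funM; last exact: past_left.
    by apply: measurable_funM; [exact: measurable_cst|exact: (past_fst past_first_moment)].
  + exact: past_weight.
  + by apply: measurable_funX; exact: (past_fst past_first_moment).
  + by apply: measurable_funX; exact: past_left.
- move=> w l H0 l0 lr; apply: le_trans (ler_normD _ _) _.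
  have hm := first_moment_le cW hWoo mz zM (h^~ w) v.
  have hl := left_le l0 lr.
  apply: lerD.
    rewrite normrM; apply: ler_pM => //; last exact: weight_le.
    rewrite !normrM (ger0_norm (x := 2)) //; apply: ler_pM; rewrite ?mulr_ge0 //.
    by apply: ler_pM.
  by rewrite normrM !normrX; apply: ler_pM; rewrite ?exprn_ge0 // lerXn2r // nnegrE // (le_trans _ hm, le_trans _ hl).
- by [].
- by move=> w; exact: bounded_weight.
- by move=> w H0; exact: weight_not_hits.
- move=> w l; apply: is_derive_eq (is_derive_sqr_reflect _ _ _) _; ring.
- move=> w; apply: continuous_derivable => l; exact: is_derive_affine.
- by move=> w l; rewrite -/(first_moment cW hWoo z (c v w)); ring.
- congr mean; apply/funext => w; rewrite /drift; case: ifP => _; last by rewrite expr0n.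
  by rewrite subrr subr0; ring.
Qed.

Lemma facet_sqr : mean P (fun w => fac v w ^+ 2) =
  mean P (fun w => if 0 <= rem v w then q v w * exp_kernel (rem v w) (a v w) else 0).
Proof.
have := @mnw_step_mean _ _ _ _ cW hWoo _ _ _ _ _ Y_mnw t t_ge0 v (fun w H => wt v w H ^+ 2) (fun w H => wt v w H ^+ 2)
  (fun w l => 1) (fun w l => 0) (fun w l => 0) (fun w l => 0) (fun w => q v w) (wm ^+ 2).
move=> H; etransitivity; last (etransitivity; first apply: H).
- congr mean; apply/funext => w; rewrite /facet_value.
  by case: splits => /=; ring.
- apply: measurable_funD; last exact: measurable_cst.
  by apply: measurable_funM; [exact: measurable_cst|apply: measurable_funX; exact: past_weight].
- move=> w l H0 l0 lr; rewrite mul1r addr0 normrX lerXn2r // ?nnegrE //; last exact: weight_le.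
  exact: weight_max_ge0.
- by [].
- by move=> w; apply: bounded_rvX; exact: bounded_weight.
- by move=> w H0 /(weight_not_hits z) ->; rewrite expr0n.
- by move=> w; exact: cst_continuous.
- by move=> w l; rewrite -/(second_moment cW hWoo z (c v w)); ring.
- by congr mean; apply/funext => w; case: ifP => // _; ring.
Qed.

(** The solution is p = - a / (a + b) exp(b (r - l)). Its factor a / (a + b) is small when [b] is
    large compared to the rate, which is what makes the generations die out. *)
Lemma split_exp (b : R) : 0 < b -> mean P (fun w => (spl v w)%:R * expR (b * (rem v w - fine (L v w)))) =
  mean P (fun w => if 0 <= rem v w then a v w / (a v w + b) *
    (expR (b * rem v w) - expR (- a v w * rem v w)) else 0).
Proof.
move=> b0.
have ab w : a v w + b != 0.
  by rewrite gt_eqF // ltr_wpDl //; exact: rate_ge0.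
have := @mnw_step_mean _ _ _ _ cW hWoo _ _ _ _ _ Y_mnw t t_ge0 v (fun w H => 0) (fun w H => 0)
  (fun w l => 0) (fun w l => expR (b * (rem v w - l)))
  (fun w l => - (a v w / (a v w + b)) * expR (b * (rem v w - l)))
  (fun w l => (a v w / (a v w + b)) * b * expR (b * (rem v w - l))) (fun w => 0) (expR (b * t)).
move=> H; etransitivity; last (etransitivity; first apply: H).
- by congr mean; apply/funext => w; rewrite mul0r add0r.
- apply: measurable_funD.
    by under eq_fun do rewrite mul0r; exact: measurable_cst.
  apply: measurableT_comp; first exact: measurable_expR.
  by apply: measurable_funM; [exact: measurable_cst|exact: past_left].
- move=> w l H0 l0 lr; rewrite mul0r add0r ger0_norm ?expR_ge0 // ler_expR ler_pM2l //.
  exact: le_trans (ler_norm _) (left_le l0 lr).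
- by [].
- by move=> w; exact: bounded_rv_cst.
- by [].
- by move=> w l; apply: is_derive_eq (is_derive_exp_reflect _ _ _ _) _; ring.
- by move=> w; exact: continuous_exp_reflect.
- by move=> w l; field.
- by congr mean; apply/funext => w; case: ifP => // _; rewrite subrr subr0 mulr0 expR0; ring.
Qed.

End past.

Section pairs.
Hypothesis kW : convex_set W.
Variables x y : E.
Hypotheses (x0 : LW [set H | points H x] = 0%E) (y0 : LW [set H | points H y] = 0%E).
Local Notation b := (fine (Lambda (hits (segment x y)))).

Definition cell_pair v w : R := \1_(c v w) x * \1_(c v w) y.

(** Used with two values of [r]: the rate of the segment gives the quantity followed along the
    cells, and the rate of the cell gives the amount lost at a split. *)
Definition pair_kernel v w (r : R) : R :=
  cell_pair v w * (if 0 <= rem v w then exp_kernel (rem v w) r else 0).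

Lemma cell_pair_bounds v w : 0 <= cell_pair v w <= 1.
Proof. by rewrite /cell_pair !indicE; do 2 case: (_ \in _); rewrite ?mulr0 ?mul0r ?mulr1 ?lexx ?ler01. Qed.

Let through : set Hy := [set H | points H x] `|` [set H | points H y].
Let mthrough : measurable through.
Proof. by apply: measurableU; exact: measurable_points_through. Qed.
Let through0 : LW through = 0%E.
Proof. by apply: null_set_setU => //; exact: measurable_points_through. Qed.

(** The indicator of [c] is inserted because the mean runs over [W] while the splitting formula
    integrates over [c]. *)
Let sep v w H : R := \1_(hits (c v w)) H * (cell_pair v w * same_side x y H).

Let bounded_sep v w : bounded_rv (sep v w).
Proof.
apply: bounded_rvM; first by apply: bounded_rv_indic; exact: measurable_hits_cell1.
apply: bounded_rvM; first exact: bounded_rv_cst.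
by split; [exact: measurable_same_side|exists 2 => H; exact: same_side_norm].
Qed.

(** If both points lie in the cell, convexity puts the segment into it, so [xy] is contained in [c].
    Off the null set of hyperplanes through x or y, a hyperplane of [c] keeps the points together
    exactly when it misses the segment. *)
Lemma mean_same_side v w : mean LW (sep v w) = cell_pair v w * (a v w - b).
Proof.
have [/andP[cx cy]|nxy] := boolP ((x \in c v w) && (y \in c v w)); last first.
  have c0 : cell_pair v w = 0.
    by move: nxy; rewrite /cell_pair !indicE; do 2 case: (_ \in _); rewrite ?mulr0 ?mul0r.
  rewrite (_ : sep v w = fun=> 0); first by rewrite mean_cst c0 !mul0r.
  by apply/funext => H; rewrite /sep c0 mul0r mulr0.
have c1 : cell_pair v w = 1 by rewrite /cell_pair !indicE cx cy mulr1.
rewrite !inE in cx cy.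
have sc : segment x y `<=` c v w by exact: segment_cell.
have mc : measurable (hits (c v w)) by exact: measurable_hits_cell1.
have ms : measurable (hits (segment x y)) by apply: measurable_hits; exact: segment_compact.
rewrite (@mean_off_null _ _ _ LW through _
  (fun H => \1_(hits (c v w)) H - \1_(hits (segment x y)) H)) //; first last.
- move=> H /not_orP[Hx Hy]; rewrite /sep c1 mul1r same_sideE //.
  rewrite !indicE; case: (boolP (H \in hits (segment x y))) => Hs; last by rewrite !subr0 mulr1.
  rewrite (_ : H \in hits (c v w)) ?mul1r //.
  by rewrite inE; apply: (hits_subset sc); rewrite inE in Hs.
- by apply: bounded_rvB; exact: bounded_rv_indic.
rewrite meanB; try exact: bounded_rv_indic.
rewrite !mean_indic // c1 mul1r; congr (_ - _).
  by rewrite /rate; congr fine; apply: hitting_measure_hits; exact: cell_sub.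
by congr fine; apply: hitting_measure_hits; apply: subset_trans sc _; exact: cell_sub.
Qed.

Lemma b_ge0 : 0 <= b.
Proof. by rewrite fine_ge0. Qed.

Lemma pair_children v w r : pair_kernel (true :: v) w r + pair_kernel (false :: v) w r =
  (spl v w)%:R * (exp_kernel (rem v w - fine (L v w)) r * (cell_pair v w * same_side x y (h v w))).
Proof.
have ic k p : \1_(c (k :: v) w) p = \1_(c v w) p * \1_(halfspace k (h v w)) p :> R.
  by rewrite /= indicI.
rewrite /pair_kernel !remaining_child_ge0 /cell_pair !ic /same_side !remaining_cons.
by case: (splits t (L^~ w) v) => /=; ring.
Qed.

Lemma bounded_pair_kernel v (r : Omega -> R) : measurable_fun setT r -> (forall w, 0 <= r w) ->
  bounded_rv (fun w => pair_kernel v w (r w)).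
Proof.
move=> mr r0; have mrem : measurable_fun setT (fun w => rem v w) by exact: measurable_remaining.
have mcell p : measurable_fun setT (fun w => \1_(c v w) p : R).
  rewrite (_ : (fun w => _) = \1_[set w | c v w p]).
    apply: measurable_indic; apply: (@measurable_cell _ _ _ _ h v _ W (fun=> p)) => //.
    exact: measurable_compact.
  by apply/funext => w; rewrite !indicE; congr ((nat_of_bool _)%:R); apply/idP/idP; rewrite !inE.
split.
  apply: measurable_funM; first exact: measurable_funM.
  apply: measurable_fun_ifT; last exact: measurable_cst.
    by apply: measurable_fun_ler => //; exact: measurable_cst.
  exact: measurable_exp_kernel.
exists t => w; have /andP[c0 c1] := cell_pair_bounds v w.
rewrite normrM (ger0_norm c0); apply: (@le_trans _ _ (1 * t)); last by rewrite mul1r.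
apply: ler_pM => //; case: ifP => rw; last by rewrite normr0.
have /andP[k0 k1] := exp_kernel_bounds rw (r0 w).
by rewrite ger0_norm //; apply: le_trans k1 _; exact: remaining_le.
Qed.

(** With the pair indicator abbreviated by i, the solution is p = - i K(r - l, b) and ga = - i. The
    identity to check reduces to exp(-bs) = 1 - b K(s,b); then - p(0) is the kernel at rate b, and
    [ga] produces the loss at the rate of the cell. *)
Lemma pair_step v :
  mean P (fun w => pair_kernel (true :: v) w b + pair_kernel (false :: v) w b) =
  mean P (fun w => pair_kernel v w b) - mean P (fun w => pair_kernel v w (a v w)).
Proof.
pose T := events_type L h (past v).
have mhp u : (size u < size v)%N -> measurable_fun [set: T] (h u : T -> Hy).
  by move=> uv; apply: (measurable_h_events (U := past v)); exact: before_past.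
have mrem : measurable_fun [set: T] (fun w : T => rem v w) by exact: past_remaining.
have mcell p : measurable_fun [set: T] (fun w : T => \1_(c v w) p : R).
  rewrite (_ : (fun w => _) = \1_[set w : T | c v w p]).
    apply: measurable_indic; apply: (@measurable_cell _ _ _ T h v mhp W (fun=> p)) => //.
    exact: measurable_compact.
  by apply/funext => w; rewrite !indicE; congr ((nat_of_bool _)%:R); apply/idP/idP; rewrite !inE.
rewrite -meanB; first last.
- apply: bounded_pair_kernel; last by move=> w; exact: rate_ge0.
  by apply: (measurable_rate cW hWoo).
- by apply: bounded_pair_kernel => [|w]; [exact: measurable_cst|exact: b_ge0].
have := @mnw_step_mean _ _ _ _ cW hWoo _ _ _ _ _ Y_mnw t t_ge0 v
  (fun w H => cell_pair v w * same_side x y H) (fun w => sep v w)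
  (fun w l => exp_kernel (rem v w - l) b) (fun w l => 0)
  (fun w l => - cell_pair v w * exp_kernel (rem v w - l) b)
  (fun w l => - (- cell_pair v w * expR (- b * (rem v w - l)))) (fun w => - cell_pair v w) (t * 2).
move=> H; etransitivity; last (etransitivity; first apply: H).
- by congr mean; apply/funext => w; rewrite pair_children addr0.
- apply: measurable_funD; last exact: measurable_cst.
  apply: measurable_funM.
    apply: measurable_exp_kernel; first exact: (past_left (v := v)).
      exact: measurable_cst.
    by move=> w; exact: b_ge0.
  apply: measurable_funM.
    by apply: (past_fst (v := v) (f := cell_pair v)); exact: measurable_funM.
  exact: (measurableT_comp (measurable_same_side x y) (past_hyperplane (v := v))).
- move=> w l H0 l0 lr; rewrite addr0 normrM; apply: ler_pM => //.
    have rl : 0 <= rem v w - l by rewrite subr_ge0.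
    have /andP[k0 k1] := exp_kernel_bounds rl b_ge0.
    rewrite ger0_norm //; apply: le_trans k1 _.
    exact: le_trans (ler_norm _) (left_le l0 lr).
  have /andP[c0 c1] := cell_pair_bounds v w.
  rewrite normrM (ger0_norm c0) -[leRHS]mul1r; apply: ler_pM => //.
  exact: same_side_norm.
- by move=> w H0 Hc; rewrite /sep indicE mem_set // mul1r.
- by move=> w; exact: bounded_sep.
- by move=> w H0 Hc; rewrite /sep indicE memNset // mul0r.
- by move=> w l; exact: is_derive_kernel_reflect.
- move=> w; rewrite (_ : (fun l => _) = fun l => cell_pair v w * expR (- b * (rem v w - l))).
    exact: continuous_exp_reflect.
  by apply/funext => l; rewrite mulNr opprK.
- move=> w l; rewrite mean_same_side.
  have -> : expR (- b * (rem v w - l)) = 1 - b * exp_kernel (rem v w - l) b.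
    by rewrite exp_kernelE subKr.
  by ring.
- congr mean; apply/funext => w; rewrite /pair_kernel; case: ifP => _; last by rewrite mulr0 subrr.
  by rewrite subrr exp_kernel0 subr0; ring.
Qed.

End pairs.
End steps.

(** * The martingale of facet sums *)

Section integral_off_null.
Local Open Scope ereal_scope.
Context d (T : measurableType d) (R : realType).
Variable m : {measure set T -> \bar R}.
Import HBNNSimple.

(* A simple function below [f], cut off on [N], is below [g] and keeps its
   integral; this does not require [f] and [g] to be measurable. *)
Lemma ge0_le_integral_off_null (N : set T) (f g : T -> \bar R) :
  measurable N -> m N = 0 -> (forall x, 0 <= f x) -> (forall x, 0 <= g x) ->
  (forall x, ~ N x -> f x <= g x) -> \int[m]_x f x <= \int[m]_x g x.
Proof.
move=> mN N0 f0 g0 fg; rewrite !ge0_integralTE //.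
apply: ge_ereal_sup => _ [u /= uf <-].
have mNC : measurable (~` N) by exact: measurableC.
have -> : sintegral m u = sintegral m (proj_nnsfun u mNC).
  rewrite -!integralT_nnsfun; apply: ae_eq_integral => //.
  - exact/measurable_EFinP.
  - exact/measurable_EFinP.
  - exists N; split => // x /= /not_implyP[_ ux]; apply: contra_notP ux => Nx.
    by rewrite mindicE mem_set // mulr1.
apply: ereal_sup_ubound; exists (proj_nnsfun u mNC) => //= x.
rewrite mindicE; have [Nx|Nx] := pselect (N x).
  by rewrite memNset ?mulr0 //= => /(_ Nx).
by rewrite mem_set // mulr1; apply: le_trans (uf x) (fg x Nx).
Qed.

Lemma ge0_integral_off_null (N : set T) (f g : T -> \bar R) :
  measurable N -> m N = 0 -> (forall x, 0 <= f x) -> (forall x, 0 <= g x) ->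
  (forall x, ~ N x -> f x = g x) -> \int[m]_x f x = \int[m]_x g x.
Proof.
move=> mN N0 f0 g0 fg; apply/eqP; rewrite eq_le.
by apply/andP; split; apply: (ge0_le_integral_off_null mN N0) => // x Nx; rewrite fg.
Qed.

Lemma integral_off_null (N : set T) (f g : T -> \bar R) :
  measurable N -> m N = 0 -> (forall x, ~ N x -> f x = g x) ->
  \int[m]_x f x = \int[m]_x g x.
Proof.
move=> mN N0 fg; rewrite integralE [RHS]integralE.
by congr (_ - _); apply: (ge0_integral_off_null mN N0) => // x Nx;
  rewrite ?funeposE ?funenegE fg.
Qed.

(** Fatou for a sequence that is eventually constant off N. The limit [f] is only compared with the
    lower limit off N, so it may fail to be measurable. *)
Lemma integral_eventually_le (N : set T) (u : nat -> T -> R) (f : T -> R) (C : \bar R) :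
  measurable N -> m N = 0 ->
  (forall k, measurable_fun setT (u k)) -> (forall k x, 0 <= u k x)%R ->
  (forall x, 0 <= f x)%R ->
  (forall x, ~ N x -> exists k0, forall k, (k0 <= k)%N -> u k x = f x) ->
  (forall k, \int[m]_x (u k x)%:E <= C) ->
  \int[m]_x (f x)%:E <= C.
Proof.
move=> mN N0 mu u0 f0 uf uC.
apply: (@le_trans _ _ (\int[m]_x limn_einf (fun k => (u k x)%:E))).
  apply: (ge0_le_integral_off_null mN N0).
  - by move=> x; rewrite lee_fin.
  - move=> x; rewrite limn_einf_lim; apply: lime_ge; first exact: is_cvg_einfs.
    by apply: nearW => k; apply: le_ereal_inf_tmp => _ [l /= _ <-]; rewrite lee_fin.
  - move=> x /uf[k0 k0u]; rewrite (_ : limn_einf _ = (f x)%:E) //.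
    apply: (cvg_limn_einf_sup _).1; apply: cvg_near_cst.
    by exists k0 => // k /= k0k; rewrite k0u.
apply: le_trans (fatou _ _ _ _) _ => //.
- by move=> k; apply/measurable_EFinP.
- by move=> k x _; rewrite lee_fin.
rewrite limn_einf_lim; apply: lime_le; first exact: is_cvg_einfs.
apply: nearW => k; apply: le_trans (uC k).
by apply: ereal_inf_lbound; exists k => /=.
Qed.

End integral_off_null.

Section martingale.
Variables (R : realType) (n : nat).
Local Notation E := 'rV[R]_n.+1.
Local Notation Hy := (hyperplane R n).
Variables (W : set E) (Lambda : {measure set Hy -> \bar R}).
Hypotheses (cW : compact W) (hWoo : (Lambda (hits W) < +oo)%E).
Hypothesis Lambda_null : forall H : Hy, Lambda [set H] = 0%E.
Variables (d : measure_display) (Omega : measurableType d) (P : probability Omega R).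
Variables (L : seq bool -> Omega -> \bar R) (h : seq bool -> Omega -> Hy).
Hypothesis Y_mnw : mnw_process Lambda L h P W.
Variables (t : R) (t_ge0 : 0 <= t).
Variables (z : Hy -> R) (Mz : R).
Hypotheses (mz : measurable_fun setT z) (zM : forall H, `|z H| <= Mz).

Local Notation rem v w := (remaining t (L^~ w) v).
Local Notation spl v w := (splits t (L^~ w) v).
Local Notation c v w := (cell W (h^~ w) v).
Local Notation a := (rate W Lambda h).
Local Notation m v w := (first_moment cW hWoo z (c v w)).
Local Notation fac := (facet_value W z t L h).
Local Notation gn := (gain cW hWoo z t L h).
Local Notation dr := (drift cW hWoo z t L h).
Local Notation wm := (weight_max cW Mz).

Let mL v : measurable_fun setT (L v). Proof. by have [] := Y_mnw. Qed.
Let mh v : measurable_fun setT (h v). Proof. by have [] := Y_mnw. Qed.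
Let bfac := bounded_facet_value cW Y_mnw t mz zM.
Let bgn := bounded_gain cW hWoo Y_mnw t_ge0 mz zM.
Let bdr := bounded_drift cW hWoo Y_mnw t_ge0 mz zM.

Definition increment v w : R := gn v w - dr v w.

Lemma drift_children v w : fac v w + (dr (true :: v) w + dr (false :: v) w) = gn v w.
Proof.
rewrite /facet_value /gain -(first_moment_split cW hWoo Lambda_null mz zM (h^~ w) v).
rewrite /drift !remaining_child_ge0 !remaining_cons.
by case: (splits t (L^~ w) v) => /=; ring.
Qed.

Definition facet_sum j w : R := \sum_(v <- generation j) fac v w.

Definition martingale k w : R :=
  \sum_(0 <= j < k) facet_sum j w + \sum_(v <- generation k) dr v w.

Lemma martingaleS k w : martingale k.+1 w =
  martingale k w + \sum_(v <- generation k) increment v w.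
Proof.
rewrite /martingale big_nat_recr //= sum_generationS -!addrA; congr (_ + _).
rewrite /facet_sum -!big_split /=; apply: eq_bigr => v _.
by rewrite /increment -drift_children; ring.
Qed.

Lemma bounded_increment v : bounded_rv (increment v).
Proof. exact: bounded_rvB. Qed.

Lemma bounded_facet_sum j : bounded_rv (facet_sum j).
Proof. by apply: bounded_rv_sum => v _; exact: bfac. Qed.

Lemma bounded_martingale k : bounded_rv (martingale k).
Proof.
apply: bounded_rvD; last by apply: bounded_rv_sum => v _; exact: bdr.
by apply: bounded_rv_sum => j _; exact: bounded_facet_sum.
Qed.

Section past_measurability.
Variable v : seq bool.
Local Notation T := (events_type L h (past v)).
Let mLp u : past v u -> measurable_fun [set: T] (L u : T -> \bar R).
Proof. by move=> uv; exact: measurable_L_events. Qed.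
Let mhp u : past v u -> measurable_fun [set: T] (h u : T -> Hy).
Proof. by move=> uv; exact: measurable_h_events. Qed.

Lemma past_drift_le u : (size u <= size v)%N -> measurable_fun [set: T] (dr u : T -> R).
Proof.
move=> uv; apply: (measurable_drift cW hWoo t (T := T) mz zM) => u' u'u.
  by apply: mLp; apply: before_past; exact: leq_trans uv.
by apply: mhp; apply: before_past; exact: leq_trans uv.
Qed.

Lemma past_gain u : past v u -> measurable_fun [set: T] (gn u : T -> R).
Proof.
move=> [uv nuv]; apply: (measurable_gain cW hWoo t (T := T) mz zM).
- by move=> u' u'u; apply: mLp; apply: before_past; exact: leq_trans uv.
- by move=> u' u'u; apply: mhp; apply: before_past; exact: leq_trans uv.
- exact: mLp.
- exact: mhp.
Qed.

Lemma past_facet u : past v u -> measurable_fun [set: T] (fac u : T -> R).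
Proof.
move=> [uv nuv]; apply: (measurable_facet_value cW t (T := T) mz zM).
- by move=> u' u'u; apply: mLp; apply: before_past; exact: leq_trans uv.
- by move=> u' u'u; apply: mhp; apply: before_past; exact: leq_trans uv.
- exact: mLp.
- exact: mhp.
Qed.

Lemma measurable_big_sum d' (T' : measurableType d') (I : eqType) (s : seq I) (F : I -> T' -> R) :
  (forall i, i \in s -> measurable_fun setT (F i)) ->
  measurable_fun setT (fun w => \sum_(i <- s) F i w).
Proof.
elim: s => [|i s IH] mF; first by under eq_fun do rewrite big_nil; exact: measurable_cst.
under eq_fun do rewrite big_cons; apply: measurable_funD; first by apply: mF; rewrite mem_head.
by apply: IH => j js; apply: mF; rewrite in_cons js orbT.
Qed.

Lemma past_martingale k : (k <= size v)%N ->
  measurable_fun [set: T] (martingale k : T -> R).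
Proof.
move=> kv; apply: measurable_funD.
  apply: measurable_big_sum => j; rewrite mem_index_iota => /andP[_ jk].
  apply: measurable_big_sum => u /size_generation us; apply: past_facet; apply: before_past.
  by rewrite /before /= us; exact: leq_trans kv.
by apply: measurable_big_sum => u /size_generation us; apply: past_drift_le; rewrite us.
Qed.

End past_measurability.

Lemma increment_orthogonal v (Z : Omega -> R) : bounded_rv Z ->
  measurable_fun [set: events_type L h (past v)] (Z : events_type L h (past v) -> R) ->
  mean P (fun w => Z w * increment v w) = 0.
Proof.
move=> bZ mZ; have [_ [C ZC]] := bZ.
rewrite (_ : (fun w => _) = fun w => Z w * gn v w - Z w * dr v w); last first.
  by apply/funext => w; rewrite mulrBr.
rewrite meanB; try exact: bounded_rvM.
by rewrite (gain_orthogonal cW hWoo Y_mnw t_ge0 mz zM mZ ZC) subrr.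
Qed.

(** Expanding the square of the gain around the drift leaves a cross term, which vanishes because
    the drift belongs to the past; [gain_sqr] identifies the rest. *)
Lemma increment_sqr v : mean P (fun w => increment v w ^+ 2) = mean P (fun w => fac v w ^+ 2).
Proof.
have bd : bounded_rv (fun w => dr v w * increment v w) by exact: bounded_rvM (bounded_increment v).
have e := gain_sqr cW hWoo Y_mnw t_ge0 mz zM v.
rewrite (_ : (fun w => increment v w ^+ 2) =
    fun w => (gn v w ^+ 2 - dr v w ^+ 2) - 2 * (dr v w * increment v w)); last first.
  by apply/funext => w; rewrite /increment; ring.
rewrite meanB; first last.
- by apply: bounded_rvM => //; exact: bounded_rv_cst.
- by apply: bounded_rvB; exact: bounded_rvX.
rewrite meanZ // increment_orthogonal //; last exact: past_drift_le.
by rewrite meanB; [rewrite e; ring|exact: bounded_rvX|exact: bounded_rvX].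
Qed.

(** Cells are added one at a time. The past of the new cell contains [Z] and the increments of the
    cells already added, although they belong to the same generation, so the cross term is 0. *)
Lemma generation_pythagoras k (s : seq (seq bool)) (Z : Omega -> R) : bounded_rv Z ->
  uniq s -> {subset s <= generation k} ->
  (forall v, size v = k -> measurable_fun [set: events_type L h (past v)]
     (Z : events_type L h (past v) -> R)) ->
  mean P (fun w => (Z w + \sum_(v <- s) increment v w) ^+ 2) =
  mean P (fun w => Z w ^+ 2) + \sum_(v <- s) mean P (fun w => fac v w ^+ 2).
Proof.
move=> bZ; elim: s => [|v s IH] /=.
  move=> _ _ _; rewrite big_nil addr0.
  by congr mean; apply/funext => w; rewrite big_nil addr0.
move=> /andP[vs us] sk mZ; have sk' : {subset s <= generation k}.
  by move=> u us'; apply: sk; rewrite in_cons us' orbT.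
have kv : size v = k by apply: size_generation; apply: sk; rewrite mem_head.
pose Z' w := Z w + \sum_(u <- s) increment u w.
have bZ' : bounded_rv Z'.
  by apply: bounded_rvD => //; apply: bounded_rv_sum => u _; exact: bounded_increment.
have mZ' : measurable_fun [set: events_type L h (past v)] (Z' : events_type L h (past v) -> R).
  apply: measurable_funD; first exact: mZ.
  apply: measurable_big_sum => u us'; apply: measurable_funB.
    apply: past_gain; split; first by rewrite kv (size_generation (sk' _ us')).
    by move=> uv; move: vs; rewrite -uv us'.
  by apply: past_drift_le; rewrite kv (size_generation (sk' _ us')).
rewrite (_ : (fun w => _) = fun w => (Z' w ^+ 2 + 2 * (Z' w * increment v w)) + increment v w ^+ 2); last first.
  by apply/funext => w; rewrite big_cons /Z'; ring.
have b1 : bounded_rv (fun w => Z' w * increment v w) by apply: bounded_rvM => //; exact: bounded_increment.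
have b2 : bounded_rv (fun w => 2 * (Z' w * increment v w)) by apply: bounded_rvM => //; exact: bounded_rv_cst.
have b3 : bounded_rv (fun w => Z' w ^+ 2) by exact: bounded_rvX.
have b4 : bounded_rv (fun w => increment v w ^+ 2) by apply: bounded_rvX; exact: bounded_increment.
rewrite meanD //; last exact: bounded_rvD.
rewrite meanD // meanZ // increment_orthogonal // mulr0 addr0 increment_sqr.
by rewrite (IH us sk' mZ) big_cons addrAC -addrA.
Qed.

Definition energy j : R := \sum_(v <- generation j) mean P (fun w => fac v w ^+ 2).

Lemma martingale_pythagoras k l : (k <= l)%N ->
  mean P (fun w => (martingale l w - martingale k w) ^+ 2) = \sum_(k <= j < l) energy j.
Proof.
move=> /subnK <-; elim: (l - k)%N => [|i IH].
  rewrite add0n big_geq //; rewrite (_ : (fun w => _) = fun=> 0); first by rewrite mean_prob_cst.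
  by apply/funext => w; rewrite subrr expr0n.
rewrite addSn big_nat_recr ?leq_addl //= -IH.
rewrite (_ : (fun w => _) = fun w => ((martingale (i + k) w - martingale k w) +
    \sum_(v <- generation (i + k)) increment v w) ^+ 2); last first.
  by apply/funext => w; rewrite martingaleS; ring.
rewrite (@generation_pythagoras (i + k)) //.
- by apply: bounded_rvB; exact: bounded_martingale.
- exact: uniq_generation.
- move=> v vk; apply: measurable_funB; apply: past_martingale; rewrite vk //.
  exact: leq_addl.
Qed.

Lemma mean_martingale k : mean P (martingale k) = mean P (martingale 0).
Proof.
elim: k => [//|k IH].
rewrite (_ : martingale k.+1 = fun w => martingale k w + \sum_(v <- generation k) increment v w);
  last by apply/funext => w; exact: martingaleS.
rewrite meanD; [|exact: bounded_martingale|by apply: bounded_rv_sum => v _; exact: bounded_increment].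
rewrite IH mean_sum; last by move=> v _; exact: bounded_increment.
rewrite big1 ?addr0 // => v _.
have H := @increment_orthogonal v (fun=> 1) (bounded_rv_cst _ 1) (measurable_cst _).
by rewrite -[RHS]H; congr mean; apply/funext => w; rewrite mul1r.
Qed.

Definition total_mean : R := t * first_moment cW hWoo z W.

Lemma martingale0 w : martingale 0 w = total_mean.
Proof. by rewrite /martingale big_geq // add0r big_seq1 /drift /= t_ge0. Qed.

(* The weight exp (beta * remaining time), with beta large compared to all rates,
   loses a factor 4 per generation. *)
Definition growth : R := 7 * fine (Lambda (hits W)) + 1.

Definition alive v w : R := if 0 <= rem v w then expR (growth * rem v w) else 0.

Lemma growth_gt0 : 0 < growth.
Proof. by rewrite /growth ltr_wpDl // mulr_ge0 // fine_ge0. Qed.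

Lemma alive_ge0 v w : 0 <= alive v w.
Proof. by rewrite /alive; case: ifP => // _; exact: expR_ge0. Qed.

Lemma bounded_alive v : bounded_rv (alive v).
Proof.
have mr : measurable_fun setT (fun w => rem v w) by exact: measurable_remaining.
split.
  apply: measurable_fun_ifT; last exact: measurable_cst.
    by apply: measurable_fun_ler => //; exact: measurable_cst.
  apply: measurableT_comp; first exact: measurable_expR.
  by apply: measurable_funM => //; exact: measurable_cst.
exists (expR (growth * t)) => w; rewrite ger0_norm ?alive_ge0 // /alive.
case: ifP => _; last exact: expR_ge0.
by rewrite ler_expR ler_pM2l ?growth_gt0 //; exact: remaining_le.
Qed.

Lemma alive_children v w : alive (true :: v) w + alive (false :: v) w =
  2 * ((spl v w)%:R * expR (growth * (rem v w - fine (L v w)))).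
Proof.
rewrite /alive !remaining_child_ge0 !remaining_cons.
by case: (splits t (L^~ w) v) => /=; ring.
Qed.

(** Each child contributes at most 1/8 of the parent in mean, by [split_exp], and there are two
    children. *)
Lemma mean_alive_children v :
  mean P (fun w => alive (true :: v) w + alive (false :: v) w) <= 4^-1 * mean P (alive v).
Proof.
have b2 : bounded_rv (fun w => (spl v w)%:R * expR (growth * (rem v w - fine (L v w)))).
  have b : bounded_rv (fun w => alive (true :: v) w + alive (false :: v) w).
    by apply: bounded_rvD; exact: bounded_alive.
  have -> : (fun w => (spl v w)%:R * expR (growth * (rem v w - fine (L v w)))) =
     fun w => 2^-1 * (alive (true :: v) w + alive (false :: v) w).
    by apply/funext => w; rewrite alive_children mulKf.
  by apply: bounded_rvM => //; exact: bounded_rv_cst.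
under [X in mean _ X]eq_fun do rewrite alive_children.
rewrite meanZ // (split_exp cW hWoo Y_mnw t_ge0 v growth_gt0).
set F := fun w => _.
have FE w : 0 <= F w <= 8^-1 * alive v w.
  rewrite /F /alive; case: ifP => r0; last by rewrite mulr0 lexx.
  have a0 : 0 <= a v w by exact: rate_ge0.
  have a1 : a v w <= fine (Lambda (hits W)) by exact: rate_le.
  have ab : 0 < a v w + growth by rewrite ltr_wpDl ?growth_gt0.
  (* The reason for the factor 7: [growth] exceeds seven times the largest possible rate. The
     additional 1 keeps it positive when the rates vanish. *)
  have q1 : a v w / (a v w + growth) <= 8^-1.
    by rewrite ler_pdivrMr // /growth; lra.
  have q0 : 0 <= a v w / (a v w + growth) by rewrite divr_ge0 // ltW.
  have e0 : expR (- a v w * rem v w) <= expR (growth * rem v w).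
    rewrite ler_expR; apply: ler_wpM2r => //; have := growth_gt0; lra.
  rewrite mulr_ge0 ?subr_ge0 //=; apply: ler_pM => //; first by rewrite subr_ge0.
  by have := expR_ge0 (- a v w * rem v w); lra.
have bF : bounded_rv F.
  split.
    apply: measurable_fun_ifT; last exact: measurable_cst.
      by apply: measurable_fun_ler; [exact: measurable_cst|exact: measurable_remaining].
    have ma : measurable_fun setT (a v) by apply: (measurable_rate cW hWoo).
    have mr : measurable_fun setT (fun w => rem v w) by exact: measurable_remaining.
    apply: measurable_funM.
      apply: measurable_funM => //; apply: measurable_funV_ge0.
        by apply: measurable_funD.
      by move=> w; rewrite addr_ge0 ?rate_ge0 // ltW // growth_gt0.
    apply: measurable_funB; apply: measurableT_comp; try exact: measurable_expR.
      by apply: measurable_funM.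
    by apply: measurable_funM => //; exact: measurable_funN.
  have [_ [C aC]] := bounded_alive v; exists C => w.
  have /andP[F0 F1] := FE w; rewrite ger0_norm //; apply: le_trans (aC w).
  have := alive_ge0 v w; rewrite (ger0_norm (alive_ge0 v w)); lra.
have : mean P F <= 8^-1 * mean P (alive v).
  rewrite -meanZ; last exact: bounded_alive.
  apply: mean_le => //; first by apply: bounded_rvM; [exact: bounded_rv_cst|exact: bounded_alive].
  by move=> w; have /andP[] := FE w.
lra.
Qed.

Lemma mean_alive k : \sum_(v <- generation k) mean P (alive v) <= expR (growth * t) * 4^-1 ^+ k.
Proof.
elim: k => [|k IH].
  rewrite big_seq1 expr0 mulr1 (_ : alive [::] = fun=> expR (growth * t)) ?mean_prob_cst //.
  by apply/funext => w; rewrite /alive /= t_ge0.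
rewrite sum_generationS exprS mulrCA.
apply: (@le_trans _ _ (\sum_(v <- generation k) 4^-1 * mean P (alive v))).
  by apply: ler_sum => v _; rewrite -meanD; [exact: mean_alive_children|exact: bounded_alive|exact: bounded_alive].
by rewrite -mulr_sumr ler_pM2l ?invr_gt0.
Qed.

Lemma splits_alive v w : (spl v w)%:R <= alive v w.
Proof.
case: (boolP (spl v w)) => [s|_] /=; last exact: alive_ge0.
have r0 := remaining_splits s; rewrite /alive r0 -[leLHS]expR0 ler_expR.
by rewrite mulr_ge0 // ltW // growth_gt0.
Qed.

Definition energy_const : R := wm ^+ 2 * expR (growth * t).

Lemma energy_const_ge0 : 0 <= energy_const.
Proof. by rewrite mulr_ge0 ?sqr_ge0 ?expR_ge0. Qed.

Lemma energy_le j : energy j <= energy_const * 4^-1 ^+ j.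
Proof.
rewrite /energy_const -mulrA; apply: (@le_trans _ _ (\sum_(v <- generation j) wm ^+ 2 * mean P (alive v))).
  apply: ler_sum => v _; rewrite -meanZ; last exact: bounded_alive.
  apply: mean_le; first by apply: bounded_rvX; exact: bfac.
    by apply: bounded_rvM; [exact: bounded_rv_cst|exact: bounded_alive].
  move=> w; rewrite /facet_value exprMn mulrC; apply: ler_pM; rewrite ?sqr_ge0 //.
    rewrite -[leLHS]real_normK ?num_real // lerXn2r // ?nnegrE //; last exact: weight_le.
    exact: (weight_max_ge0 cW zM).
  apply: le_trans (splits_alive v w); case: (splits _ _ _) => /=; rewrite ?expr1n ?expr0n //.
by rewrite -mulr_sumr ler_wpM2l ?sqr_ge0 // mean_alive.
Qed.

Lemma energy_tail k l : (k <= l)%N ->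
  \sum_(k <= j < l) energy j <= 2 * energy_const * 4^-1 ^+ k.
Proof.
move=> kl; have C0 := energy_const_ge0.
(* A telescoping bound that survives the induction; it needs a factor of at least 4/3, and 2 is
   taken. *)
suff : \sum_(k <= j < l) energy j <= 2 * energy_const * (4^-1 ^+ k - 4^-1 ^+ l).
  move=> H; apply: le_trans H _; apply: ler_wpM2l; first by rewrite mulr_ge0.
  by rewrite gerBl exprn_ge0 ?invr_ge0.
move: kl => /subnK <-; elim: (l - k)%N => [|i IH].
  by rewrite add0n big_geq // subrr mulr0.
rewrite addSn big_nat_recr ?leq_addl //=.
apply: le_trans (lerD IH (energy_le _)) _; rewrite exprS.
have q0 : 0 <= 4^-1 ^+ (i + k) :> R by rewrite exprn_ge0 ?invr_ge0.
have := mulr_ge0 C0 q0; lra.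
Qed.

End martingale.

Lemma geometric_le (R : realType) (x y C q : R) : 0 <= q < 1 ->
  (forall k, x <= y + C * q ^+ k) -> x <= y.
Proof.
move=> /andP[q0 q1] H.
have c0 : (fun k : nat => C * q ^+ k : R) @ \oo --> (0 : R).
  by apply: (@cvg_geometric R C q); rewrite ger0_norm.
have : x - y <= 0.
  apply: (cvgr_to_ge c0); apply: nearW => k; have := H k; lra.
lra.
Qed.

(** * Variance of a limit with geometric quadratic errors *)

Section square_integrable_limit.
Context d (Omega : measurableType d) (R : realType) (P : probability Omega R).
Implicit Types f g : Omega -> R.
Local Notation integrable_rv f := (P.-integrable setT (EFin \o f)).

Let integrableDr f g : integrable_rv f -> integrable_rv g ->
  integrable_rv (fun w => f w + g w).
Proof.
by move=> If Ig; have := integrableD measurableT If Ig; congr (integrable _ _ _);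
  apply/funext => w.
Qed.

Let integrableZr k f : integrable_rv f -> integrable_rv (fun w => k * f w).
Proof.
move=> If; have := integrableZl measurableT k If; congr (integrable _ _ _).
Qed.

Let mean_addi f g : integrable_rv f -> integrable_rv g ->
  mean P (fun w => f w + g w) = mean P f + mean P g.
Proof. exact: RintegralD. Qed.

Let mean_scale k f : integrable_rv f -> mean P (fun w => k * f w) = k * mean P f.
Proof. exact: RintegralZl. Qed.

Lemma integral_sqr_le_integrable f (C : R) : measurable_fun setT f ->
  (\int[P]_w (f w ^+ 2)%:E <= C%:E)%E -> integrable_rv (fun w => f w ^+ 2) /\
  mean P (fun w => f w ^+ 2) <= C.
Proof.
move=> mf fC; have If : integrable_rv (fun w => f w ^+ 2).
  apply/integrableP; split; first by apply/measurable_EFinP; exact: measurable_funX.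
  apply: le_lt_trans (ltry C); apply: le_trans fC; rewrite le_eqVlt; apply/orP; left.
  by apply/eqP/eq_integral => w _; rewrite /= ger0_norm ?sqr_ge0.
split => //; rewrite -lee_fin /mean fineK //.
exact: integrable_fin_num If.
Qed.

(** The quadratic tail bound passes to the limit by Fatou, which makes the limit square integrable.
    Young inequalities with parameter 2^-k then carry over the mean and the variance. *)
Lemma variance_limit (X : Omega -> R) (M : nat -> Omega -> R) (N : set Omega) (s0 B : R) :
  measurable N -> P N = 0%E -> 0 <= B ->
  (forall k, bounded_rv (M k)) -> (forall w, M 0%N w = s0) ->
  (forall k, mean P (M k) = s0) ->
  (forall k l, (k <= l)%N -> mean P (fun w => (M l w - M k w) ^+ 2) <= B * 4^-1 ^+ k) ->
  (forall w, ~ N w -> exists k0, forall k, (k0 <= k)%N -> M k w = X w) ->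
  (forall k l, (k <= l)%N -> mean P (fun w => (M l w - s0) ^+ 2) <=
     mean P (fun w => (M k w - s0) ^+ 2) + B * 4^-1 ^+ k) ->
  exists V D : R, 'V_P[X] = V%:E /\
    forall k, `|V - mean P (fun w => (M k w - s0) ^+ 2)| <= D * 2^-1 ^+ k.
Proof.
move=> mN N0 B0 bM M0 mM ML MX MA.
(* [X] is not known to be measurable. Its modification [Y], set to 0 on the null set N, is the
   pointwise limit of [one * M k] everywhere and hence measurable. *)
pose one w : R := \1_(~` N) w; pose Y w := one w * X w.
have mone : measurable_fun setT one by apply: measurable_indic; exact: measurableC.
have oneN w : ~ N w -> one w = 1 by move=> Nw; rewrite /one indicE mem_set.
have one0 w : N w -> one w = 0 by move=> Nw; rewrite /one indicE memNset //= => /(_ Nw).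
have XY w : ~ N w -> X w = Y w by move=> /oneN; rewrite /Y => ->; rewrite mul1r.
have mMk k : measurable_fun setT (M k) by have [] := bM k.
have mY : measurable_fun setT Y.
  apply: (@measurable_fun_cvg _ _ _ _ (fun k w => one w * M k w)).
    by move=> k; exact: measurable_funM.
  move=> w _; apply: cvg_near_cst; have [Nw|Nw] := pselect (N w).
    by apply: nearW => k; rewrite /Y one0 // !mul0r.
  by have [k0 k0M] := MX w Nw; exists k0 => // k /= /k0M; rewrite /Y => ->.
have IM k : integrable_rv (M k) by exact: bounded_rv_integrable.
have tail k : (\int[P]_w ((Y w - M k w) ^+ 2)%:E <= (B * 4^-1 ^+ k)%:E)%E.
  apply: (@integral_eventually_le _ _ _ P N (fun l w => (M (l + k)%N w - M k w) ^+ 2)) => //.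
  - by move=> l; apply: measurable_funX; exact: measurable_funB.
  - by move=> l w; exact: sqr_ge0.
  - by move=> w; exact: sqr_ge0.
  - move=> w Nw; have [k0 k0M] := MX w Nw; exists k0 => l k0l.
    by rewrite -XY // k0M // (leq_trans k0l) // leq_addr.
  - move=> l; rewrite integral_mean ?lee_fin ?ML ?leq_addl //.
    by apply: bounded_rvX; exact: bounded_rvB.
have [It mt] : (forall k, integrable_rv (fun w => (Y w - M k w) ^+ 2)) /\
    (forall k, mean P (fun w => (Y w - M k w) ^+ 2) <= B * 4^-1 ^+ k).
  by split => k; have [] := integral_sqr_le_integrable (measurable_funB mY (mMk k)) (tail k).
have I0 : integrable_rv (fun w => (Y w - s0) ^+ 2).
  by have := It 0%N; congr (integrable _ _ _); apply/funext => w /=; rewrite M0.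
have Icst k : integrable_rv (fun=> k) by exact: bounded_rv_integrable (bounded_rv_cst _ k).
have IYM k : integrable_rv (fun w => Y w - M k w).
  apply: (@le_integrable _ _ _ P setT measurableT _ (EFin \o (fun w => 1 + (Y w - M k w) ^+ 2))).
  - by apply/measurable_EFinP; exact: measurable_funB.
  - move=> w _ /=; rewrite lee_fin (ger0_norm (x := 1 + _)); last first.
      by rewrite addr_ge0 // sqr_ge0.
    move: (Y w - M k w) => y; rewrite -[y ^+ 2]real_normK ?num_real //.
    by have := sqr_ge0 (`|y| - 1); rewrite sqrrB expr1n; have := normr_ge0 y; nra.
  - exact: integrableDr.
have IY : integrable_rv Y.
  have := integrableDr (IYM 0%N) (IM 0%N); congr (integrable _ _ _).
  by apply/funext => w /=; rewrite subrK.
have q2 : 4^-1 = 2^-1 * 2^-1 :> R by field.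
have h0 k : 0 < 2^-1 ^+ k :> R by rewrite exprn_gt0 // invr_gt0.
have EY : mean P Y = s0.
  suff H : `|mean P Y - s0| <= 0 by move: H; rewrite normr_le0 subr_eq0 => /eqP.
  apply: (@geometric_le R _ 0 (2^-1 * (1 + B)) 2^-1); first by lra.
  move=> k; rewrite add0r -(mM k) -[mean P Y - _](RintegralB measurableT IY (IM k)).
  apply: le_trans (le_normr_Rintegral measurableT (IYM k)) _.
  set q := 2^-1 ^+ k.
  (* The bound |y| <= (q + y^2 / q) / 2 with q = 2^-k: a quadratic error of order 4^-k becomes an
     error of order 2^-k in mean. *)
  pose g w := 2^-1 * (q + q^-1 * (Y w - M k w) ^+ 2).
  have Ig : integrable_rv g by apply: integrableZr; apply: integrableDr => //; exact: integrableZr.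
  apply: (@le_trans _ _ (mean P g)).
    apply: le_Rintegral => //; first exact: integrable_norm.
    move=> w _; rewrite /g; move: (Y w - M k w) => y.
    have qp : 0 < q by exact: h0.
    have -> : 2^-1 * (q + q^-1 * y ^+ 2) = `|y| + 2^-1 * q^-1 * (`|y| - q) ^+ 2.
      rewrite -[y ^+ 2]real_normK ?num_real //; move: (`|y|) => x.
      by field; rewrite gt_eqF.
    by rewrite lerDl mulr_ge0 ?sqr_ge0 // mulr_ge0 ?invr_ge0 // ltW.
  rewrite mean_scale; last by apply: integrableDr => //; exact: integrableZr.
  rewrite mean_addi //; last exact: integrableZr.
  rewrite mean_scale // mean_prob_cst.
  rewrite -mulrA ler_pM2l ?invr_gt0 //.
  have -> : (1 + B) * q = q + q^-1 * (B * 4^-1 ^+ k).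
    rewrite q2 exprMn -/q; field; rewrite gt_eqF //; exact: h0.
  by rewrite lerD2l ler_pM2l ?invr_gt0 ?h0 // mt.
pose V := mean P (fun w => (Y w - s0) ^+ 2).
have VE : 'V_P[X] = V%:E.
  have EX : ('E_P[X] = s0%:E)%E.
    rewrite unlock (@integral_off_null _ _ _ P N _ (fun w => (Y w)%:E)) //.
      by rewrite -EY /mean fineK //; exact: integrable_fin_num IY.
    by move=> w /XY ->.
  rewrite /variance covariance.unlock EX /= expectation.unlock.
  rewrite (@integral_off_null _ _ _ P N _ (fun w => ((Y w - s0) ^+ 2)%:E)) //.
    by rewrite /V /mean fineK //; exact: integrable_fin_num I0.
  by move=> w /XY XYw; rewrite expr2 /= -XYw.
have V0 : 0 <= V by apply: mean_ge0 => w; exact: sqr_ge0.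
have VB : V <= B.
  by have := mt 0%N; rewrite expr0 mulr1 /V; under eq_fun do rewrite M0.
exists V, (V + 4 * B); split => // k.
set Ak := mean P _; set q := 2^-1 ^+ k.
have qp : 0 < q by exact: h0.
have q1 : q <= 1 by rewrite exprn_ile1 ?invr_ge0 // invf_le1 // ler1n.
have e4 : 4^-1 ^+ k = q * q by rewrite q2 exprMn.
rewrite ler_norml; apply/andP; split.
  (* The bound (x - y)^2 <= (1 + q) x^2 + (1 + 1/q) y^2 with q = 2^-k: both excess terms are of
     order q, the second because 4^-k = q^2. *)
  have : Ak <= (1 + q) * V + (1 + q^-1) * mean P (fun w => (Y w - M k w) ^+ 2).
    rewrite -[(1 + q) * V]mean_scale // -[(1 + q^-1) * _]mean_scale //.
    rewrite -mean_addi; try exact: integrableZr.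
    apply: le_Rintegral => //.
    - by apply: bounded_rv_integrable; apply: bounded_rvX; apply: bounded_rvB => //; exact: bounded_rv_cst.
    - by apply: integrableDr; exact: integrableZr.
    move=> w _; have -> : M k w - s0 = (Y w - s0) - (Y w - M k w) by ring.
    move: (Y w - s0) (Y w - M k w) => x y; rewrite -subr_ge0.
    have -> : (1 + q) * x ^+ 2 + (1 + q^-1) * y ^+ 2 - (x - y) ^+ 2 = q^-1 * (q * x + y) ^+ 2.
      by field; rewrite gt_eqF.
    by rewrite mulr_ge0 ?sqr_ge0 // invr_ge0 ltW.
  have : (1 + q^-1) * mean P (fun w => (Y w - M k w) ^+ 2) <= 2 * B * q.
    apply: (@le_trans _ _ ((1 + q^-1) * (B * (q * q)))).
      by rewrite -e4 ler_wpM2l // addr_ge0 // invr_ge0 ltW.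
    have -> : (1 + q^-1) * (B * (q * q)) = (q + 1) * (B * q) by field; rewrite gt_eqF.
    by have := mulr_ge0 B0 (ltW qp); nra.
  have := mulr_ge0 B0 (ltW qp); lra.
(* The opposite inequality comes from Fatou applied to the centred squares along the tail of the
   sequence. *)
have : V <= Ak + B * 4^-1 ^+ k.
  rewrite -lee_fin.
  have -> : V%:E = (\int[P]_w ((Y w - s0) ^+ 2)%:E)%E.
    by rewrite /V /mean fineK //; exact: integrable_fin_num I0.
  apply: (@integral_eventually_le _ _ _ P N (fun l w => (M (l + k)%N w - s0) ^+ 2)) => //.
  - by move=> l; apply: measurable_funX; apply: measurable_funB => //; exact: measurable_cst.
  - by move=> l w; exact: sqr_ge0.
  - by move=> w; exact: sqr_ge0.
  - move=> w Nw; have [k0 k0M] := MX w Nw; exists k0 => l k0l.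
    by rewrite -XY // k0M // (leq_trans k0l) // leq_addr.
  - move=> l; rewrite integral_mean ?lee_fin ?MA ?leq_addl //.
    by apply: bounded_rvX; apply: bounded_rvB => //; exact: bounded_rv_cst.
rewrite e4; have := mulr_ge0 B0 (ltW qp); have := mulr_ge0 V0 (ltW qp).
move=> h1 h2 h3; have h4 : B * (q * q) <= B * q by rewrite mulrA; exact: ler_piMr.
lra.
Qed.

End square_integrable_limit.

(** * The variance as a sum of second moments *)

Section splitting_times.
Variables (R : realType) (t : R) (L : seq bool -> \bar R).
Hypotheses (t_ge0 : 0 <= t) (L_ge0 : forall u, (0 <= L u)%E).

(** [remaining] stops keeping time once a cell is born too late. Nonnegative lifetimes guarantee
    that birth times beyond t stay beyond t for all descendants, so nothing relevant is
    forgotten. *)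
Lemma birth_remaining v :
  if 0 <= remaining t L v then birth L v = (t - remaining t L v)%:E
  else (t%:E < birth L v)%E.
Proof.
elim: v => [|b v IH]; first by rewrite /= t_ge0 subrr.
rewrite remaining_child_ge0 remaining_cons /=; case: ifPn => [s|ns].
  have r0 := remaining_splits s; rewrite r0 in IH.
  have [l [Ll l0 lr]] := splitsP s; rewrite s IH Ll /= -EFinD; congr EFin; ring.
have [r0|r0] := leP 0 (remaining t L v).
  rewrite r0 in IH; move: ns; rewrite /splits L_ge0 /= -ltNge IH.
  case: (L v) (L_ge0 v) => [l| |] //= _; rewrite ?lte_fin ?addey ?ltry //.
  lra.
move: IH; rewrite leNgt r0 /= => IH; apply: (lt_le_trans IH).
by rewrite leeDl.
Qed.

Lemma split_before_splits v : split_before L t v <-> splits t L v.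
Proof.
(* The splitting time of [v] is the birth time of either child; the child [true] is taken. *)
rewrite /split_before /= -(remaining_child_ge0 t L true v) -[(birth L v + L v)%E]/(birth L (true :: v)).
have := birth_remaining (true :: v); case: ifP => r0.
  by move=> ->; rewrite lee_fin; split => // _; lra.
by move=> H; split => //; rewrite leNgt H.
Qed.

End splitting_times.

Section levels.
Implicit Types (k : nat).

Fixpoint level k : seq (seq bool) :=
  if k is k'.+1 then level k' ++ generation k' else [::].

Lemma mem_level k v : (v \in level k) = (size v < k)%N.
Proof.
elim: k => [//|k IH]; rewrite mem_cat IH mem_generation ltnS.
by case: ltngtP.
Qed.

Lemma uniq_level k : uniq (level k).
Proof.
elim: k => [//|k IH]; rewrite cat_uniq IH uniq_generation andbT /=.
apply/hasPn => v; rewrite mem_generation mem_level => /eqP ->.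
by rewrite ltnn.
Qed.

Lemma sum_level (V : nmodType) k (F : seq bool -> V) :
  \sum_(v <- level k) F v = \sum_(0 <= j < k) \sum_(v <- generation j) F v.
Proof.
elim: k => [|k IH]; first by rewrite big_nil big_geq.
by rewrite big_cat IH big_nat_recr.
Qed.

End levels.

Lemma remaining_lt0_generation (R : realType) (t : R) (L : seq bool -> \bar R) k v :
  (forall u, size u = k -> remaining t L u < 0) -> (k <= size v)%N -> remaining t L v < 0.
Proof.
move=> H; elim: v => [|b v IH].
  by rewrite leqn0 => /eqP k0; apply: H; rewrite k0.
rewrite leq_eqVlt => /orP[/eqP e|kv]; first exact: H.
rewrite ltNge remaining_child_ge0; apply/negP => /remaining_splits.
by rewrite leNgt IH.
Qed.

Section sum_of_facets.
Variables (R : realType) (n : nat).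
Local Notation E := 'rV[R]_n.+1.
Local Notation Hy := (hyperplane R n).
Variables (W : set E) (Lambda : {measure set Hy -> \bar R}).
Hypotheses (cW : compact W) (hWoo : (Lambda (hits W) < +oo)%E).
Hypothesis Lambda_null : forall H : Hy, Lambda [set H] = 0%E.
Variables (d : measure_display) (Omega : measurableType d) (P : probability Omega R).
Variables (L : seq bool -> Omega -> \bar R) (h : seq bool -> Omega -> Hy).
Hypothesis Y_mnw : mnw_process Lambda L h P W.
Variables (t : R) (t_ge0 : 0 <= t).
Variables (zeta : E -> R) (Mz : R).
Local Notation z := (fun H : Hy => zeta (normal H)).
Hypotheses (mz : measurable_fun setT z) (zM : forall H : Hy, `|zeta (normal H)| <= Mz).

Local Notation rem v w := (remaining t (L^~ w) v).
Local Notation spl v w := (splits t (L^~ w) v).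
Local Notation fac := (facet_value W z t L h).
Local Notation mart := (martingale cW hWoo L h t z).
Local Notation X := (fun w => Sigma_phi zeta W (L ^~ w) (h ^~ w) t).

Let mL v : measurable_fun setT (L v). Proof. by have [] := Y_mnw. Qed.

(** When generation k has no cell born by time t, its drifts vanish and all splits occur in earlier
    generations. The sum in [Sigma_phi] is then supported in the finite list [level k]. *)
Lemma Sigma_phi_martingale w k : (forall u, (0 <= L u w)%E) ->
  (forall v, size v = k -> rem v w < 0) -> mart k w = X w.
Proof.
move=> L0 rk; have rk' v : (k <= size v)%N -> rem v w < 0.
  exact: remaining_lt0_generation.
rewrite /martingale [X in _ + X]big1_seq ?addr0; last first.
  by move=> v /= vk; rewrite /drift leNgt rk' // (size_generation vk).
have nspl v : (k <= size v)%N -> spl v w = false.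
  by move=> /rk'; apply: contraPF => /remaining_splits; rewrite leNgt => /negP.
rewrite /Sigma_phi.
have -> : \sum_(v \in split_before (L^~ w) t) facet_phi zeta (Ifacet W (h^~ w) v) =
    \sum_(v \in split_before (L^~ w) t) fac v w.
  apply: eq_fsbigr => v; rewrite inE => /(split_before_splits t_ge0 L0) s.
  rewrite /Ifacet facet_phi_points; last exact: measurable_cell1.
  by rewrite /facet_value s mul1r /weight mulrC.
rewrite (fsbig_fwiden (level k)).
- by rewrite sum_level.
- move=> v /(split_before_splits t_ge0 L0) s /=; rewrite mem_level ltnNge.
  by apply/negP => /nspl; rewrite s.
- exact: uniq_level.
- move=> v [_ nv] /=; rewrite /facet_value; case: (boolP (spl v w)) => s; last by rewrite mul0r.
  by case: nv; apply/(split_before_splits t_ge0 L0).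
Qed.

Lemma measurable_negative : measurable ([set x | (x < 0)%E] : set (\bar R)).
Proof.
rewrite [X in measurable X](_ : _ = `]-oo, 0%E[%classic); first exact: emeasurable_itv.
by apply/seteqP; split => x /=; rewrite in_itv.
Qed.

(** Lifetimes are prescribed in law only, so their nonnegativity has to be recovered up to a null
    set. *)
Lemma lifetime_negative_null v : P [set w | (L v w < 0)%E] = 0%E.
Proof.
have mI := measurable_negative.
have := past_rect cW hWoo Y_mnw (v := v) (A := setT) (S0 := [set x | (x < 0)%E]) (B0 := setT).
rewrite setTI => H.
have -> : [set w | (L v w < 0)%E] = [set w | [set x | (x < 0)%E] (L v w) /\ [set: Hy] (h v w)].
  by apply/seteqP; split => w //= -[].
rewrite H //; last first.
  by have := @measurableT _ (events_type L h (past v)).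
apply: integral0_eq => w _; rewrite /transition split_lawT // mule1.
rewrite lifetime_lawE //; last exact: rate_ge0.
case: ifP => _; first by rewrite diracE memNset //= ltxx.
rewrite /expint integral0_eq ?mule0 // => x _; congr EFin.
rewrite !indicE; case: (boolP (x \in EFin @^-1` [set x | (x < 0)%E])) => /=; last by rewrite mul0r.
rewrite inE /= lte_fin => x0; rewrite memNset ?mul0r ?mulr0 //= in_itv /= andbT.
by apply/negP; rewrite -ltNge.
Qed.

Definition address (i : nat) : seq bool := odflt [::] (unpickle i).

Definition negative_lifetime : set Omega := \bigcup_i [set w | (L (address i) w < 0)%E].

Lemma measurable_negative_lifetime1 v : measurable [set w | (L v w < 0)%E].
Proof.
by rewrite -[X in measurable X]setTI; exact: (mL v measurableT measurable_negative).
Qed.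

Lemma measurable_negative_lifetime : measurable negative_lifetime.
Proof. by apply: bigcupT_measurable => i; exact: measurable_negative_lifetime1. Qed.

Lemma negative_lifetime_null : P negative_lifetime = 0%E.
Proof.
have : P.-negligible negative_lifetime.
  apply: negligible_bigcup => i; exists [set w | (L (address i) w < 0)%E]; split => //.
    exact: measurable_negative_lifetime1.
  exact: lifetime_negative_null.
by move/negligibleP; apply; exact: measurable_negative_lifetime.
Qed.

Local Notation alv := (alive W Lambda L t).

(** A cell born by time t contributes at least 1 to the sum, so off this set some generation is
    empty. The condition on the sums is measurable and suited to the Markov inequality with
    [mean_alive]. *)
Definition explosion : set Omega :=
  \bigcap_k [set w | 1 <= \sum_(v <- generation k) alv v w].

Let balive k : bounded_rv (fun w => \sum_(v <- generation k) alv v w).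
Proof. by apply: bounded_rv_sum => v _; apply: (bounded_alive Y_mnw t_ge0). Qed.

Lemma measurable_explosion : measurable explosion.
Proof.
apply: bigcapT_measurable => k; apply: measurable_set_le; first exact: measurable_cst.
by have [] := balive k.
Qed.

Lemma explosion_null : P explosion = 0%E.
Proof.
have fP : P explosion \is a fin_num by exact: fin_num_measure measurable_explosion.
rewrite -[LHS]fineK //; congr EFin; apply/eqP; rewrite eq_le fine_ge0 // andbT.
apply: (@geometric_le _ _ 0 (expR (growth W Lambda * t)) 4^-1); first by lra.
move=> k; rewrite add0r -mean_indic; last exact: measurable_explosion.
apply: le_trans (mean_alive cW hWoo Y_mnw t_ge0 k).
rewrite -mean_sum; last by move=> v _; apply: (bounded_alive Y_mnw t_ge0).
apply: mean_le => //; first by apply: bounded_rv_indic; exact: measurable_explosion.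
move=> w; rewrite indicE; case: (boolP (w \in explosion)) => [|_] /=.
  by rewrite inE => /(_ k I).
by apply: sumr_ge0 => v _; exact: alive_ge0.
Qed.

Lemma eventually_Sigma_phi w : ~ (negative_lifetime `|` explosion) w ->
  exists k0, forall k, (k0 <= k)%N -> mart k w = X w.
Proof.
move=> /not_orP[nL nE].
have L0 u : (0 <= L u w)%E.
  rewrite leNgt; apply/negP => Lu; apply: nL; exists (pickle u) => //.
  by rewrite /address pickleK.
have [k0 k0E] : exists k, ~ (1 <= \sum_(v <- generation k) alv v w).
  by apply/existsNP => H; apply: nE => k _; exact: H.
exists k0 => k k0k; apply: Sigma_phi_martingale => // v vk.
apply: (@remaining_lt0_generation _ _ _ k0); last by rewrite vk.
move=> u uk; rewrite ltNge; apply/negP => r0; apply: k0E.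
have ug : u \in generation k0 by rewrite mem_generation uk.
rewrite (big_rem u) //=; apply: (@le_trans _ _ (alv u w)).
  rewrite /alive r0 -[leLHS]expR0 ler_expR mulr_ge0 // ltW //; exact: growth_gt0.
by rewrite lerDl; apply: sumr_ge0 => v' _; exact: alive_ge0.
Qed.

Lemma variance_Sigma_phi : exists V D : R, 'V_P[X] = V%:E /\
  forall k, `|V - \sum_(0 <= j < k) energy W P L h t z j| <= D * 2^-1 ^+ k.
Proof.
have s0E w : mart 0 w = total_mean cW hWoo t z by exact: martingale0.
have pyth k l (kl : (k <= l)%N) := martingale_pythagoras cW hWoo Lambda_null Y_mnw t_ge0 mz zM kl.
have pyth0 k : mean P (fun w => (mart k w - total_mean cW hWoo t z) ^+ 2) =
    \sum_(0 <= j < k) energy W P L h t z j.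
  rewrite -(pyth 0%N k) //; congr mean; apply/funext => w; by rewrite s0E.
have tail k l (kl : (k <= l)%N) := energy_tail cW hWoo Y_mnw t_ge0 mz zM kl.
have mE k : mean P (mart k) = total_mean cW hWoo t z.
  rewrite (mean_martingale cW hWoo Lambda_null Y_mnw t_ge0 mz zM).
  by rewrite -[RHS](mean_prob_cst P); congr mean; apply/funext => w; exact: s0E.
have [||||||V [D [VE VD]]] := @variance_limit _ _ _ P X mart (negative_lifetime `|` explosion)
  (total_mean cW hWoo t z) (2 * energy_const Lambda cW t Mz) _ _ _
  (bounded_martingale cW hWoo Y_mnw t_ge0 mz zM) s0E mE.
- exact: measurableU measurable_negative_lifetime measurable_explosion.
- apply: null_set_setU; [exact: measurable_negative_lifetime|exact: measurable_explosion|
    exact: negative_lifetime_null|exact: explosion_null].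
- by apply: mulr_ge0 => //; exact: energy_const_ge0.
- by move=> k l kl; rewrite pyth //; exact: tail.
- exact: eventually_Sigma_phi.
- move=> k l kl; rewrite !pyth0 (big_cat_nat (leq0n k) kl) /= lerD2l; exact: tail.
exists V, D; split => // k.
by rewrite -pyth0.
Qed.

End sum_of_facets.

(** * The integral over pairs of points *)

Section iterated_means.
Variable R : realType.

Section one_measure.
Context d (T : measurableType d) (m : {finite_measure set T -> \bar R}).
Implicit Types f g : T -> R.

Lemma mean_le_off_null (N : set T) f g : measurable N -> m N = 0%E ->
  bounded_rv f -> bounded_rv g -> (forall x, ~ N x -> f x <= g x) ->
  mean m f <= mean m g.
Proof.
move=> mN N0 bf bg fg; have bN := bounded_rv_indic R (measurableC mN).
rewrite (@mean_off_null _ _ _ _ N f (fun x => \1_(~` N) x * f x)) //; last first.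
- by move=> x Nx; rewrite indicE mem_set // mul1r.
- exact: bounded_rvM.
rewrite (@mean_off_null _ _ _ _ N g (fun x => \1_(~` N) x * g x)) //; last first.
- by move=> x Nx; rewrite indicE mem_set // mul1r.
- exact: bounded_rvM.
apply: mean_le; try exact: bounded_rvM.
move=> x; rewrite indicE; case: (boolP (x \in ~` N)) => [|_]; last by rewrite !mul0r.
by rewrite inE => /fg; rewrite !mul1r.
Qed.

Lemma mean_eq0 f : bounded_rv f -> (forall x, 0 <= f x) -> mean m f = 0 ->
  m [set x | f x <> 0] = 0%E.
Proof.
move=> bf f0 mf0; have [mf _] := bf.
have int0 : (\int[m]_x `|(f x)%:E| = 0)%E.
  rewrite -[RHS](_ : (mean m f)%:E = 0%E); last by rewrite mf0.
  by rewrite -integral_mean //; apply: eq_integral => x _; rewrite /= ger0_norm.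
have mfE : measurable_fun setT (EFin \o f) by exact/measurable_EFinP.
have [N [mN N0 fN]] := (ae_eq_integral_abs m measurableT mfE).1 int0.
apply/eqP; rewrite eq_le measure_ge0 andbT -N0.
have ms : measurable [set x | f x <> 0].
  have -> : [set x | f x <> 0] = ~` [set x | f x = 0] by [].
  by apply/measurableC/measurable_set_eq => //; exact: measurable_cst.
apply: le_measure; rewrite ?inE // => x /= fx; apply: fN => /= H; apply: fx; by have [] := H I.
Qed.

End one_measure.

Section two_measures.
Context d1 d2 (T1 : measurableType d1) (T2 : measurableType d2).
Variables (m1 : {finite_measure set T1 -> \bar R}) (m2 : {finite_measure set T2 -> \bar R}).
Implicit Types f : T1 * T2 -> R.

Lemma bounded_rv_slice f x : bounded_rv f -> bounded_rv (fun y => f (x, y)).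
Proof.
by move=> [mf [C fC]]; split; [exact: (measurableT_comp mf (pair1_measurable x))|exists C].
Qed.

Lemma bounded_rv_slice2 f y : bounded_rv f -> bounded_rv (fun x => f (x, y)).
Proof.
by move=> [mf [C fC]]; split; [exact: (measurableT_comp mf (pair2_measurable y))|exists C].
Qed.

Lemma bounded_rv_mean f : bounded_rv f -> bounded_rv (fun x => mean m2 (fun y => f (x, y))).
Proof.
move=> bf; split; first exact: measurable_mean.
have [_ [C fC]] := bf; exists (C * fine (m2 setT)) => x.
by apply: mean_norm_le => //; exact: bounded_rv_slice.
Qed.

Lemma mean_swap f : bounded_rv f -> (forall p, 0 <= f p) ->
  mean m1 (fun x => mean m2 (fun y => f (x, y))) =
  mean m2 (fun y => mean m1 (fun x => f (x, y))).
Proof.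
move=> bf f0; rewrite {1 3}/mean; congr fine.
transitivity (\int[m1]_x \int[m2]_y (f (x, y))%:E)%E.
  by apply: eq_integral => x _; rewrite integral_mean //; exact: bounded_rv_slice.
transitivity (\int[m2]_y \int[m1]_x (f (x, y))%:E)%E; last first.
  by apply: eq_integral => y _; rewrite integral_mean //; exact: bounded_rv_slice2.
apply: (fubini_tonelli (m1 := m1) (m2 := m2) (fun p => (f p)%:E)).
  by apply/measurable_EFinP; have [] := bf.
by move=> p; rewrite lee_fin.
Qed.

End two_measures.

Lemma bounded_rv_comp d1 d2 (T1 : measurableType d1) (T2 : measurableType d2)
    (f : T2 -> R) (g : T1 -> T2) : bounded_rv f -> measurable_fun setT g ->
  bounded_rv (fun x => f (g x)).
Proof.
by move=> [mf [C fC]] mg; split; [exact: (measurableT_comp mf mg)|exists C].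
Qed.

End iterated_means.

Section kernel_of_pairs.
Variables (R : realType) (n : nat).
Local Notation E := 'rV[R]_n.+1.
Local Notation Hy := (hyperplane R n).
Variables (W : set E) (Lambda : {measure set Hy -> \bar R}).
Hypotheses (cW : compact W) (kW : convex_set W) (hWoo : (Lambda (hits W) < +oo)%E).
Variables (d : measure_display) (Omega : measurableType d) (P : probability Omega R).
Variables (L : seq bool -> Omega -> \bar R) (h : seq bool -> Omega -> Hy).
Hypothesis Y_mnw : mnw_process Lambda L h P W.
Local Notation LW := (hitting_measure cW hWoo).
Variables (t : R) (t_ge0 : 0 <= t).

Local Notation rem v w := (remaining t (L^~ w) v).
Local Notation c v w := (cell W (h^~ w) v).
Local Notation a := (rate W Lambda h).
Local Notation pk := (pair_kernel W L h t).
Local Notation b x y := (fine (Lambda (hits (segment x y)))).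

Let mL v : measurable_fun setT (L v). Proof. by have [] := Y_mnw. Qed.
Let mh v : measurable_fun setT (h v). Proof. by have [] := Y_mnw. Qed.

Definition split_kernel (x y : E) v : R := mean P (fun w => pk x y v w (a v w)).
Definition residual_kernel (x y : E) v : R := mean P (fun w => pk x y v w (b x y)).

Let bpk (x y : E) v (r : R) : 0 <= r -> bounded_rv (fun w => pk x y v w r).
Proof.
by move=> r0; apply: (bounded_pair_kernel cW Y_mnw t_ge0 x y v (measurable_cst _)).
Qed.

(** Initially W contains both points and the residual is the full kernel. By [pair_step] the
    residual of each generation splits into its losses and the residual of the next. The points must
    not lie on a set of hyperplanes of positive measure. *)
Lemma kernel_telescope (x y : E) k :
  LW [set H | points H x] = 0%E -> LW [set H | points H y] = 0%E -> W x -> W y ->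
  exp_kernel t (b x y) =
  \sum_(0 <= j < k) \sum_(v <- generation j) split_kernel x y v +
  \sum_(v <- generation k) residual_kernel x y v.
Proof.
move=> x0 y0 Wx Wy; have b0 : 0 <= b x y by rewrite fine_ge0.
elim: k => [|k ->].
  rewrite big_geq // add0r big_seq1 /residual_kernel.
  rewrite -[LHS](mean_prob_cst P); congr mean; apply/funext => w.
  by rewrite /pair_kernel /cell_pair /= t_ge0 !indicE !mem_set // !mul1r.
rewrite big_nat_recr //= -addrA; congr (_ + _).
rewrite sum_generationS -big_split /=; apply: eq_bigr => v _.
rewrite /residual_kernel -meanD; try exact: bpk.
by rewrite (pair_step Y_mnw t_ge0 kW x0 y0 v) addrC subrK.
Qed.

Lemma residual_kernel_ge0 (x y : E) v : 0 <= residual_kernel x y v.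
Proof.
apply: mean_ge0 => w; rewrite /pair_kernel.
have /andP[c0 _] := cell_pair_bounds W h x y v w.
apply: mulr_ge0 => //; case: ifP => // r0.
by have /andP[] := exp_kernel_bounds r0 (fine_ge0 (measure_ge0 Lambda (hits (segment x y)))).
Qed.

Definition residual_const : R := t * expR (growth W Lambda * t).

(** A living cell has kernel at most t and [alive] at least 1. The bound does not depend on the
    points and can therefore be integrated over them. *)
Lemma residual_kernel_le (x y : E) k :
  \sum_(v <- generation k) residual_kernel x y v <= residual_const * 4^-1 ^+ k.
Proof.
have balv v := bounded_alive Y_mnw t_ge0 (P := P) v.
apply: (@le_trans _ _ (\sum_(v <- generation k) t * mean P (alive W Lambda L t v))).
  apply: ler_sum => v _; rewrite -meanZ //; apply: mean_le.
  - by apply: bpk; rewrite fine_ge0.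
  - by apply: bounded_rvM => //; exact: bounded_rv_cst.
  move=> w; rewrite /pair_kernel /alive.
  have /andP[c0 c1] := cell_pair_bounds W h x y v w.
  case: ifP => r0; last by rewrite !mulr0.
  have /andP[k0 k1] := exp_kernel_bounds r0 (fine_ge0 (measure_ge0 Lambda (hits (segment x y)))).
  have k2 : exp_kernel (rem v w) (b x y) <= t by apply: le_trans k1 _; exact: remaining_le.
  have e1 : 1 <= expR (growth W Lambda * rem v w).
    by rewrite -expR0 ler_expR mulr_ge0 // ltW // growth_gt0.
  apply: (@le_trans _ _ (1 * t)); first exact: ler_pM.
  by rewrite mul1r -[leLHS]mulr1 ler_wpM2l.
rewrite -mulr_sumr /residual_const -mulrA ler_wpM2l //.
exact: (mean_alive cW hWoo Y_mnw t_ge0 k).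
Qed.

Definition lifespan_kernel v w : R := if 0 <= rem v w then exp_kernel (rem v w) (a v w) else 0.

Lemma lifespan_kernel_ge0 v w : 0 <= lifespan_kernel v w.
Proof.
rewrite /lifespan_kernel; case: ifP => // r0.
by have /andP[] := exp_kernel_bounds r0 (rate_ge0 W Lambda h v w).
Qed.

Lemma bounded_lifespan_kernel v : bounded_rv (lifespan_kernel v).
Proof.
have mr : measurable_fun setT (fun w => rem v w) by exact: measurable_remaining.
split.
  apply: measurable_fun_ifT; last exact: measurable_cst.
    by apply: measurable_fun_ler => //; exact: measurable_cst.
  apply: measurable_exp_kernel => //; first by apply: (measurable_rate cW hWoo).
  by move=> w; exact: rate_ge0.
exists t => w; rewrite ger0_norm ?lifespan_kernel_ge0 // /lifespan_kernel; case: ifP => // r0.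
have /andP[_ k1] := exp_kernel_bounds r0 (rate_ge0 W Lambda h v w).
by apply: le_trans k1 _; exact: remaining_le.
Qed.

Definition in_cell v (p : E * Omega) : R := \1_(c v p.2) p.1.

Lemma bounded_in_cell v : bounded_rv (in_cell v).
Proof.
rewrite (_ : in_cell v = \1_[set p : E * Omega | c v p.2 p.1]).
  apply: bounded_rv_indic.
  apply: (@measurable_cell _ _ _ _ (fun u (p : E * Omega) => h u p.2) v _ W fst) => //.
  - by move=> u _; exact: (measurableT_comp (mh u) measurable_snd).
  - exact: measurable_compact.
by apply/funext => p; rewrite /in_cell !indicE; congr ((nat_of_bool _)%:R); apply/idP/idP; rewrite !inE.
Qed.

Lemma in_cell_ge0 v p : 0 <= in_cell v p.
Proof. by rewrite /in_cell indicE. Qed.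

Lemma pair_kernelE x y v w :
  pk x y v w (a v w) = in_cell v (x, w) * (in_cell v (y, w) * lifespan_kernel v w).
Proof. by rewrite /pair_kernel /cell_pair -mulrA. Qed.

Lemma bounded_split_kernel v : bounded_rv (fun p : E * E => split_kernel p.1 p.2 v).
Proof.
pose f (q : (E * E) * Omega) : R :=
  in_cell v (q.1.1, q.2) * (in_cell v (q.1.2, q.2) * lifespan_kernel v q.2).
have bf : bounded_rv f.
  have m1 : measurable_fun setT (fun q : (E * E) * Omega => (q.1.1, q.2)).
    apply: measurable_fun_pair; last exact: measurable_snd.
    exact: (measurableT_comp measurable_fst measurable_fst).
  have m2 : measurable_fun setT (fun q : (E * E) * Omega => (q.1.2, q.2)).
    apply: measurable_fun_pair; last exact: measurable_snd.
    exact: (measurableT_comp measurable_snd measurable_fst).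
  apply: bounded_rvM; first exact: (bounded_rv_comp (bounded_in_cell v) m1).
  apply: bounded_rvM; first exact: (bounded_rv_comp (bounded_in_cell v) m2).
  exact: (bounded_rv_comp (bounded_lifespan_kernel v) measurable_snd).
have := @bounded_rv_mean _ _ _ _ _ P f bf; congr (bounded_rv _).
apply/funext => p; congr mean; apply/funext => w.
by rewrite pair_kernelE.
Qed.

End kernel_of_pairs.

(** * Integration over one section of W *)

Section hyperplane_section.
Variables (R : realType) (n : nat).
Local Notation E := 'rV[R]_n.+1.
Local Notation Hy := (hyperplane R n).
Variables (W : set E) (Lambda : {measure set Hy -> \bar R}).
Hypotheses (cW : compact W) (kW : convex_set W) (hWoo : (Lambda (hits W) < +oo)%E).
Hypothesis Lambda_null : forall H : Hy, Lambda [set H] = 0%E.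
Local Notation LW := (hitting_measure cW hWoo).
Variable H : Hy.
Local Notation D := (W `&` points H).

Lemma measurable_section : measurable D.
Proof. by apply: measurableI; [exact: measurable_compact|exact: measurable_points]. Qed.

Lemma section_lty : (hyperplane_lebesgue H D < +oo)%E.
Proof.
apply: le_lt_trans (ltry (vol_max cW)); apply: hyperplane_lebesgue_le.
  exact: measurable_section.
exact: subIsetl.
Qed.

Definition section_measure : set E -> \bar R := mfrestr measurable_section section_lty.
HB.instance Definition _ := FiniteMeasure.on section_measure.
Local Notation nu := section_measure.

Lemma section_measureE c : c `<=` W -> nu c = hyperplane_lebesgue H c.
Proof.
move=> cc; rewrite /section_measure /mfrestr /mrestr setIA (setIidl cc).
exact: hyperplane_lebesgue_setI.
Qed.

Lemma section_measure_le c : measurable c -> (nu c <= hyperplane_lebesgue H c)%E.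
Proof.
move=> mc; apply: le_measure; rewrite ?inE //.
by apply: measurableI => //; exact: measurable_section.
Qed.

Lemma section_measure_out : nu (~` D) = 0%E.
Proof. by rewrite /section_measure /mfrestr /mrestr setICl measure0. Qed.

Definition point_mass (x : E) : R := mean LW (\1_[set K : Hy | points K x]).

Lemma bounded_incidence : bounded_rv (fun p : E * Hy => \1_[set K : Hy | points K p.1] p.2 : R).
Proof.
rewrite (_ : (fun p => _) = \1_[set p : E * Hy | sdist p.2 p.1 = 0]).
  apply/bounded_rv_indic/measurable_set_eq; last exact: measurable_cst.
  by apply: measurable_fun_sdist; [exact: measurable_snd|exact: measurable_fst].
apply/funext => p; rewrite !indicE; congr ((nat_of_bool _)%:R).
by apply/idP/idP; rewrite !inE /= points_sdist.
Qed.

Lemma point_mass0 (x : E) : point_mass x = 0 -> LW [set K | points K x] = 0%E.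
Proof.
rewrite /point_mass mean_indic; last exact: measurable_points_through.
have fL : LW [set K | points K x] \is a fin_num.
  by apply: fin_num_measure; exact: measurable_points_through.
by move=> H0; rewrite -[LHS]fineK // H0.
Qed.

Definition exceptional : set E := ~` D `|` [set x | point_mass x <> 0].

Lemma bounded_point_mass : bounded_rv point_mass.
Proof. exact: (@bounded_rv_mean _ _ _ _ _ LW _ bounded_incidence). Qed.

Lemma point_mass_ge0 x : 0 <= point_mass x.
Proof. by apply: mean_ge0 => K; rewrite indicE. Qed.

(* By Fubini, since hyperplanes other than [H] meet it in null sets and [H]
   itself is not an atom. *)
Lemma mean_point_mass : mean nu point_mass = 0.
Proof.
rewrite (@mean_swap _ _ _ _ _ nu LW _ bounded_incidence); last first.
  by move=> p; rewrite indicE.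
rewrite (@mean_off_null _ _ _ LW [set H] _ (fun=> 0)).
- by rewrite mean_cst mul0r.
- exact: measurable_set1_hyperplane.
- exact: hitting_measure_null.
- have bi : bounded_rv (fun q : Hy * E => \1_[set K : Hy | points K q.2] q.1 : R).
    apply: (bounded_rv_comp (g := fun q : Hy * E => (q.2, q.1)) bounded_incidence).
    by apply: measurable_fun_pair; [exact: measurable_snd|exact: measurable_fst].
  exact: (@bounded_rv_mean _ _ _ _ _ nu _ bi).
- exact: bounded_rv_cst.
move=> K HK; rewrite (_ : (fun x => _) = \1_(points K)); last first.
  by apply/funext => x; rewrite !indicE.
rewrite mean_indic; last exact: measurable_points.
suff nuK : nu (points K) = 0%E by exact: (congr1 fine nuK).
apply/eqP; rewrite eq_le measure_ge0 andbT.
apply: le_trans (section_measure_le (measurable_points K)) _.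
by rewrite hyperplane_lebesgue_points.
Qed.

Lemma measurable_exceptional : measurable exceptional.
Proof.
apply: measurableU; first by apply: measurableC; exact: measurable_section.
have -> : [set x | point_mass x <> 0] = ~` [set x | point_mass x = 0] by [].
apply/measurableC/measurable_set_eq; last exact: measurable_cst.
by have [] := bounded_point_mass.
Qed.

Lemma exceptional_null : nu exceptional = 0%E.
Proof.
apply: null_set_setU.
- by apply: measurableC; exact: measurable_section.
- have -> : [set x | point_mass x <> 0] = ~` [set x | point_mass x = 0] by [].
  apply/measurableC/measurable_set_eq; last exact: measurable_cst.
  by have [] := bounded_point_mass.
- exact: section_measure_out.
- by apply: mean_eq0; [exact: bounded_point_mass|exact: point_mass_ge0|exact: mean_point_mass].
Qed.

Lemma not_exceptional x : ~ exceptional x -> W x /\ LW [set K | points K x] = 0%E.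
Proof.
move=> /not_orP[/contrapT [Wx _] /contrapT H0]; split => //.
exact: point_mass0.
Qed.

Variables (d : measure_display) (Omega : measurableType d) (P : probability Omega R).
Variables (L : seq bool -> Omega -> \bar R) (h : seq bool -> Omega -> Hy).
Hypothesis Y_mnw : mnw_process Lambda L h P W.
Variables (t : R) (t_ge0 : 0 <= t).
Local Notation c v w := (cell W (h^~ w) v).
Local Notation b x y := (fine (Lambda (hits (segment x y)))).
Local Notation sk := (split_kernel W Lambda P L h t).
Local Notation lk := (lifespan_kernel W Lambda L h t).

Let bvol v : bounded_rv (fun w => vol H (c v w)).
Proof.
have mv := measurable_vol_prod cW (g := h) (v := v) (fun u _ => (let: And3 _ mh _ := Y_mnw in mh u)).
split; first exact: (measurableT_comp mv (pair2_measurable H)).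
exists (vol_max cW) => w; rewrite ger0_norm ?vol_ge0 //; apply: vol_le; last exact: cell_sub.
exact: measurable_cell1.
Qed.

(** For a fixed outcome the kernel is a product of the indicators of x and y with a factor free of
    both points; by Tonelli the two integrations over H each produce the volume of the section. *)
Lemma mean_split_kernel v :
  mean nu (fun x => mean nu (fun y => sk x y v)) =
  mean P (fun w => lk v w * vol H (c v w) ^+ 2).
Proof.
have bi := bounded_in_cell cW Y_mnw v.
have bl := bounded_lifespan_kernel cW hWoo Y_mnw t_ge0 v.
have i0 p : 0 <= in_cell W h v p by exact: in_cell_ge0.
have l0 w : 0 <= lk v w by exact: lifespan_kernel_ge0.
have v0 w : 0 <= vol H (c v w) by exact: vol_ge0.
have iw w : bounded_rv (fun y => in_cell W h v (y, w)).
  exact: (bounded_rv_slice2 w bi).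
have mi w : mean nu (fun y => in_cell W h v (y, w)) = vol H (c v w).
  rewrite [mean _ _](mean_indic nu (measurable_cell1 cW (h^~ w) v)).
  by congr fine; apply: section_measureE; exact: cell_sub.
have inner x : mean nu (fun y => sk x y v) =
    mean P (fun w => in_cell W h v (x, w) * (lk v w * vol H (c v w))).
  pose g (p : E * Omega) := in_cell W h v p * (in_cell W h v (x, p.2) * lk v p.2).
  have bg : bounded_rv g.
    apply: bounded_rvM => //.
    apply: (bounded_rv_comp (g := snd) (f := fun w => in_cell W h v (x, w) * lk v w)); last exact: measurable_snd.
    by apply: bounded_rvM => //; exact: (bounded_rv_slice x bi).
  transitivity (mean nu (fun y => mean P (fun w => g (y, w)))).
    congr mean; apply/funext => y; congr mean; apply/funext => w.
    by rewrite pair_kernelE /g /=; ring.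
  rewrite mean_swap //; last by move=> p; rewrite /g !mulr_ge0.
  congr mean; apply/funext => w; rewrite /g /=.
  rewrite (_ : (fun y => _) = fun y => (in_cell W h v (x, w) * lk v w) * in_cell W h v (y, w)).
    by rewrite meanZ // mi mulrA.
  by apply/funext => y; rewrite mulrC.
under [X in mean _ X]eq_fun do rewrite inner.
pose g (p : E * Omega) := in_cell W h v p * (lk v p.2 * vol H (c v p.2)).
have bg : bounded_rv g.
  apply: bounded_rvM => //.
  apply: (bounded_rv_comp (g := snd) (f := fun w => lk v w * vol H (c v w))); last exact: measurable_snd.
  exact: bounded_rvM.
rewrite (@mean_swap _ _ _ _ _ nu P g bg); last by move=> p; rewrite /g !mulr_ge0.
congr mean; apply/funext => w; rewrite /g /=.
rewrite (_ : (fun y => _) = fun y => (lk v w * vol H (c v w)) * in_cell W h v (y, w)).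
  by rewrite meanZ // mi expr2 mulrA.
by apply/funext => y; rewrite mulrC.
Qed.

(** Formed with the restricted measure, so that it is finite and measurable for all pairs of points.
    For points of W, convexity keeps the segment in W and the value is Lambda[xy]. *)
Definition separation (p : E * E) : R := fine (LW (hits (segment p.1 p.2))).

Lemma separationE x y : W x -> W y -> separation (x, y) = b x y.
Proof.
by move=> Wx Wy; congr fine; apply: hitting_measure_hits; exact: segment_convex.
Qed.

Lemma bounded_kernel : bounded_rv (fun p => exp_kernel t (separation p)).
Proof.
have s0 p : 0 <= separation p by rewrite fine_ge0.
split; last first.
  exists t => p; have /andP[k0 k1] := exp_kernel_bounds t_ge0 (s0 p).
  by rewrite ger0_norm.
apply: measurable_exp_kernel => //.
apply: measurableT_comp; first exact: fine_measurable.
apply: (@measurable_measure_section _ _ _ _ _ LW (fun p : E * E => hits (segment p.1 p.2))).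
rewrite (_ : [set _ | _] = [set q : (E * E) * Hy | sdist q.2 q.1.1 * sdist q.2 q.1.2 <= 0]); last first.
  by apply/seteqP; split => q /hits_segmentP.
apply: measurable_set_le; last exact: measurable_cst.
apply: measurable_funM; apply: measurable_fun_sdist; try exact: measurable_snd.
  exact: (measurableT_comp measurable_fst measurable_fst).
exact: (measurableT_comp measurable_snd measurable_fst).
Qed.

Definition section_energy k : R :=
  \sum_(0 <= j < k) \sum_(v <- generation j) mean P (fun w => lk v w * vol H (c v w) ^+ 2).

Let K (p : E * E) : R := exp_kernel t (separation p).
Let S k (p : E * E) : R := \sum_(0 <= j < k) \sum_(v <- generation j) sk p.1 p.2 v.

Let bS k : bounded_rv (S k).
Proof.
apply: bounded_rv_sum => j _; apply: bounded_rv_sum => v _.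
exact: (bounded_split_kernel cW hWoo Y_mnw t_ge0 v).
Qed.

Let mean_S k : mean nu (fun x => mean nu (fun y => S k (x, y))) = section_energy k.
Proof.
have bs v := bounded_split_kernel cW hWoo Y_mnw t_ge0 v.
have bs1 v x : bounded_rv (fun y => sk x y v) by exact: (bounded_rv_slice x (bs v)).
have bs2 v : bounded_rv (fun x => mean nu (fun y => sk x y v)).
  exact: (@bounded_rv_mean _ _ _ _ _ nu _ (bs v)).
rewrite (_ : (fun x => _) = fun x => \sum_(0 <= j < k) \sum_(v <- generation j) mean nu (fun y => sk x y v)).
  rewrite mean_sum; last by move=> j _; apply: bounded_rv_sum.
  apply: eq_bigr => j _; rewrite mean_sum //; apply: eq_bigr => v _.
  exact: mean_split_kernel.
apply/funext => x; rewrite /S mean_sum; last by move=> j _; apply: bounded_rv_sum => v _; exact: bs1.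
by apply: eq_bigr => j _; rewrite mean_sum // => v _; exact: bs1.
Qed.

(** The telescoped kernel differs from its partial sum by at most [e], uniformly outside the
    exceptional points. Integrating over two points multiplies the error by at most the squared
    volume. *)
Lemma section_bounds k :
  section_energy k <= mean nu (fun x => mean nu (fun y => K (x, y))) <=
  section_energy k + residual_const W Lambda t * 4^-1 ^+ k * vol_max cW ^+ 2.
Proof.
have bK : bounded_rv K by exact: bounded_kernel.
have mx := measurable_exceptional; have nx := exceptional_null.
set e := residual_const W Lambda t * 4^-1 ^+ k.
have e0 : 0 <= e.
  by rewrite /e /residual_const !mulr_ge0 ?expR_ge0 ?exprn_ge0 ?invr_ge0.
have pointwise x y : ~ exceptional x -> ~ exceptional y ->
    S k (x, y) <= K (x, y) <= S k (x, y) + e.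
  move=> /not_exceptional[Wx x0] /not_exceptional[Wy y0].
  rewrite /K separationE // (kernel_telescope kW Y_mnw t_ge0 k x0 y0 Wx Wy).
  rewrite lerDl lerD2l (residual_kernel_le cW hWoo Y_mnw t_ge0) andbT.
  by apply: sumr_ge0 => v _; exact: residual_kernel_ge0.
have bSe : bounded_rv (fun p => S k p + e) by apply: bounded_rvD => //; exact: bounded_rv_cst.
have mono f g : bounded_rv f -> bounded_rv g ->
    (forall x y, ~ exceptional x -> ~ exceptional y -> f (x, y) <= g (x, y)) ->
    mean nu (fun x => mean nu (fun y => f (x, y))) <= mean nu (fun x => mean nu (fun y => g (x, y))).
  move=> bf bg fg; apply: (mean_le_off_null mx nx).
  - exact: (@bounded_rv_mean _ _ _ _ _ nu _ bf).
  - exact: (@bounded_rv_mean _ _ _ _ _ nu _ bg).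
  move=> x nex; apply: (mean_le_off_null mx nx).
  - exact: bounded_rv_slice.
  - exact: bounded_rv_slice.
  by move=> y ney; exact: fg.
apply/andP; split.
  by rewrite -mean_S; apply: mono => // x y nex ney; have /andP[] := pointwise x y nex ney.
apply: (@le_trans _ _ (mean nu (fun x => mean nu (fun y => S k (x, y) + e)))).
  by apply: (mono K _ bK bSe) => x y nex ney; have /andP[] := pointwise x y nex ney.
have bSx x : bounded_rv (fun y => S k (x, y)) by exact: bounded_rv_slice.
rewrite (_ : (fun x => _) = fun x => mean nu (fun y => S k (x, y)) + e * fine (nu setT)); last first.
  by apply/funext => x; rewrite meanD //; [rewrite mean_cst|exact: bounded_rv_cst].
rewrite meanD; [|exact: (@bounded_rv_mean _ _ _ _ _ nu _ (bS k))|exact: bounded_rv_cst].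
rewrite mean_cst mean_S lerD2l -mulrA ler_wpM2l //.
have nu0 : 0 <= fine (nu setT) by rewrite fine_ge0.
have nuC : fine (nu setT) <= vol_max cW.
  rewrite -lee_fin fineK; last exact: fin_num_measure.
  rewrite /section_measure /mfrestr /mrestr setTI.
  apply: hyperplane_lebesgue_le; first exact: measurable_section.
  exact: subIsetl.
by rewrite expr2; apply: ler_pM.
Qed.

Lemma section_integral :
  (\int[hyperplane_lebesgue H]_(x in D) \int[hyperplane_lebesgue H]_(y in D)
     (exp_kernel t (b x y))%:E =
   (mean nu (fun x => mean nu (fun y => K (x, y))))%:E)%E.
Proof.
have bK : bounded_rv K by exact: bounded_kernel.
have K0 p : 0 <= K p.
  have s0 : 0 <= separation p by rewrite fine_ge0.
  by have /andP[] := exp_kernel_bounds t_ge0 s0.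
rewrite -integral_mean; last exact: (@bounded_rv_mean _ _ _ _ _ nu _ bK).
rewrite [RHS]integral_mfrestr; first last.
- by move=> x; rewrite lee_fin; exact: mean_ge0.
- by apply/measurable_EFinP; have [] := @bounded_rv_mean _ _ _ _ _ nu _ bK.
apply: eq_integral => x; rewrite inE => -[Wx _].
have bKx : bounded_rv (fun y => K (x, y)) by exact: bounded_rv_slice.
rewrite -integral_mean // [RHS]integral_mfrestr; first last.
- by move=> y; rewrite lee_fin.
- by apply/measurable_EFinP; have [] := bKx.
by apply: eq_integral => y; rewrite inE => -[Wy _]; rewrite /K separationE.
Qed.

End hyperplane_section.

(** * Integration over hyperplanes and conclusion *)

Section variance_integral.
Variables (R : realType) (n : nat).
Local Notation E := 'rV[R]_n.+1.
Local Notation Hy := (hyperplane R n).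
Variables (W : set E) (Lambda : {measure set Hy -> \bar R}).
Hypotheses (cW : compact W) (kW : convex_set W) (hWoo : (Lambda (hits W) < +oo)%E).
Hypothesis Lambda_null : forall H : Hy, Lambda [set H] = 0%E.
Variables (d : measure_display) (Omega : measurableType d) (P : probability Omega R).
Variables (L : seq bool -> Omega -> \bar R) (h : seq bool -> Omega -> Hy).
Hypothesis Y_mnw : mnw_process Lambda L h P W.
Local Notation LW := (hitting_measure cW hWoo).
Variables (t : R) (t_ge0 : 0 <= t).
Variables (z : Hy -> R) (Mz : R).
Hypotheses (mz : measurable_fun setT z) (zM : forall H, `|z H| <= Mz).
Local Notation c v w := (cell W (h^~ w) v).
Local Notation lk := (lifespan_kernel W Lambda L h t).
Local Notation se H k := (section_energy W Lambda H P L h t k).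

Let mh v : measurable_fun setT (h v). Proof. by have [] := Y_mnw. Qed.

Let cell_energy v (p : Omega * Hy) : R := lk v p.1 * weight z (c v p.1) p.2 ^+ 2.

Let bounded_cell_energy v : bounded_rv (cell_energy v).
Proof.
apply: bounded_rvM.
  exact: (bounded_rv_comp (bounded_lifespan_kernel cW hWoo Y_mnw t_ge0 v) measurable_fst).
by apply: bounded_rvX; exact: (bounded_weight_prod cW mz zM (g := h)).
Qed.

Let cell_energy_ge0 v p : 0 <= cell_energy v p.
Proof. by rewrite mulr_ge0 ?sqr_ge0 ?lifespan_kernel_ge0. Qed.

Let bounded_cell_mean v : bounded_rv (fun H => mean P (fun w => cell_energy v (w, H))).
Proof.
apply: (@bounded_rv_mean _ _ _ _ _ P (fun q : Hy * Omega => cell_energy v (q.2, q.1))).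
apply: (bounded_rv_comp (bounded_cell_energy v)).
by apply: measurable_fun_pair; [exact: measurable_snd|exact: measurable_fst].
Qed.

Let mean_cell_energy v : mean LW (fun H => mean P (fun w => cell_energy v (w, H))) =
  mean P (fun w => facet_value W z t L h v w ^+ 2).
Proof.
rewrite -(@mean_swap _ _ _ _ _ P LW (cell_energy v)) //.
rewrite (facet_sqr cW hWoo Y_mnw t_ge0 mz zM); congr mean; apply/funext => w.
rewrite /cell_energy /= meanZ; last by apply: bounded_rvX; exact: bounded_weight.
rewrite -/(second_moment cW hWoo z (c v w)) /lifespan_kernel.
by case: ifP => _; rewrite ?mul0r // mulrC.
Qed.

Let weighted_energy k H : R := z H ^+ 2 * se H k.

Let weighted_energyE k H : weighted_energy k H =
  \sum_(0 <= j < k) \sum_(v <- generation j) mean P (fun w => cell_energy v (w, H)).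
Proof.
rewrite /weighted_energy mulr_sumr; apply: eq_bigr => j _.
rewrite mulr_sumr; apply: eq_bigr => v _; rewrite -meanZ; last first.
  apply: bounded_rvM; first exact: (bounded_lifespan_kernel cW hWoo Y_mnw t_ge0 v).
  apply: bounded_rvX; have mv := measurable_vol_prod cW (g := h) (v := v) (fun u _ => mh u).
  split; first exact: (measurableT_comp mv (pair2_measurable H)).
  exists (vol_max cW) => w; rewrite ger0_norm ?vol_ge0 //; apply: vol_le; last exact: cell_sub.
  exact: measurable_cell1.
by congr mean; apply/funext => w; rewrite /cell_energy /weight /=; ring.
Qed.

Let bounded_weighted_energy k : bounded_rv (weighted_energy k).
Proof.
rewrite (_ : weighted_energy k = fun H => \sum_(0 <= j < k) \sum_(v <- generation j)
    mean P (fun w => cell_energy v (w, H))); last by apply/funext => H; exact: weighted_energyE.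
by apply: bounded_rv_sum => j _; apply: bounded_rv_sum => v _.
Qed.

Let weighted_energy_ge0 k H : 0 <= weighted_energy k H.
Proof.
rewrite weighted_energyE; apply: sumr_ge0 => j _; apply: sumr_ge0 => v _.
by apply: mean_ge0.
Qed.

Lemma mean_section_energy k :
  mean LW (weighted_energy k) = \sum_(0 <= j < k) energy W P L h t z j.
Proof.
rewrite (_ : weighted_energy k = fun H => \sum_(0 <= j < k) \sum_(v <- generation j)
    mean P (fun w => cell_energy v (w, H))); last by apply/funext => H; exact: weighted_energyE.
rewrite mean_sum; last by move=> j _; apply: bounded_rv_sum => v _.
apply: eq_bigr => j _; rewrite mean_sum; last by move=> v _.
by apply: eq_bigr => v _; exact: mean_cell_energy.
Qed.

(** The partial sums agree exactly with those of the variance because both are built from the second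
    moments in [facet_sqr]; only the remainder of the pair series has to be bounded, uniformly in
    H. *)
Lemma variance_integral_bounds : exists2 B, 0 <= B & forall k,
  ((\sum_(0 <= j < k) energy W P L h t z j)%:E <=
   \int[Lambda]_(H in hits W) ((z H ^+ 2)%:E *
     \int[hyperplane_lebesgue H]_(x in W `&` points H)
       \int[hyperplane_lebesgue H]_(y in W `&` points H)
         (exp_kernel t (fine (Lambda (hits (segment x y)))))%:E) <=
   (\sum_(0 <= j < k) energy W P L h t z j + B * 4^-1 ^+ k)%:E)%E.
Proof.
pose B1 : R := Mz ^+ 2 * (residual_const W Lambda t * vol_max cW ^+ 2).
have rc0 : 0 <= residual_const W Lambda t by rewrite mulr_ge0 ?expR_ge0.
have B10 : 0 <= B1 by apply: mulr_ge0; [exact: sqr_ge0|apply: mulr_ge0 => //; exact: sqr_ge0].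
have LT0 : 0 <= fine (LW setT) by rewrite fine_ge0.
exists (B1 * fine (LW setT)) => [|k]; first exact: mulr_ge0.
pose F H : R := z H ^+ 2 * mean (section_measure cW H) (fun x =>
  mean (section_measure cW H) (fun y => exp_kernel t (separation cW hWoo (x, y)))).
rewrite (eq_integral (fun H => (F H)%:E)); last first.
  by move=> H _; rewrite section_integral // -EFinM.
have q0 : 0 <= 4^-1 ^+ k :> R by rewrite exprn_ge0 ?invr_ge0.
have FB H : weighted_energy k H <= F H <= weighted_energy k H + B1 * 4^-1 ^+ k.
  have /andP[h1 h2] := section_bounds cW kW hWoo Lambda_null H Y_mnw t_ge0 k.
  rewrite /F /weighted_energy ler_wpM2l ?sqr_ge0 //=.
  apply: le_trans (ler_wpM2l (sqr_ge0 (z H)) h2) _.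
  have z2 : z H ^+ 2 <= Mz ^+ 2.
    by rewrite -[leLHS]real_normK ?num_real // lerXn2r // nnegrE // (le_trans _ (zM H)).
  have -> : B1 * 4^-1 ^+ k = Mz ^+ 2 * (residual_const W Lambda t * 4^-1 ^+ k * vol_max cW ^+ 2).
    by rewrite /B1; ring.
  rewrite mulrDr lerD2l; apply: ler_wpM2r => //.
  by apply: mulr_ge0; [exact: mulr_ge0|exact: sqr_ge0].
have F0 H : 0 <= F H by have /andP[h1 _] := FB H; exact: le_trans h1.
have restrict (g : Hy -> R) : measurable_fun setT g -> (forall H, 0 <= g H) -> bounded_rv g ->
    (\int[Lambda]_(H in hits W) (g H)%:E = (mean LW g)%:E)%E.
  move=> mg g0 bg; rewrite -integral_mean // [RHS]integral_mfrestr //.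
  exact/measurable_EFinP.
(* [F] is not shown to be measurable in H. It is squeezed between measurable functions by a
   monotonicity of the integral that asks no measurability of either side. *)
have mono (f g : Hy -> R) : (forall H, 0 <= f H) -> (forall H, f H <= g H) ->
    (\int[Lambda]_(H in hits W) (f H)%:E <= \int[Lambda]_(H in hits W) (g H)%:E)%E.
  move=> f0 fg; rewrite (integral_mkcond (hits W)) [leRHS]integral_mkcond.
  apply: (@ge0_le_integral_off_null _ _ _ Lambda set0) => //.
  - by move=> H; rewrite patchE; case: ifP => // _; rewrite lee_fin.
  - by move=> H; rewrite patchE; case: ifP => // _; rewrite lee_fin (le_trans (f0 H)).
  - by move=> H _; rewrite !patchE; case: ifP => // _; rewrite lee_fin.
have bw := bounded_weighted_energy k; have [mw _] := bw.
rewrite -mean_section_energy; apply/andP; split.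
  rewrite -restrict //; apply: mono => H; first exact: weighted_energy_ge0.
  by have /andP[] := FB H.
apply: (@le_trans _ _ (\int[Lambda]_(H in hits W) (weighted_energy k H + B1 * 4^-1 ^+ k)%:E)%E).
  by apply: mono => // H; have /andP[] := FB H.
have bc : bounded_rv (fun H => weighted_energy k H + B1 * 4^-1 ^+ k).
  by apply: bounded_rvD => //; exact: bounded_rv_cst.
have [mc _] := bc; rewrite restrict //; last first.
  by move=> H; apply: addr_ge0; [exact: weighted_energy_ge0|exact: mulr_ge0].
rewrite lee_fin meanD //; last exact: bounded_rv_cst.
by rewrite mean_cst lerD2l mulrAC.
Qed.

End variance_integral.

(** A single hyperplane of positive measure would be a measurable set whose only subsets are empty
    or full, leaving no room for an intermediate measure. *)
Lemma non_atomic_set1 (R : realType) (n : nat) (Lambda : {measure set (hyperplane R n) -> \bar R}) :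
  non_atomic Lambda -> forall H, Lambda [set H] = 0%E.
Proof.
move=> na H; apply/eqP; rewrite eq_le measure_ge0 andbT leNgt; apply/negP => H0.
have [B [_ BH /andP[B0 BL]]] := na _ (measurable_set1_hyperplane H) H0.
have [BE|/set0P BE] := eqVneq B set0; first by move: B0; rewrite BE measure0 ltxx.
have [K BK] := BE; move: BL; rewrite (_ : B = [set H]) ?ltxx //.
by apply/seteqP; split => // K' ->; rewrite -(BH K BK).
Qed.

Lemma measurable_unit_sphere (R : realType) (n : nat) : measurable (@unit_sphere R n).
Proof.
apply: measurable_set_eq; last exact: measurable_cst.
by apply: measurable_fun_dotr; exact: measurable_id.
Qed.

Theorem mainTheorem9 (R : realType) (n : nat) (W : set 'rV[R]_n.+1)
    (Lambda : {measure set (hyperplane R n) -> \bar R}) (t : R)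
    (zeta : 'rV[R]_n.+1 -> R)
    (d : measure_display) (Omega : measurableType d) (P : probability Omega R)
    (L : seq bool -> Omega -> \bar R)
    (h : seq bool -> Omega -> hyperplane R n)
    (W_compact : compact W) (W_convex : convex_set W)
    (W_volume : (0 < lebesgue_rV R n.+1 W)%E)
    (Lambda_non_atomic : non_atomic Lambda)
    (Lambda_locally_finite : locally_finite Lambda)
    (t_gt0 : 0 < t)
    (zeta_bounded : exists M : R, forall u, unit_sphere u -> `|zeta u| <= M)
    (zeta_measurable : measurable_fun (@unit_sphere R n) zeta)
    (zeta_even : forall u, unit_sphere u -> zeta (- u) = zeta u)
    (Y_mnw : mnw_process Lambda L h P W) :
  ('V_P[fun w => Sigma_phi zeta W (L ^~ w) (h ^~ w) t] =
   \int[Lambda]_(H in hits W)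
     ((zeta (normal H) ^+ 2)%:E *
      \int[hyperplane_lebesgue H]_(x in W `&` points H)
        \int[hyperplane_lebesgue H]_(y in W `&` points H)
          (exp_kernel t (fine (Lambda (hits (segment x y)))))%:E))%E.
Proof.
have hWoo : (Lambda (hits W) < +oo)%E.
  apply: Lambda_locally_finite; first exact: compact_bounded.
  exact: measurable_hits.
have Lambda_null := non_atomic_set1 Lambda_non_atomic.
have normal_unit H : unit_sphere (normal H : 'rV[R]_n.+1) by exact: dotr_normal.
have [M zM0] := zeta_bounded.
have zM (H : hyperplane R n) : `|zeta (normal H)| <= M by exact: zM0.
have mz : measurable_fun setT (fun H : hyperplane R n => zeta (normal H)).
  have sub : (@normal R n) @` setT `<=` @unit_sphere R n by move=> _ [H _ <-].
  exact: (measurable_comp (@measurable_unit_sphere R n) sub zeta_measurable (@measurable_normal R n)).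
have t_ge0 := ltW t_gt0.
have [V [D [-> VD]]] := variance_Sigma_phi W_compact hWoo Lambda_null Y_mnw t_ge0 mz zM.
have [B B0 XB] := variance_integral_bounds W_compact W_convex hWoo Lambda_null Y_mnw t_ge0 mz zM.
move: XB; set X := (\int[Lambda]_(H in hits W) _)%E => XB.
(* At k = 0 the partial sum is empty and the bounds read 0 <= X <= B. *)
have : X \is a fin_num.
  have /andP[X0 X1] := XB 0%N.
  by rewrite fin_numElt (lt_le_trans _ X0) ?ltNyr // (le_lt_trans X1) ?ltry.
case: X XB => [x| |] // XB _; congr EFin; apply/eqP; rewrite eq_le; apply/andP; split.
  apply: (@geometric_le _ _ _ D 2^-1); first by lra.
  move=> k; have /andP[+ _] := XB k; rewrite lee_fin.
  by have := VD k; rewrite ler_norml => /andP[? ?]; lra.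
apply: (@geometric_le _ _ _ (D + B) 2^-1); first by lra.
move=> k; have /andP[_] := XB k; rewrite lee_fin.
(* The faster error is weakened so that both errors decay at the rate 2^-k required by
   [geometric_le]. *)
have : B * 4^-1 ^+ k <= B * 2^-1 ^+ k.
  by apply: ler_wpM2l => //; apply: lerXn2r; rewrite ?nnegrE ?invr_ge0 //; lra.
by have := VD k; rewrite ler_norml => /andP[? ?]; lra.
Qed.
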